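(* Let $n=3$, $\Omega_0=B(0,1)\subset\mathbb{R}^3$, and consider spherically symmetric flows with positive bulk viscosity and zero heat conductivity, i.e. $\bar\mu>0$, $2\bar\mu+3\bar\lambda>0$, $\kappa=0$. Assume $0\le\alpha\le\frac{1}{\gamma-1}$. Let $\delta>0$ and let $C_1,C_2\in(0,\infty)$ be such that, for $y\in\Omega_0$ in a neighborhood of $\Gamma_0=\partial\Omega_0$, $$C_1^{-1}d^{\delta}(y)<\rho_0(y)<C_1d^{\delta}(y),\qquad C_2^{-1}d^{\delta-1}(y)<|\nabla_{\mathbf n}\rho_0(y)|<C_2d^{\delta-1}(y).$$ There is a small constant $d_0\in(0,1)$, depending only on $C_1$ and $C_2$, such that the following holds. Assume that there exists $r_0\in(1-d_0,1)$ with $$\frac{y}{|y|}\cdot\mathbf u_0(y)>0\ \text{ for } |y|=r_0,\qquad \frac{y}{|y|}\cdot\mathbf u_0(y)\ge 0\ \text{ for } r_0<|y|<1.$$ Then, for any positive time $T$, the vacuum free boundary problem (FBP) described in the context has no solution $(\rho,\mathbf u,\theta)$ on $[0,T]$ satisfying $$\rho,\theta\in C^{1,1}(\Omega(t)\times[0,T])\cap C(\overline{\Omega(t)}\times[0,T]),$$ $$\mathbf u\in C^2_1(\Omega(t)\times[0,T])\cap C(\overline{\Omega(t)}\times[0,T])\cap L^\infty(0,T;W^{2,\infty}(\Omega(t))),\qquad \mathbf u_t\in L^\infty(0,T;L^\infty(\Omega(t))),$$ with entropy $s$ satisfying $$s\in L^\infty(0,T;W^{1,\infty}(\Omega(t))),\qquad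 s_t\in L^2(0,T;L^\infty(\Omega(t))).$$
   Context: Vacuum free boundary problem (FBP). The unknowns are an evolving simply connected open domain $\Omega(t)\subset\mathbb{R}^n$ (with $\Omega(0)=\Omega_0$ and boundary $\Gamma(t)=\partial\Omega(t)$), the density $\rho$, velocity $\mathbf u$ and absolute temperature $\theta$, with $\rho>0$, $\theta>0$ in $\Omega(t)$, satisfying in $\Omega(t)$ $$\rho_t+\mathrm{div}(\rho\mathbf u)=0,$$ $$(\rho\mathbf u)_t+\mathrm{div}(\rho\mathbf u\otimes\mathbf u)+\nabla p=\mathrm{div}\big(\mu(\nabla\mathbf u+(\nabla\mathbf u)^{\intercal})+\lambda\,\mathrm{div}\,\mathbf u\,\mathbb I_n\big),$$ $$c_v\partial_t(\rho\theta)+c_v\mathrm{div}(\rho\mathbf u\theta)+p\,\mathrm{div}\,\mathbf u=\tfrac{\mu}{2}|\nabla\mathbf u+(\nabla\mathbf u)^{\intercal}|^2+\lambda(\mathrm{div}\,\mathbf u)^2+\kappa\Delta\theta,$$ together with: the stress balance $\big(\mu(\nabla\mathbf u+(\nabla\mathbf u)^{\intercal})+\lambda\,\mathrm{div}\,\mathbf u\,\mathbb I_n-p\,\mathbb I_n\big)\mathbf n=0$ on $\Gamma(t)$; the kinematic condition that the normal velocity of $\Gamma(t)$ equals $\mathbf u\cdot\mathbf n|_{\Gamma(t)}$, where $\mathbf n$ is the exterior unit normal; the vacuum condition $\rho=\theta=0$ on $\Gamma(t)$; and the initial condition $(\rho,\mathbf u,\theta)|_{t=0}=(\rho_0,\mathbf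 u_0,\theta_0)$ in $\Omega_0$, where $\rho_0,\theta_0>0$ in $\Omega_0$ and $\rho_0=\theta_0=0$ on $\Gamma_0=\partial\Omega_0$. Transport coefficients: $\mu=\bar\mu\theta^\alpha$, $\lambda=\bar\lambda\theta^\alpha$, $\kappa=\bar\kappa\theta^\alpha$ with constants $\bar\mu>0$, $2\bar\mu+n\bar\lambda\ge0$, $\bar\kappa\ge0$, $\alpha\ge0$ (they are constants if $\alpha=0$). State equations: $p=R\rho\theta=\bar A e^{s(\gamma-1)/R}\rho^\gamma$, which defines the entropy $s$; here $\gamma>1$, $R>0$, $\bar A>0$ are constants and $c_v=R/(\gamma-1)$. Spherical symmetry: with $r=|y|$, $\rho$ and $\theta$ are functions of $(r,t)$ and $\mathbf u(y,t)=u(r,t)\,y/r$; then $\Omega(t)=B(0,\bar r(t))$. Notation: $d(y)$ is the distance from $y$ to $\Gamma_0$; $\nabla_{\mathbf n}$ is the outward normal derivative (near $\Gamma_0$, the derivative in the outward radial direction). ''$\Omega(t)\times[0,T]$'' means $\{(y,t):t\in[0,T],\,y\in\Omega(t)\}$, and similarly with $\overline{\Omega(t)}$. $C^{m_1}_{m_2}(\Omega(t)\times[0,T])$ is the set of functions that are $C^{m_1}$ in space and $C^{m_2}$ in time on this set, and $C^{1,1}$ means $C^1$ in space and $C^1$ in time. *)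

(* Defs.v *)
From mathcomp Require Import all_boot all_order all_algebra.
From mathcomp Require Import all_classical all_reals all_analysis.
From mathcomp Require Import ess_sup_inf.

Set Implicit Arguments.
Unset Strict Implicit.
Unset Printing Implicit Defensive.

Import Order.TTheory GRing.Theory Num.Theory.
Import numFieldNormedType.Exports.

Local Open Scope classical_set_scope.
Local Open Scope ring_scope.

(* The library norm on 'rV[R]_3 is the sup norm; lengths, balls and distances
   below are Euclidean. *)
Definition dotv (R : realType) (x y : 'rV[R]_3) : R :=
  \sum_(i < 3) x 0 i * y 0 i.
Definition enorm (R : realType) (y : 'rV[R]_3) : R := Num.sqrt (dotv y y).

Definition eball (R : realType) (r : R) : set 'rV[R]_3 := [set y | enorm y < r].
Definition esphere (R : realType) (r : R) : set 'rV[R]_3 :=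
  [set y | enorm y = r].

Definition radial (R : realType) (y : 'rV[R]_3) : 'rV[R]_3 :=
  (enorm y)^-1 *: y.

Definition dist_to (R : realType) (A : set 'rV[R]_3) (y : 'rV[R]_3) : R :=
  inf [set enorm (y - z) | z in A].

Definition evec (R : realType) (i : 'I_3) : 'rV[R]_3 := delta_mx 0 i.

Definition dx (R : realType) (i : 'I_3) (f : 'rV[R]_3 -> R -> R) :
    'rV[R]_3 -> R -> R :=
  fun y t => 'D_(evec R i) (fun z => f z t) y.

(* Derivative relative to the closed interval [0, T]: one-sided at 0 and T. *)
Definition tquot (R : realType) (T : R) (g : R -> R) (t : R) : set_system R :=
  (fun h : R => h^-1 * (g (t + h) - g t))
    @ within [set h : R | 0 <= t + h <= T] (0 : R)^'.
Definition tderivable (R : realType) (T : R) (g : R -> R) (t : R) : Prop :=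
  cvg (tquot T g t).
Definition tderiv (R : realType) (T : R) (g : R -> R) (t : R) : R :=
  lim (tquot T g t).

Definition dt (R : realType) (T : R) (f : 'rV[R]_3 -> R -> R) :
    'rV[R]_3 -> R -> R :=
  fun y t => tderiv T (f y) t.

Definition tube (R : realType) (T : R) (S : R -> set 'rV[R]_3) :
    set ('rV[R]_3 * R) :=
  [set z | 0 <= z.2 <= T /\ S z.2 z.1].

Definition cont_on (R : realType) (D : set ('rV[R]_3 * R))
    (f : 'rV[R]_3 -> R -> R) : Prop :=
  {within D, continuous (fun z : 'rV[R]_3 * R => f z.1 z.2)}.

Fixpoint C_space (R : realType) (m : nat) (D : set ('rV[R]_3 * R))
    (f : 'rV[R]_3 -> R -> R) : Prop :=
  cont_on D f /\
  match m with
  | 0 => True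
  | m'.+1 => forall i : 'I_3,
      (forall y t, D (y, t) -> derivable (fun z => f z t) y (evec R i)) /\
      C_space m' D (dx i f)
  end.

Fixpoint C_time (R : realType) (T : R) (m : nat) (D : set ('rV[R]_3 * R))
    (f : 'rV[R]_3 -> R -> R) : Prop :=
  cont_on D f /\
  match m with
  | 0 => True
  | m'.+1 =>
      (forall y t, D (y, t) -> tderivable T (f y) t) /\ C_time T m' D (dt T f)
  end.

Definition C_class (R : realType) (T : R) (m1 m2 : nat)
    (D : set ('rV[R]_3 * R)) (f : 'rV[R]_3 -> R -> R) : Prop :=
  C_space m1 D f /\ C_time T m2 D f.

(* The library has no measure on 'rV[R]_3: Lebesgue measure of R * R * R is
   used through the coordinates. *)
Definition vec3 (R : realType) (x : R * R * R) : 'rV[R]_3 :=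
  \row_(i < 3) [tuple x.1.1; x.1.2; x.2]`_i.

Definition Linf_norm (R : realType) (A : set 'rV[R]_3) (f : 'rV[R]_3 -> R) :
    \bar R :=
  ess_sup ((@lebesgue_measure R \x @lebesgue_measure R) \x @lebesgue_measure R)%E
    (fun x => if vec3 x \in A then `|f (vec3 x)|%:E else 0%E).

(* Norm of W^{k,oo}(A), A open.  It is only applied to functions of class C^k
   on A, whose weak derivatives are the classical ones. *)
Fixpoint Sobolev_norm (R : realType) (k : nat) (A : set 'rV[R]_3)
    (f : 'rV[R]_3 -> R) : \bar R :=
  match k with
  | 0 => Linf_norm A f
  | k'.+1 => (Linf_norm A f +
      \sum_(i < 3) Sobolev_norm k' A (fun y => 'D_(evec R i) f y))%E
  end.

Definition in_Linf_time (R : realType) (T : R) (N : R -> \bar R) : Prop :=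
  (ess_sup (@lebesgue_measure R)
     (fun t => if t \in `]0%R, T[ then N t else 0%E) < +oo)%E.

Definition in_L2_time (R : realType) (T : R) (N : R -> \bar R) : Prop :=
  (\int[@lebesgue_measure R]_(t in `]0%R, T[) (N t * N t) < +oo)%E.

(* [gamma] adiabatic exponent, [Rg] gas constant, [Abar] constant of the
   entropy form of the state equation; the transport coefficients are
   [mubar], [lambar], [kapbar] times the temperature to the power [alpha]. *)
Record fluid (R : realType) := Fluid {
  gamma : R; Rg : R; Abar : R;
  mubar : R; lambar : R; kapbar : R; alpha : R }.

Record admissible (R : realType) (P : fluid R) : Prop := Admissible {
  adm_gamma : 1 < gamma P;
  adm_Rg : 0 < Rg P;
  adm_Abar : 0 < Abar P;
  adm_mu : 0 < mubar P;
  adm_bulk : 0 <= 2 * mubar P + 3 * lambar P;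
  adm_kappa : 0 <= kapbar P;
  adm_alpha : 0 <= alpha P }.

Definition c_v (R : realType) (P : fluid R) : R := Rg P / (gamma P - 1).

Section FlowFields.
Variables (R : realType) (P : fluid R).
Variables (rho : 'rV[R]_3 -> R -> R) (u : 'rV[R]_3 -> R -> 'rV[R]_3)
          (theta : 'rV[R]_3 -> R -> R).

Definition vcoord (i : 'I_3) : 'rV[R]_3 -> R -> R := fun y t => u y t 0 i.

Definition mu y t : R := mubar P * theta y t `^ alpha P.
Definition lam y t : R := lambar P * theta y t `^ alpha P.
Definition kappa y t : R := kapbar P * theta y t `^ alpha P.
Definition pressure y t : R := Rg P * rho y t * theta y t.

Definition divu y t : R := \sum_(i < 3) dx i (vcoord i) y t.

(* entries of grad u + (grad u)^T *)
Definition strain2 (i j : 'I_3) y t : R :=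
  dx i (vcoord j) y t + dx j (vcoord i) y t.

Definition visc_stress (i j : 'I_3) y t : R :=
  mu y t * strain2 i j y t + (lam y t * divu y t) *+ (i == j).

Definition total_stress (i j : 'I_3) y t : R :=
  visc_stress i j y t - pressure y t *+ (i == j).

Definition mass_eq (T : R) y t : Prop :=
  dt T rho y t + \sum_(j < 3) dx j (fun z s => rho z s * vcoord j z s) y t = 0.

Definition momentum_eq (T : R) y t : Prop :=
  forall i : 'I_3,
    dt T (fun z s => rho z s * vcoord i z s) y t
    + \sum_(j < 3) dx j (fun z s => rho z s * vcoord i z s * vcoord j z s) y t
    + dx i pressure y t
    = \sum_(j < 3) dx j (visc_stress i j) y t.

Definition energy_eq (T : R) y t : Prop :=
  c_v P * dt T (fun z s => rho z s * theta z s) y t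
  + c_v P *
    (\sum_(j < 3) dx j (fun z s => rho z s * vcoord j z s * theta z s) y t)
  + pressure y t * divu y t
  = mu y t / 2 * (\sum_(i < 3) \sum_(j < 3) strain2 i j y t ^+ 2)
    + lam y t * divu y t ^+ 2
    + kappa y t * \sum_(i < 3) dx i (dx i theta) y t.

End FlowFields.

Record initial_data (R : realType) (rho0 theta0 : 'rV[R]_3 -> R) : Prop :=
  InitialData {
  init_pos : forall y, eball 1 y -> 0 < rho0 y /\ 0 < theta0 y;
  init_vac : forall y, esphere 1 y -> rho0 y = 0 /\ theta0 y = 0 }.

Definition boundary_profile (R : realType) (C1 C2 delta : R)
    (rho0 : 'rV[R]_3 -> R) : Prop :=
  exists U : set 'rV[R]_3, [/\ open U, esphere 1 `<=` U &
    forall y, eball 1 y -> U y ->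
      let d := dist_to (esphere 1) y in
      [/\ C1^-1 * d `^ delta < rho0 y < C1 * d `^ delta,
          derivable rho0 y (radial y) &
          C2^-1 * d `^ (delta - 1) < `|'D_(radial y) rho0 y|
            < C2 * d `^ (delta - 1)]].

(* Spherically symmetric solutions of the vacuum free boundary problem on
   [0, T], with Omega(t) the ball of radius [rb t], so that the exterior normal
   at y is [radial y] and the normal velocity of the boundary is rb'(t).
   As [u] and the fluxes are differentiated in the open ball only, the stress
   balance on the boundary is the vanishing of the interior trace. *)
Record FBP_solution (R : realType) (P : fluid R) (T : R)
    (rho0 : 'rV[R]_3 -> R) (u0 : 'rV[R]_3 -> 'rV[R]_3)
    (theta0 : 'rV[R]_3 -> R) (rb : R -> R) (rho : 'rV[R]_3 -> R -> R)
    (u : 'rV[R]_3 -> R -> 'rV[R]_3) (theta : 'rV[R]_3 -> R -> R) : Prop :=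
  FBPSolution {
  fbp_rb0 : rb 0 = 1;
  fbp_rb_pos : forall t, 0 <= t <= T -> 0 < rb t;
  fbp_sym_rho : exists f : R -> R -> R, forall y t, 0 <= t <= T ->
    enorm y <= rb t -> rho y t = f (enorm y) t;
  fbp_sym_theta : exists f : R -> R -> R, forall y t, 0 <= t <= T ->
    enorm y <= rb t -> theta y t = f (enorm y) t;
  fbp_sym_u : exists f : R -> R -> R, forall y t, 0 <= t <= T ->
    enorm y <= rb t -> y != 0 -> u y t = f (enorm y) t *: radial y;
  fbp_pos : forall y t, 0 <= t <= T -> eball (rb t) y ->
    0 < rho y t /\ 0 < theta y t;
  fbp_mass : forall y t, 0 <= t <= T -> eball (rb t) y ->
    mass_eq rho u T y t;
  fbp_momentum : forall y t, 0 <= t <= T -> eball (rb t) y ->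
    momentum_eq P rho u theta T y t;
  fbp_energy : forall y t, 0 <= t <= T -> eball (rb t) y ->
    energy_eq P rho u theta T y t;
  fbp_stress : forall y t, 0 <= t <= T -> esphere (rb t) y ->
    forall i : 'I_3,
      (fun z => \sum_(j < 3)
         total_stress P rho u theta i j z t * radial y 0 j)
        @ within (eball (rb t)) (nbhs y) --> (0 : R);
  fbp_kinematic : forall t, 0 <= t <= T ->
    tderivable T rb t /\
    forall y, esphere (rb t) y -> tderiv T rb t = dotv (u y t) (radial y);
  fbp_vacuum : forall y t, 0 <= t <= T -> esphere (rb t) y ->
    rho y t = 0 /\ theta y t = 0;
  fbp_init : forall y, eball 1 y ->
    [/\ rho y 0 = rho0 y, u y 0 = u0 y & theta y 0 = theta0 y] }.

Record regular_flow (R : realType) (T : R) (rb : R -> R)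
    (rho : 'rV[R]_3 -> R -> R) (u : 'rV[R]_3 -> R -> 'rV[R]_3)
    (theta : 'rV[R]_3 -> R -> R) : Prop := RegularFlow {
  reg_rho : C_class T 1 1 (tube T (fun t => eball (rb t))) rho;
  reg_rho_cl : cont_on (tube T (fun t => [set y | enorm y <= rb t])) rho;
  reg_theta : C_class T 1 1 (tube T (fun t => eball (rb t))) theta;
  reg_theta_cl : cont_on (tube T (fun t => [set y | enorm y <= rb t])) theta;
  reg_u : forall i,
    C_class T 2 1 (tube T (fun t => eball (rb t))) (vcoord u i);
  reg_u_cl : forall i,
    cont_on (tube T (fun t => [set y | enorm y <= rb t])) (vcoord u i);
  reg_u_W2 : forall i, in_Linf_time T (fun t =>
    Sobolev_norm 2 (eball (rb t)) (fun y => vcoord u i y t));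
  reg_ut : forall i, in_Linf_time T (fun t =>
    Linf_norm (eball (rb t)) (fun y => dt T (vcoord u i) y t)) }.

Definition is_entropy (R : realType) (P : fluid R) (T : R) (rb : R -> R)
    (rho theta s : 'rV[R]_3 -> R -> R) : Prop :=
  forall y t, 0 <= t <= T -> eball (rb t) y ->
    pressure P rho theta y t
    = Abar P * expR (s y t * (gamma P - 1) / Rg P) * rho y t `^ gamma P.

Record regular_entropy (R : realType) (T : R) (rb : R -> R)
    (s : 'rV[R]_3 -> R -> R) : Prop := RegularEntropy {
  reg_s_W1 : in_Linf_time T (fun t =>
    Sobolev_norm 1 (eball (rb t)) (fun y => s y t));
  reg_st : in_L2_time T (fun t =>
    Linf_norm (eball (rb t)) (fun y => dt T s y t)) }.

(* Main.v *)
Require Import Defs.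
From mathcomp Require Import all_boot all_order all_algebra.
From mathcomp Require Import all_classical all_reals all_analysis.
From mathcomp Require Import ess_sup_inf ring lra.
Import Order.TTheory GRing.Theory Num.Theory.
Import numFieldNormedType.Exports.
Local Open Scope classical_set_scope.
Local Open Scope ring_scope.

Set Implicit Arguments.
Unset Strict Implicit.
Unset Printing Implicit Defensive.

(** On a ray through the origin the flow is described by functions of (r, t).
    As the entropy is bounded, theta ~ rho ^ (gamma - 1), and the entropy equation
    reads theta ^ alpha Q(grad u) = rho theta (s_t + u . grad s), where Q is positive
    definite because the shear and bulk viscosities are positive.  The condition
    alpha <= 1 / (gamma - 1) gives rho <= K theta ^ alpha, so u and grad u vanish on
    the boundary at every time at which s_t is bounded.  Such times are dense: the
    boundary does not move.  Near it the density remains steeply decreasing for a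
    short time, so the pressure pushes outwards; if u >= 0 there initially, then
    u > 0 by the minimum principle and a Hopf barrier gives u >= eps (1 - r) at a
    later time at which grad u vanishes on the boundary, a contradiction. *)

(** * Extrema of differentiable functions *)

(** The obstacle is low regularity at the boundary: density and temperature are C^1 in the open ball
    only and vanish on the sphere, so the mass equation cannot be differentiated in r and the
    momentum equation degenerates. The bound on the logarithmic density gradient is therefore
    propagated as monotonicity in r of a weighted density, compared at two points; the weight exp(m
    r) has m decreasing in time to absorb the compression terms. Such a bound holds initially with
    any constant, close enough to the boundary, because the profile gives a logarithmic slope of
    order 1 / (1 - r). The constant is taken large enough for the bounded entropy gradient not to
    reverse the sign of the temperature gradient. Square integrability of s_t gives flatness of u
    only at some times, arbitrarily close to 0; the barrier can be ended at any prescribed small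
    time, so it is aimed at one of them. *)

Section Extrema.
Variable R : realType.
Implicit Types (f : R -> R) (x d e : R).

Lemma exists_lt2 (a b : R) : 0 < a -> 0 < b -> exists h, [/\ 0 < h, h < a & h < b].
Proof.
move=> a0 b0; exists (Num.min a b / 2).
have m0 : 0 < Num.min a b by rewrite lt_min a0.
have : Num.min a b / 2 < Num.min a b by rewrite ltr_pdivrMr// ltr_pMr ?ltr1n.
by rewrite lt_min divr_gt0// => /andP[? ?].
Qed.

Lemma is_derive_quot f x d : is_derive x (1 : R) f d ->
  (fun h : R => h^-1 * (f (x + h) - f x)) @ 0^' --> d.
Proof.
move=> [fx <-]; rewrite [X in X @ _](_ : _ =
  (fun h : R => h^-1 *: ((f \o shift x) (h *: 1) - f x))); last first.
  by apply/funext => h /=; rewrite /GRing.scale /= mulr1 [h + x]addrC.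
exact: fx.
Qed.

Lemma is_derive_lt0_strict f x d : is_derive x (1 : R) f d -> d < 0 ->
  exists2 e, 0 < e & forall h, 0 < h < e -> f (x + h) < f x /\ f x < f (x - h).
Proof.
move=> /is_derive_quot fd d0.
have /fd : \forall y \near d, y < 0 by exact: lt_nbhsl.
rewrite near_simpl /= => -[e /= e0 He]; exists e => // h /andP[h0 he]; split.
  have /He : ball 0 e h by rewrite /ball /= sub0r normrN gtr0_norm.
  by move=> /(_ (lt0r_neq0 h0)); rewrite pmulr_rlt0 ?invr_gt0// subr_lt0.
have : ball 0 e (- h) by rewrite /ball /= sub0r opprK gtr0_norm.
move=> /He; rewrite oppr_eq0 => /(_ (lt0r_neq0 h0)).
by rewrite invrN mulNr oppr_lt0 pmulr_rgt0 ?invr_gt0// subr_gt0.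
Qed.

Lemma is_derive_gt0_strict f x d : is_derive x (1 : R) f d -> 0 < d ->
  exists2 e, 0 < e & forall h, 0 < h < e -> f x < f (x + h) /\ f (x - h) < f x.
Proof.
move=> fd d0; have [|e e0 He] := @is_derive_lt0_strict (- f) x (- d).
- by rewrite oppr_lt0.
- by exists e => // h /He /=; rewrite !ltrN2.
Qed.

Lemma derive_ge0_right f x d e : is_derive x (1 : R) f d -> 0 < e ->
  (forall h, 0 < h < e -> f x <= f (x + h)) -> 0 <= d.
Proof.
move=> fd e0 H; rewrite leNgt; apply/negP => /(is_derive_lt0_strict fd)[e' e'0].
have [h [h0 he he']] := exists_lt2 e0 e'0.
by move=> /(_ h); rewrite h0 he' => /(_ erefl)[+ _]; rewrite ltNge H// h0.
Qed.

Lemma derive_le0_right f x d e : is_derive x (1 : R) f d -> 0 < e ->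
  (forall h, 0 < h < e -> f (x + h) <= f x) -> d <= 0.
Proof.
move=> fd e0 H; rewrite -oppr_ge0.
apply: (@derive_ge0_right (- f) x _ e) => // h he.
by rewrite /= lerN2 H.
Qed.

Lemma derive_le0_left f x d e : is_derive x (1 : R) f d -> 0 < e ->
  (forall h, 0 < h < e -> f x <= f (x - h)) -> d <= 0.
Proof.
move=> fd e0 H; rewrite leNgt; apply/negP => /(is_derive_gt0_strict fd)[e' e'0].
have [h [h0 he he']] := exists_lt2 e0 e'0.
by move=> /(_ h); rewrite h0 he' => /(_ erefl)[_]; rewrite ltNge H// h0.
Qed.

Lemma derive_ge0_left f x d e : is_derive x (1 : R) f d -> 0 < e ->
  (forall h, 0 < h < e -> f (x - h) <= f x) -> 0 <= d.
Proof.
move=> fd e0 H; rewrite -oppr_le0.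
apply: (@derive_le0_left (- f) x _ e) => // h he.
by rewrite /= lerN2 H.
Qed.

Lemma derive_eq0_min f x d e : is_derive x (1 : R) f d -> 0 < e ->
  (forall y, `|y - x| < e -> f x <= f y) -> d = 0.
Proof.
move=> fd e0 H; apply/eqP; rewrite eq_le; apply/andP; split.
  apply: (derive_le0_left fd e0) => h /andP[h0 he]; apply: H.
  by rewrite addrAC subrr add0r normrN gtr0_norm.
apply: (derive_ge0_right fd e0) => h /andP[h0 he]; apply: H.
by rewrite addrAC subrr add0r gtr0_norm.
Qed.

(** Were d negative, [f1], which vanishes at x, would be negative just to the right of x, and the
    mean value theorem would push f below its minimum. [f1] needs a derivative at x alone. *)
Lemma derive2_ge0_min f f1 x d e : 0 < e ->
  (forall y, `|y - x| < e -> is_derive y (1 : R) f (f1 y)) ->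
  is_derive x (1 : R) f1 d ->
  (forall y, `|y - x| < e -> f x <= f y) -> f1 x = 0 /\ 0 <= d.
Proof.
move=> e0 ff1 f1d H.
have f10 : f1 x = 0.
  by apply: (derive_eq0_min (ff1 x _) e0 H); rewrite subrr normr0.
split=> //; rewrite leNgt; apply/negP => /(is_derive_lt0_strict f1d)[e' e'0 He].
have [m [m0 me me']] := exists_lt2 e0 e'0.
have near_x y : y \in `[x, x + m] -> `|y - x| < e.
  rewrite in_itv/= => /andP[xy ym].
  by rewrite ger0_norm ?subr_ge0// ltrBlDl (le_lt_trans ym)// ltrD2l.
have [|||c] := @MVT R f f1 x (x + m).
- by rewrite ltrDl.
- by move=> y /subset_itv_oo_cc/near_x/ff1.
- apply: derivable_within_continuous => y /near_x/ff1.
  by move=> fy; exact: (@ex_derive _ _ _ _ _ _ _ fy).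
rewrite in_itv/= => /andP[xc cm].
rewrite addrAC subrr add0r => E.
have : f x <= f (x + m) by apply: H; apply: near_x; rewrite in_itv/= lerDl (ltW m0) lexx.
rewrite -subr_ge0 E; apply/negP; rewrite -ltNge pmulr_llt0//.
have [] := He (c - x); first by rewrite subr_gt0 xc ltrBlDl (lt_trans cm)// ltrD2l.
by rewrite addrCA subrr addr0 f10.
Qed.

End Extrema.

(** * Propagation of the density gradient *)

Section WithinContinuous.
Variables (R : realType) (X : topologicalType) (A : set X).

Lemma withinD (f g : X -> R) : {within A, continuous f} ->
  {within A, continuous g} -> {within A, continuous (fun x => f x + g x)}.
Proof. by move=> fc gc x; exact: (continuousD (fc x) (gc x)). Qed.

Lemma withinN (f : X -> R) : {within A, continuous f} ->
  {within A, continuous (fun x => - f x)}.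
Proof. by move=> fc x; exact: (continuousN (fc x)). Qed.

Lemma withinM (f g : X -> R) : {within A, continuous f} ->
  {within A, continuous g} -> {within A, continuous (fun x => f x * g x)}.
Proof. by move=> fc gc x; exact: (continuousM (fc x) (gc x)). Qed.

Lemma within_cst (c : R) : {within A, continuous (fun _ : X => c)}.
Proof. by move=> x; exact: cst_continuous. Qed.

End WithinContinuous.

Lemma within_comp (X Y Z : topologicalType) (A : set X) (B : set Y)
    (g : X -> Y) (f : Y -> Z) : (forall x, A x -> B (g x)) ->
  {within A, continuous g} -> {within B, continuous f} ->
  {within A, continuous (fun x => f (g x))}.
Proof.
move=> AB /subspace_continuousP gc /subspace_continuousP fc.
apply/subspace_continuousP => x Ax.
apply: cvg_comp (fc _ (AB _ Ax)) => V; rewrite /nbhs/= => BV.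
have : \forall y \near x, A y -> B (g y) -> V (g y) := gc _ Ax _ BV.
by apply: filterS => y H Ay; exact: H Ay (AB _ Ay).
Qed.

Lemma withinV (R : realType) (X : topologicalType) (A : set X) (f : X -> R) :
  (forall x, A x -> f x != 0) -> {within A, continuous f} ->
  {within A, continuous (fun x => (f x)^-1)}.
Proof.
move=> f0 /subspace_continuousP fc; apply/subspace_continuousP => x Ax.
by apply: cvgV; [exact: f0|exact: fc].
Qed.

Lemma within_slice (R : realType) (S : set (R * R)) (A : set R)
    (f : R -> R -> R) (t : R) :
  {within S, continuous (fun z : R * R => f z.1 z.2)} ->
  (forall x, A x -> S (x, t)) -> {within A, continuous (f^~ t)}.
Proof.
move=> fc AS.
have gc : {within A, continuous (fun x : R => (x, t))}.
  by apply: continuous_subspaceT => x; apply: (@cvg_pair _ _ _ (nbhs x) (nbhs x) (nbhs t)); [exact: cvg_id|exact: cvg_cst].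
exact: (within_comp AS gc fc).
Qed.

Lemma within_slice_r (R : realType) (S : set (R * R)) (A : set R)
    (f : R -> R -> R) (r : R) :
  {within S, continuous (fun z : R * R => f z.1 z.2)} ->
  (forall x, A x -> S (r, x)) -> {within A, continuous (f r)}.
Proof.
move=> fc AS.
have gc : {within A, continuous (fun x : R => (r, x))}.
  by apply: continuous_subspaceT => x; apply: (@cvg_pair _ _ _ (nbhs x) (nbhs r) (nbhs x)); [exact: cvg_cst|exact: cvg_id].
exact: (within_comp AS gc fc).
Qed.

Lemma within_lt (R : realType) (S : set (R * R)) (f : R -> R -> R) (x t a : R) :
  {within S, continuous (fun z : R * R => f z.1 z.2)} -> S (x, t) -> f x t < a ->
  exists2 e, 0 < e & forall x' t', `|x' - x| < e -> `|t' - t| < e -> S (x', t') ->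
    f x' t' < a.
Proof.
move=> /subspace_continuousP fc Sx fa.
have /(@cvgr_lt _ _ _ _ _ _)/(_ _ fa) := fc _ Sx.
move=> /nbhs_ballP[e /= e0 He]; exists e => // x' t' xx tt Sx'.
by apply: (He (x', t')) => //; split; rewrite /ball/= distrC.
Qed.

Lemma inv_half_itv (R : realFieldType) (x : R) : 2^-1 < x < 1 ->
  [/\ 0 < x, 0 < x^-1 <= 2 & 0 < x ^- 2 <= 4].
Proof.
move=> /andP[x2 x1]; have x0 : 0 < x by apply: lt_trans x2; rewrite invr_gt0.
have xi : 0 < x^-1 <= 2.
  rewrite invr_gt0 x0/= -[X in _ <= X]invrK lef_pV2 ?posrE ?invr_gt0 ?ltr0n//.
  exact: ltW.
split=> //; rewrite invr_gt0 exprn_gt0//= -exprVn expr2.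
have -> : 4 = 2 * 2 :> R by lra.
by case/andP: xi => /ltW ? ?; exact: ler_pM.
Qed.

(** * Radial flow in a shell with fixed outer boundary r = 1 *)

Section RadialDynamics.
Variables (R : realType) (T : R).
Variables (rho U Th p_r Thr rhor Ur Urr rhot Ut : R -> R -> R).
Variables (nu lb B K : R).
Implicit Types (r t e x y z a b tau : R).

Definition cont2 (S : set (R * R)) (f : R -> R -> R) : Prop :=
  {within S, continuous (fun z : R * R => f z.1 z.2)}.

(** The inner radius 1/2 keeps 1 / r at most 2. The boundary r = 1 is included only here, for
    quantities continuous up to it; derivatives are known on [shell] only. *)
Definition shell_closed := [set z : R * R | 2^-1 <= z.1 <= 1 /\ 0 <= z.2 <= T].
Definition shell := [set z : R * R | 2^-1 <= z.1 < 1 /\ 0 <= z.2 <= T].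

(* Th stands for theta ^ alpha and Thr, p_r for radial derivatives. *)
Record radial_flow : Prop := RadialFlow {
  rf_rho_cont : cont2 shell_closed rho;
  rf_U_cont : cont2 shell_closed U;
  rf_rhor_cont : cont2 shell rhor;
  rf_Ur_cont : cont2 shell Ur;
  rf_Urr_cont : cont2 shell Urr;
  rf_Th_cont : cont2 shell Th;
  rf_Thr_cont : cont2 shell Thr;
  rf_p_r_cont : cont2 shell p_r;
  rf_rhor : forall r t, 2^-1 < r < 1 -> 0 <= t <= T ->
    is_derive r (1 : R) (rho^~ t) (rhor r t);
  rf_Ur : forall r t, 2^-1 < r < 1 -> 0 <= t <= T ->
    is_derive r (1 : R) (U^~ t) (Ur r t);
  rf_Urr : forall r t, 2^-1 < r < 1 -> 0 <= t <= T ->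
    is_derive r (1 : R) (Ur^~ t) (Urr r t);
  rf_rhot : forall r t, 2^-1 < r < 1 -> 0 < t < T ->
    is_derive t (1 : R) (rho r) (rhot r t);
  rf_Ut : forall r t, 2^-1 < r < 1 -> 0 < t < T ->
    is_derive t (1 : R) (U r) (Ut r t);
  rf_mass : forall r t, 2^-1 < r < 1 -> 0 < t < T ->
    rhot r t + rhor r t * U r t + rho r t * (Ur r t + 2 * (U r t / r)) = 0;
  rf_momentum : forall r t, 2^-1 < r < 1 -> 0 < t < T ->
    rho r t * (Ut r t + U r t * Ur r t) + p_r r t =
    nu * Th r t * (Urr r t + 2 * (Ur r t / r) - 2 * (U r t / r ^+ 2))
    + Thr r t * (nu * Ur r t + 2 * lb * (U r t / r));
  rf_rho_gt0 : forall r t, 2^-1 < r < 1 -> 0 <= t <= T -> 0 < rho r t;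
  rf_Th_gt0 : forall r t, 2^-1 < r < 1 -> 0 <= t <= T -> 0 < Th r t;
  rf_rho1 : forall t, 0 <= t <= T -> rho 1 t = 0;
  rf_U1 : forall t, 0 <= t <= T -> U 1 t = 0;
  rf_bound : forall r t, 2^-1 < r < 1 -> 0 < t < T ->
    [/\ `|U r t| <= B, `|Ur r t| <= B & `|Urr r t| <= B];
  rf_rhoTh : forall r t, 2^-1 < r < 1 -> 0 < t < T -> rho r t <= K * Th r t }.

End RadialDynamics.

(** * Monotonicity of the weighted density *)

Section DensityGradient.
Variables (R : realType) (T : R).
Variables (rho U Th p_r Thr rhor Ur Urr rhot Ut : R -> R -> R).
Variables (nu lb B K : R).
Implicit Types (r t e x y z a b tau : R).
Hypothesis T0 : 0 < T.
Hypothesis flow : radial_flow T rho U Th p_r Thr rhor Ur Urr rhot Ut nu lb B K.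

Let C := shell_closed T.
Let D := shell T.
Let rhoC : cont2 C rho := rf_rho_cont flow.
Let rhorC : cont2 D rhor := rf_rhor_cont flow.
Let drho := rf_rhor flow.
Let dU := rf_Ur flow.
Let dUr := rf_Urr flow.
Let drhot := rf_rhot flow.
Let mass := rf_mass flow.
Let rho_gt0 := rf_rho_gt0 flow.
Let rho1 := rf_rho1 flow.
Let UB := rf_bound flow.

Variable M : R.
Hypothesis M0 : 0 < M.
Variables (c0 e0 : R).
Hypothesis init_rho : forall r, 2^-1 < r < 1 -> 1 - e0 < r ->
  rhor r 0 <= - (c0 / (1 - r)) * rho r 0.

Lemma B_ge0 : 0 <= B.
Proof.
have r01 : 2^-1 < (3 / 4 : R) < 1 by apply/andP; split; lra.
have t01 : 0 < T / 2 < T by have T0' := T0; apply/andP; split; lra.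
by have [+ _ _] := UB r01 t01; exact: le_trans (normr_ge0 _).
Qed.

(** The r-derivative of [F] is -N plus terms bounded by (M + 1) B, B, 8 B and 4 B, whose sum is (M +
    14) B; the extra 1 makes N positive. The exponent [m] starts at M + 1 and stays at least M as
    long as N t <= 1. *)
Let N := 14 * B + M * B + 1.
Let m t := M + 1 - N * t.
Let h r t := rho r t * expR (m t * r).
Let F r t := m t * U r t - N * r - (Ur r t + 2 * (U r t / r)).

Lemma h_derive_r r t : 2^-1 < r < 1 -> 0 <= t <= T ->
  is_derive r (1 : R) (h^~ t) ((rhor r t + m t * rho r t) * expR (m t * r)).
Proof.
move=> r01 t01; have dr := drho r01 t01.
have de : is_derive r (1 : R) (fun x => expR (m t * x)) (expR (m t * r) * m t).
  apply: (@is_derive1_comp _ expR (fun x => m t * x)).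
  by apply: is_derive_eq; rewrite /GRing.scale /= mulr1.
by apply: is_derive_eq; rewrite /GRing.scale /=; ring.
Qed.

Lemma h_derive_t r t : 2^-1 < r < 1 -> 0 < t < T ->
  is_derive t (1 : R) (h r) ((rhot r t - N * r * rho r t) * expR (m t * r)).
Proof.
move=> r01 t01; have dr := drhot r01 t01.
have de : is_derive t (1 : R) (fun x => expR (m x * r)) (expR (m t * r) * (- N * r)).
  apply: (@is_derive1_comp _ expR (fun x => m x * r)).
  rewrite /m; apply: is_derive_eq; rewrite /GRing.scale /=; ring.
by apply: is_derive_eq; rewrite /GRing.scale /=; ring.
Qed.

(* Along the flow the weighted density grows at rate F, and the choice of N
   makes F nonincreasing in r. *)
Lemma F_nincr r r' t : 2^-1 < r -> r < r' -> r' < 1 -> 0 < t < T -> N * t <= 1 ->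
  F r' t <= F r t.
Proof.
move=> r0 rr' r1 t01 Nt.
have B0 := B_ge0.
have mt : 0 < m t <= M + 1.
  have N0 : 0 <= N * t.
    by rewrite mulr_ge0 ?(ltW (andP t01).1)// /N addr_ge0// addr_ge0// mulr_ge0// ltW.
  have M0' := M0; rewrite /m; apply/andP; split; lra.
have tT : 0 <= t <= T by case/andP: t01 => ? ?; apply/andP; split; lra.
pose F' x := m t * Ur x t - N -
  (Urr x t + 2 * (- x ^- 2 * U x t + x^-1 * Ur x t)).
have dF x : 2^-1 < x < 1 -> is_derive x (1 : R) (F^~ t) (F' x).
  move=> x01; have x0 : x != 0 by case/andP: x01 => ? ?; apply: lt0r_neq0; lra.
  have du := dU x01 tT; have dur := dUr x01 tT.
  have dx : is_derive x (1 : R) (fun y : R => y^-1) (- x ^- 2).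
    by apply: is_derive_eq; [exact: is_deriveV|rewrite /GRing.scale/= mulr1].
  by rewrite /F'; apply: is_derive_eq; rewrite /GRing.scale/=; ring.
have xin x : x \in `[r, r'] -> 2^-1 < x < 1.
  by rewrite in_itv/= => /andP[? ?]; apply/andP; split; lra.
have [||c crr' E] := @MVT R (F^~ t) F' r r' rr'.
- by move=> x /subset_itv_oo_cc/xin/dF.
- apply: derivable_within_continuous => x /xin/dF dFx.
  exact: (@ex_derive _ _ _ _ _ _ _ dFx).
have c01 := xin _ (subset_itv_oo_cc crr').
rewrite -subr_le0 E pmulr_lle0 ?subr_gt0//.
have [Ub Urb Urrb] := UB c01 t01.
have [c0' ci ci2] := inv_half_itv c01.
rewrite /F'.
have H1 : m t * Ur c t <= (M + 1) * B.
  apply: le_trans (ler_norm _) _; rewrite normrM gtr0_norm; last by case/andP: mt.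
  by apply: ler_pM => //; case/andP: mt => // /ltW.
have H2 : `|c ^- 2 * U c t| <= 4 * B.
  rewrite normrM gtr0_norm; last by case/andP: ci2.
  by apply: ler_pM => //; case/andP: ci2 => // /ltW.
have H3 : `|c^-1 * Ur c t| <= 2 * B.
  rewrite normrM gtr0_norm; last by case/andP: ci.
  by apply: ler_pM => //; case/andP: ci => // /ltW.
move: H1 H2 H3 Urrb; rewrite !ler_norml => H1 /andP[? ?] /andP[? ?] /andP[? ?].
rewrite mulNr /N; lra.
Qed.

Lemma F_bounded : exists k, forall r t, 2^-1 < r < 1 -> 0 < t < T -> N * t <= 1 ->
  F r t <= k.
Proof.
exists ((M + 1) * B + B + 4 * B) => r t r01 t01 Nt.
have B0 := B_ge0.
have N0 : 0 <= N by rewrite /N addr_ge0// addr_ge0// mulr_ge0// ltW.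
have [r0' ri _] := inv_half_itv r01.
have [Ub Urb Urrb] := UB r01 t01.
have mt : 0 <= m t <= M + 1.
  have N1 : 0 <= N * t by rewrite mulr_ge0// ?(ltW (andP t01).1).
  have M0' := M0; rewrite /m; apply/andP; split; lra.
have H1 : m t * U r t <= (M + 1) * B.
  apply: le_trans (ler_norm _) _; rewrite normrM ger0_norm; last by case/andP: mt.
  by apply: ler_pM => //; case/andP: mt.
have H3 : `|U r t / r| <= B * 2.
  rewrite normrM [X in _ * X]gtr0_norm; last by case/andP: ri.
  by apply: ler_pM => //; case/andP: ri => // /ltW.
have H4 : 0 <= N * r by rewrite mulr_ge0// ltW.
move: H3 Urb; rewrite !ler_norml => /andP[? ?] /andP[? ?].
rewrite /F; lra.
Qed.

Lemma m_cont : continuous (fun z : R * R => m z.2).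
Proof.
move=> z; apply: cvgB; first exact: cvg_cst.
by apply: cvgM; [exact: cvg_cst|exact: cvg_snd].
Qed.

Lemma h_cont : cont2 C h.
Proof.
apply: withinM => //; apply: continuous_subspaceT => z.
apply: (@continuous_comp _ _ _ (fun z : R * R => m z.2 * z.1) expR);
  last exact: continuous_expR.
by apply: (@continuousM _ _ (fun z : R * R => m z.2) fst); [exact: m_cont|exact: cvg_fst].
Qed.

Lemma N_gt0 : 0 < N.
Proof.
by rewrite /N ltr_wpDl// addr_ge0// mulr_ge0// ?B_ge0// ltW.
Qed.

Lemma tT_itv t tau : tau < T -> 0 <= t <= tau -> 0 <= t <= T.
Proof. by move=> tauT /andP[-> /le_trans->]//; exact: ltW. Qed.

Section GradientPropagation.
Variable r1 : R.
Hypotheses (r101 : 2^-1 < r1 < 1) (r1e : 1 - e0 < r1).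
Hypothesis r1c : (M + 2) * (1 - r1) <= c0.

Let r01_itv r : r1 <= r < 1 -> 2^-1 < r < 1.
Proof. by case/andP: r101 => + _ /andP[+ ->] => /lt_le_trans/[apply] ->. Qed.

Let zeroT : 0 <= (0 : R) <= T. Proof. by rewrite lexx ltW. Qed.

(** Here c0 / (1 - r) is at least M + 2 by the choice of [r1], one more than m 0 = M + 1; the
    surplus makes the inequality strict. *)
Lemma rhor_init r : r1 <= r < 1 -> rhor r 0 + m 0 * rho r 0 < 0.
Proof.
move=> r1r; have r01 := r01_itv r1r.
have rp := rho_gt0 r01 zeroT.
have r1' : 0 < 1 - r by rewrite subr_gt0; case/andP: r01.
have : rhor r 0 <= - (c0 / (1 - r)) * rho r 0.
  by apply: init_rho => //; case/andP: r1r => + _; exact: lt_le_trans.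
have : (M + 2) * rho r 0 <= c0 / (1 - r) * rho r 0.
  rewrite ler_pM2r// ler_pdivlMr//; apply: le_trans r1c.
  rewrite ler_pM2l ?lerD2l ?lerN2; first by case/andP: r1r.
  by have M0' := M0; lra.
rewrite /m mulr0 subr0; lra.
Qed.

Lemma h_itv_cont t a b : r1 <= a -> b <= 1 -> 0 <= t <= T ->
  {within `[a, b], continuous (h^~ t)}.
Proof.
move=> ra b1 t01; apply: (within_slice h_cont) => r /=.
rewrite in_itv/= => /andP[ar rb]; split=> //=.
case/andP: r101 => ? ?; apply/andP; split; lra.
Qed.

Lemma h_init_decr x y : r1 <= x -> x < y -> y <= 1 -> h y 0 < h x 0.
Proof.
move=> rx xy y1.
have yin z : z \in `]x, y[ -> r1 <= z < 1.
  by rewrite in_itv/= => /andP[? ?]; apply/andP; split; lra.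
apply: (@ltr0_derive1_decr _ (h^~ 0) x y) => //.
- move=> z /yin/r01_itv z01; exact: (@ex_derive _ _ _ _ _ _ _ (h_derive_r z01 zeroT)).
- move=> z /yin rz; rewrite derive1E.
  rewrite (@derive_val _ _ _ _ _ _ _ (h_derive_r (r01_itv rz) zeroT)).
  by rewrite pmulr_llt0 ?expR_gt0// rhor_init.
- exact: h_itv_cont.
Qed.

(** Serves as a boundary condition on the inner side: it excludes r = r1 at a positive maximum of h
    r' - h r. It persists for a short time because [h] is strictly decreasing in r at time 0. *)
Lemma h_inflow : exists2 tau, 0 < tau < T & forall r t, r1 <= r <= 1 ->
  0 <= t <= tau -> h r t <= h r1 t.
Proof.
have r1r1 : r1 <= r1 < 1 by rewrite lexx; case/andP: r101.
have Cr1 r t : r1 <= r <= 1 -> 0 <= t <= T -> C (r, t).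
  move=> /andP[? ?] ?; split=> //=; case/andP: r101 => ? ?; apply/andP; split; lra.
(* Compactness of [r1, 1] makes the local lifespans uniform. Away from r1 the strict inequality h x
   0 < h r1 0 persists by continuity; at x = r1 it becomes an equality, and the sign of the
   r-derivative is propagated instead. *)
have : near_covering_within `[r1, 1]%classic.
  by apply/near_covering_withinP/compact_near_coveringP/segment_compact.
move=> /(_ R (nbhs (0 : R)) (fun t r => 0 <= t <= T -> h r t <= h r1 t) _).
case.
  move=> x /=; rewrite in_itv/= => /andP[]; rewrite le_eqVlt => /predU1P[<- _|r1x x1].
    have rm : cont2 D (fun r t => rhor r t + m t * rho r t).
      apply: withinD => //; apply: withinM.
        by apply: continuous_subspaceT; exact: m_cont.
      apply: continuous_subspaceW rhoC => z [/andP[? /ltW ?] ?].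
      by split=> //; apply/andP.
    have [|e egt0 He] := within_lt (x:=r1) (t:=0) (a:=0) rm _ (rhor_init r1r1).
      by split=> //=; case/andP: r101 => /ltW -> ->.
    exists ([set r | `|r - r1| < e], [set t | `|t - 0| < e]) => /=.
      by split; apply/nbhs_ballP; exists e => // y; rewrite /ball/= distrC.
    move=> [r t] /= [re te]; rewrite in_itv/= => /andP[r1r rle1] t01.
    move: r1r; rewrite le_eqVlt => /predU1P[->//|r1r].
    have yin z : z \in `]r1, r[ -> r1 <= z < 1.
      by rewrite in_itv/= => /andP[? ?]; apply/andP; split; lra.
    apply: (@ler0_derive1_nincr _ (h^~ t) r1 r) => //; last exact: ltW.
    + move=> z /yin/r01_itv z01; exact: (@ex_derive _ _ _ _ _ _ _ (h_derive_r z01 t01)).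
    + move=> z zin; have rz := yin _ zin; rewrite derive1E.
      rewrite (@derive_val _ _ _ _ _ _ _ (h_derive_r (r01_itv rz) t01)).
      rewrite pmulr_lle0 ?expR_gt0//; apply/ltW/He => //.
        have /andP[r1z zr] : r1 < z < r by move: zin; rewrite in_itv.
        by move: re; rewrite !gtr0_norm ?subr_gt0//; lra.
      by split=> //=; case/andP: (r01_itv rz) => /ltW -> ->.
    + exact: h_itv_cont.
  have hh : cont2 C (fun r t => h r t - h r1 t).
    apply: withinD; first exact: h_cont.
    have gC (z : R * R) : C z -> C (r1, z.2).
      by move=> [_ z01]; apply: Cr1 => //; rewrite lexx; case/andP: r101 => _ /ltW.
    have gc : {within C, continuous (fun z : R * R => (r1, z.2))}.
      apply: continuous_subspaceT => z.
      by apply: (@cvg_pair _ _ _ (nbhs z) (nbhs r1) (nbhs z.2)); [exact: cvg_cst|exact: cvg_snd].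
    exact: (withinN (within_comp gC gc h_cont)).
  have [||e egt0 He] := within_lt (x:=x) (t:=0) (a:=0) hh.
  - by apply: Cr1 => //; rewrite (ltW r1x).
  - by rewrite subr_lt0 h_init_decr.
  exists ([set r | `|r - x| < e], [set t | `|t - 0| < e]) => /=.
    by split; apply/nbhs_ballP; exists e => // y; rewrite /ball/= distrC.
  move=> [r t] /= [re te]; rewrite in_itv/= => rin t01.
  by rewrite -subr_le0 ltW// He//; exact: Cr1.
move=> e /= egt0 He; exists (Num.min (e / 2) (T / 2)).
  rewrite lt_min !divr_gt0//= gt_min; apply/orP; right.
  by rewrite ltr_pdivrMr// ltr_pMr ?ltr1n.
move=> r t r1r /andP[t0]; rewrite le_min => /andP[te tT].
have T0' := T0.
apply: (He t); [|by []|].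
- by rewrite /= sub0r normrN ger0_norm//; lra.
- by apply/andP; split=> //; lra.
Qed.

(** At a critical point of [h] in r, [rhor] equals - m rho, so the transport term of the mass
    equation becomes a multiple of rho and no derivative of rho is left. *)
Lemma flow_growth r t : 2^-1 < r < 1 -> 0 < t < T -> rhor r t + m t * rho r t = 0 ->
  is_derive t (1 : R) (h r) (F r t * h r t).
Proof.
move=> r01 t01 hr0; apply: (is_derive_eq (h_derive_t r01 t01)).
have E := mass r01 t01.
have -> : rhot r t = - (rhor r t * U r t) - rho r t * (Ur r t + 2 * (U r t / r)) by lra.
have -> : rhor r t = - (m t * rho r t) by lra.
rewrite /F /h; ring.
Qed.

(* Doubling of variables: at a positive interior maximum both space derivatives
   vanish, so h r' - h r grows at rate less than k, against the factor exp(-kt). *)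
Lemma h_le_of_max tau k r r' t : 0 < tau < T -> N * tau <= 1 ->
  (forall x s, r1 <= x <= 1 -> 0 <= s <= tau -> h x s <= h r1 s) ->
  (forall x s, 2^-1 < x < 1 -> 0 < s < T -> N * s <= 1 -> F x s < k) ->
  r1 <= r <= r' -> r' <= 1 -> 0 <= t <= tau ->
  (forall x y s, r1 <= x <= y -> y <= 1 -> 0 <= s <= tau ->
    expR (- k * s) * (h y s - h x s) <= expR (- k * t) * (h r' t - h r t)) ->
  h r' t <= h r t.
Proof.
move=> /andP[tau0 tauT] Ntau inflow Fk /andP[r1r rr'] r'1 /andP[t0 ttau] mx.
rewrite leNgt; apply/negP => hlt.
have t_gt0 : 0 < t.
  rewrite lt_neqAle t0 andbT; apply/eqP => tE; move: hlt; rewrite -tE.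
  move: rr'; rewrite le_eqVlt => /predU1P[->|rr']; first by rewrite ltxx.
  by rewrite ltNge (ltW (h_init_decr _ _ _)).
have t0T : 0 < t < T by rewrite t_gt0 (le_lt_trans ttau).
have tT : 0 <= t <= T by case/andP: t0T => /ltW -> /ltW.
have rr'lt : r < r'.
  by rewrite lt_neqAle rr' andbT; apply/eqP => E; move: hlt; rewrite E ltxx.
have r1rlt : r1 < r.
  rewrite lt_neqAle r1r andbT; apply/eqP => E; move: hlt; rewrite -E ltNge inflow//.
    by rewrite r'1 E rr'.
  by rewrite t0 ttau.
have r01 : 2^-1 < r < 1 by apply: r01_itv; rewrite r1r (lt_le_trans rr'lt).
have h_ge0 x s : 2^-1 < x < 1 -> 0 <= s <= T -> 0 < h x s.
  by move=> x01 sT; rewrite mulr_gt0 ?expR_gt0 ?rho_gt0.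
have r'lt1 : r' < 1.
  rewrite lt_neqAle r'1 andbT; apply/eqP => E; move: hlt.
  have -> : h r' t = 0 by rewrite E /h rho1// mul0r.
  by rewrite ltNge ltW// h_ge0.
have r'01 : 2^-1 < r' < 1 by apply: r01_itv; rewrite r'lt1 andbT (le_trans r1r).
have tin : 0 <= t <= tau by rewrite t0.
have ht (x y : R) : r1 <= x <= y -> y <= 1 -> h y t - h x t <= h r' t - h r t.
  by move=> xy y1; have := mx x y t xy y1 tin; rewrite ler_pM2l ?expR_gt0.
have hr0 : rhor r t + m t * rho r t = 0.
  apply/eqP; rewrite -(mulIr_eq0 _ (@mulIf _ _ (lt0r_neq0 (expR_gt0 (m t * r))))); apply/eqP.
  apply: (derive_eq0_min (h_derive_r r01 tT) (e:=Num.min (r - r1) (r' - r))).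
    by rewrite lt_min !subr_gt0 r1rlt.
  move=> y; rewrite lt_min !ltr_norml => /andP[/andP[? ?] /andP[? ?]].
  have yr' : r1 <= y <= r' by apply/andP; split; lra.
  have := ht y r' yr' r'1; lra.
have hr'0 : rhor r' t + m t * rho r' t = 0.
  apply/eqP; rewrite -(mulIr_eq0 _ (@mulIf _ _ (lt0r_neq0 (expR_gt0 (m t * r'))))) -oppr_eq0.
  apply/eqP; apply: (@derive_eq0_min _ (fun x => - h x t) r' _ (Num.min (r' - r) (1 - r'))).
  - exact: (is_deriveN (h_derive_r r'01 tT)).
  - by rewrite lt_min !subr_gt0 rr'lt.
  - move=> y; rewrite lt_min !ltr_norml => /andP[/andP[? ?] /andP[? ?]].
    have ry : r1 <= r <= y by apply/andP; split; lra.
    have y1 : y <= 1 by lra.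
    have := ht r y ry y1; rewrite /=; lra.
have Nt : N * t <= 1 by apply: le_trans Ntau; rewrite ler_pM2l ?N_gt0.
have dh := flow_growth r01 t0T hr0.
have dh' := flow_growth r'01 t0T hr'0.
have de : is_derive t (1 : R) (fun s => expR (- k * s)) (expR (- k * t) * - k).
  apply: (@is_derive1_comp _ expR (fun s => - k * s)).
  by apply: is_derive_eq; rewrite /GRing.scale /= mulr1.
have dG : is_derive t (1 : R) (fun s => expR (- k * s) * (h r' s - h r s))
   (expR (- k * t) * (F r' t * h r' t - F r t * h r t - k * (h r' t - h r t))).
  by apply: is_derive_eq; rewrite /GRing.scale /=; ring.
have : 0 <= expR (- k * t) * (F r' t * h r' t - F r t * h r t - k * (h r' t - h r t)).
  apply: (derive_ge0_left dG t_gt0) => s /andP[s0 st].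
  by apply: mx; rewrite ?r1r// subr_ge0 (ltW st)/= lerBlDl ler_wpDl// ltW.
rewrite pmulr_rge0 ?expR_gt0//; apply/negP; rewrite -ltNge.
(* Since F r' <= F r and h r' > 0, the bracket is at most (F r - k) (h r' - h r), which is negative
   by F < k. *)
have FF := F_nincr (andP r01).1 rr'lt (andP r'01).2 t0T Nt.
have Fr : F r t < k by exact: Fk.
have hr_gt0 := h_ge0 _ _ r01 tT.
have hr'_gt0 := h_ge0 _ _ r'01 tT.
have : F r' t * h r' t <= F r t * h r' t by rewrite ler_pM2r.
have : F r t * (h r' t - h r t) < k * (h r' t - h r t) by rewrite ltr_pM2r// subr_gt0.
rewrite [F r t * (_ - _)]mulrBr; lra.
Qed.

(** The maximum of the damped difference h r' - h r over r <= r' is attained and cannot be positive,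
    so [h] is nonincreasing in r. The sign of its derivative reads rhor <= - m rho, and m is at
    least M. *)
Lemma density_gradient : exists2 tau, 0 < tau < T & forall r t, r1 <= r < 1 ->
  0 <= t <= tau -> rhor r t <= - M * rho r t.
Proof.
have [tau1 /andP[tau10 tau1T] inflow] := h_inflow.
have [k Fk] := F_bounded.
(* [tau1] controls the inner side, and 1 / N keeps [m] at least M. *)
pose tau := Num.min tau1 N^-1.
have N0 := N_gt0.
have tau0 : 0 < tau by rewrite lt_min tau10 invr_gt0.
have tautau1 : tau <= tau1 by rewrite ge_min lexx.
have tauT : tau < T by exact: le_lt_trans tautau1 tau1T.
have Ntau : N * tau <= 1 by rewrite -ler_pdivlMl// mulr1 ge_min lexx orbT.
exists tau; first by rewrite tau0.
(* Triples (r, r', t) with r <= r'. [G] carries a minus sign, so its minimum is the maximum sought;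
   the rate k + 1 turns the bound F <= k into a strict one. *)
pose A := [set z : R * R * R | r1 <= z.1.1 <= 1 /\ r1 <= z.1.2 <= 1] `&`
  [set z | 0 <= z.2 <= tau] `&` [set z | z.1.1 <= z.1.2].
pose G (z : R * R * R) := - (expR (- (k + 1) * z.2) * (h z.1.2 z.2 - h z.1.1 z.2)).
have AC1 (z : R * R * R) : A z -> C (z.1.1, z.2).
  move=> [[[/= z1 _] z2] _]; split=> //=; last exact: tT_itv tauT z2.
  by case/andP: z1 => ? ?; case/andP: r101 => ? ?; apply/andP; split; lra.
have AC2 (z : R * R * R) : A z -> C (z.1.2, z.2).
  move=> [[[/= _ z1] z2] _]; split=> //=; last exact: tT_itv tauT z2.
  by case/andP: z1 => ? ?; case/andP: r101 => ? ?; apply/andP; split; lra.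
have c11 : continuous (fun z : R * R * R => z.1.1).
  by move=> z; apply: (@cvg_comp _ _ _ fst fst); [exact: cvg_fst|exact: cvg_fst].
have c12 : continuous (fun z : R * R * R => z.1.2).
  by move=> z; apply: (@cvg_comp _ _ _ fst snd); [exact: cvg_fst|exact: cvg_snd].
have cA : compact A.
  apply: compact_closedI; last first.
    rewrite (_ : [set z | _] = (fun z : R * R * R => z.1.2 - z.1.1) @^-1` [set x | 0 <= x]).
      apply: preimage_closed; last exact: closed_ge.
      by move=> z _; apply: cvgB; [exact: c12|exact: c11].
    by apply/seteqP; split => z /=; rewrite subr_ge0.
  rewrite (_ : _ `&` _ = (`[r1, 1] `*` `[r1, 1]) `*` `[0, tau]).
    by apply: compact_setX; [apply: compact_setX|]; exact: segment_compact.
  by apply/seteqP; split => z /=; rewrite !in_itv.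
have A0 : A !=set0.
  exists ((r1, r1), 0) => /=; have r11 := ltW (andP r101).2.
  by rewrite /A /= !lexx r11 (ltW tau0).
have cG : {within A, continuous G}.
  apply: withinN; apply: withinM.
    apply: continuous_subspaceT => z.
    apply: (@continuous_comp _ _ _ (fun z : R * R * R => - (k + 1) * z.2) expR);
      last exact: continuous_expR.
    by apply: cvgM; [exact: cvg_cst|exact: cvg_snd].
  have g1 : {within A, continuous (fun z : R * R * R => (z.1.1, z.2))}.
    apply: continuous_subspaceT => z.
    apply: (@cvg_pair _ _ _ (nbhs z) (nbhs z.1.1) (nbhs z.2)); [exact: c11|exact: cvg_snd].
  have g2 : {within A, continuous (fun z : R * R * R => (z.1.2, z.2))}.
    apply: continuous_subspaceT => z.
    apply: (@cvg_pair _ _ _ (nbhs z) (nbhs z.1.2) (nbhs z.2)); [exact: c12|exact: cvg_snd].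
  apply: withinD; first exact: (within_comp AC2 g2 h_cont).
  exact: (withinN (within_comp AC1 g1 h_cont)).
have [[[r0 r0'] t0]] := compact_EVT_min A0 cA cG.
rewrite inE => -[[[/= r0in r0'in] t0in] r0r0'] Gmin.
have mx x y s : r1 <= x <= y -> y <= 1 -> 0 <= s <= tau ->
    expR (- (k + 1) * s) * (h y s - h x s) <= expR (- (k + 1) * t0) * (h r0' t0 - h r0 t0).
  move=> /andP[r1x xy] y1 sin; have /Gmin : ((x, y), s) \in A.
    by rewrite inE /A/= r1x xy y1 (le_trans xy y1) (le_trans r1x xy).
  by rewrite /G/= lerN2.
have h0 : h r0' t0 <= h r0 t0.
  apply: (@h_le_of_max tau (k + 1)) => //.
  - by rewrite tau0.
  - move=> x s xin /andP[s0 stau]; apply: inflow => //.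
    by rewrite s0 (le_trans stau).
  - by move=> x s x01 s01 Ns; rewrite (le_lt_trans (Fk _ _ x01 s01 Ns))// ltrDl.
  - by rewrite r0r0' andbT; case/andP: r0in.
  - by case/andP: r0'in.
have decr x y s : r1 <= x <= y -> y <= 1 -> 0 <= s <= tau -> h y s <= h x s.
  move=> xy y1 sin; rewrite -subr_le0 -(pmulr_rle0 _ (expR_gt0 (- (k + 1) * s))).
  by apply: (le_trans (mx _ _ _ xy y1 sin)); rewrite pmulr_rle0 ?expR_gt0// subr_le0.
move=> r t r1r tin.
have r01 := r01_itv r1r.
have tT := tT_itv tauT tin.
have : (rhor r t + m t * rho r t) * expR (m t * r) <= 0.
  apply: (derive_le0_right (h_derive_r r01 tT) (e:=1 - r)).
    by rewrite subr_gt0; case/andP: r1r.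
  move=> e /andP[egt0 er]; apply: decr => //; last by lra.
  by case/andP: r1r => -> _; rewrite lerDl ltW.
rewrite pmulr_lle0 ?expR_gt0//.
have Nt : N * t <= 1.
  by apply: le_trans Ntau; rewrite ler_pM2l//; case/andP: tin.
have : 0 <= (1 - N * t) * rho r t by rewrite mulr_ge0 ?subr_ge0// ltW// rho_gt0.
rewrite /m; lra.
Qed.

End GradientPropagation.
End DensityGradient.

(** * Minimum principle and Hopf barrier *)

(** The momentum balance fails strictly where u touches the barrier from above, with g and g' the
    values of the profile and of its derivative. The 7 in nu (2 b - 7) is 5 from 2 ur / x, as 2 *
    (5/4) * 2, plus 2 from 2 u / x^2, as 2 * (1/4) * 4. What remains of the viscous term dominates
    rho ut, because rho <= K Th; the term in Thr has a favourable sign once 4 |lb| g <= nu. *)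
Lemma barrier_momentum (R : realFieldType) (rho Th u ur urr ut p_r Thr nu lb K b eps g g' x : R) :
  2^-1 < x < 1 -> 0 < nu -> 0 < eps -> 0 < rho -> 0 < Th -> rho <= K * Th ->
  K <= nu * (2 * b - 7) -> 1 <= g' <= 5 / 4 -> 0 <= g <= 4^-1 ->
  4 * `|lb| * g <= nu -> p_r < 0 -> Thr <= 0 ->
  0 <= u <= eps * g -> ut <= eps -> ur = - (eps * g') -> eps * (2 * b) <= urr ->
  rho * (ut + u * ur) + p_r <
    nu * Th * (urr + 2 * (ur / x) - 2 * (u / x ^+ 2)) + Thr * (nu * ur + 2 * lb * (u / x)).
Proof.
move=> /inv_half_itv[x0 xi xi2] nu0 eps0 rp Tp rT Kb g'1 g1 lbg pr0 Thr0 /andP[u0 ug] ute urE urre.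
have Ur_le : ur <= - eps.
  by rewrite urE lerN2 ler_peMr ?(ltW eps0)//; case/andP: g'1.
have L : rho * (ut + u * ur) <= rho * eps.
  rewrite ler_pM2l//; have : u * ur <= 0.
    by rewrite mulr_ge0_le0// (le_trans Ur_le)// oppr_le0 ltW.
  by move: ute; clear; lra.
have R1 : nu * Th * (eps * (2 * b - 7)) <= nu * Th * (urr + 2 * (ur / x) - 2 * (u / x ^+ 2)).
  rewrite ler_pM2l ?mulr_gt0//.
  have H1 : - (eps * (5 / 4 * 2)) <= ur / x.
    rewrite urE mulNr lerN2 -[leLHS]mulrA ler_pM2l//.
    case/andP: g'1 => ? ?; case/andP: xi => ? ?; apply: ler_pM => //; last exact: ltW.
    by apply: le_trans ler01 _.
  have H2 : u / x ^+ 2 <= eps * g * 4.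
    by case/andP: xi2 => /ltW ? ?; apply: ler_pM.
  have H3 : eps * g <= eps * 4^-1 by rewrite ler_pM2l//; case/andP: g1.
  by move: H1 H2 H3 urre; clear; lra.
have R2 : 0 <= Thr * (nu * ur + 2 * lb * (u / x)).
  apply: mulr_le0 => //.
  have H1 : nu * ur <= nu * - eps by rewrite ler_pM2l.
  have H2 : lb * (u / x) <= `|lb| * (eps * g * 2).
    apply: le_trans (ler_norm _) _; rewrite normrM ler_wpM2l//.
    rewrite ger0_norm; last by rewrite divr_ge0// ltW.
    by case/andP: xi => /ltW ? ?; apply: ler_pM.
  have H3 : eps * (4 * `|lb| * g) <= eps * nu by rewrite ler_pM2l.
  by move: H1 H2 H3; clear; lra.
have R3 : K * Th * eps <= nu * (2 * b - 7) * Th * eps.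
  by rewrite ler_pM2r// ler_pM2r.
have R4 : rho * eps <= K * Th * eps by rewrite ler_pM2r.
by move: L R1 R2 R3 R4 pr0; clear; lra.
Qed.

Section Positivity.
Variables (R : realType) (T : R).
Variables (rho U Th p_r Thr rhor Ur Urr rhot Ut : R -> R -> R).
Variables (nu lb B K : R).
Implicit Types (r t e x y z a b tau : R).
Hypothesis T0 : 0 < T.
Hypothesis flow : radial_flow T rho U Th p_r Thr rhor Ur Urr rhot Ut nu lb B K.

Let C := shell_closed T.
Let D := shell T.
Let rhoC : cont2 C rho := rf_rho_cont flow.
Let UC : cont2 C U := rf_U_cont flow.
Let UrC : cont2 D Ur := rf_Ur_cont flow.
Let UrrC : cont2 D Urr := rf_Urr_cont flow.
Let ThC : cont2 D Th := rf_Th_cont flow.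
Let ThrC : cont2 D Thr := rf_Thr_cont flow.
Let prC : cont2 D p_r := rf_p_r_cont flow.
Let dU := rf_Ur flow.
Let dUr := rf_Urr flow.
Let dUt := rf_Ut flow.
Let momentum := rf_momentum flow.
Let rho_gt0 := rf_rho_gt0 flow.
Let Th_gt0 := rf_Th_gt0 flow.
Let U1 := rf_U1 flow.
Let UB := rf_bound flow.
Let rhoTh := rf_rhoTh flow.

Hypotheses (nu0 : 0 < nu) (bulk0 : 0 < nu + 2 * lb).
Variable e0 : R.
Hypothesis init_U : forall r, 2^-1 < r < 1 -> 1 - e0 < r -> 0 <= U r 0.

(** * Positive velocity on the inner side of the boundary layer *)

Section InflowSign.
Variables (r1 tau : R).
Hypotheses (r101 : 2^-1 < r1 < 1) (r1e : 1 - e0 < r1) (tauT : 0 < tau < T).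
Hypothesis src : forall t, 0 <= t <= tau -> p_r r1 t < 0.

(** By the momentum equation [E] is rho Ut at r1 for 0 < t < T. Its continuity down to t = 0 stands
    in for that of Ut. *)
Let E t := nu * Th r1 t * (Urr r1 t + 2 * (Ur r1 t / r1) - 2 * (U r1 t / r1 ^+ 2))
  + Thr r1 t * (nu * Ur r1 t + 2 * lb * (U r1 t / r1)) - p_r r1 t
  - rho r1 t * (U r1 t * Ur r1 t).

Let slC (f : R -> R -> R) : cont2 C f -> {within `[0, T], continuous (f r1)}.
Proof.
move=> fc; apply: (within_slice_r fc) => t /=; rewrite in_itv/= => tT; split=> //=.
by case/andP: r101 => /ltW -> /ltW ->.
Qed.

Let slD (f : R -> R -> R) : cont2 D f -> {within `[0, T], continuous (f r1)}.
Proof.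
move=> fc; apply: (within_slice_r fc) => t /=; rewrite in_itv/= => tT; split=> //=.
by case/andP: r101 => /ltW -> ->.
Qed.

Let E_cont : {within `[0, T], continuous E}.
Proof.
rewrite /E.
have cst (c : R) : {within `[0, T], continuous (fun _ : R => c)} by exact: within_cst.
have [[cU cUr] cUrr] := (slC UC, slD UrC, slD UrrC).
have [[[cTh cThr] cpr] crho] := (slD ThC, slD ThrC, slD prC, slC rhoC).
apply: withinD; last by apply: withinN; apply: withinM => //; exact: withinM.
apply: withinD; last exact: withinN.
apply: withinD.
  apply: withinM; first exact: withinM.
  apply: withinD; first apply: withinD => //.
    by apply: withinM => //; exact: withinM.
  by apply: withinN; apply: withinM => //; exact: withinM.
apply: withinM => //; apply: withinD; first exact: withinM.
by apply: withinM => //; exact: withinM.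
Qed.

Lemma gt0_near0 (f : R -> R) : {within `[0, T], continuous f} -> 0 < f 0 ->
  exists2 e, 0 < e & forall t, 0 <= t < e -> t <= T -> 0 < f t.
Proof.
move=> /subspace_continuousP fc f0.
have T00 : [set` `[0, T]] (0 : R) by rewrite /= in_itv/= lexx ltW.
have /(@cvgr_gt _ _ _ _ _ _)/(_ _ f0) := fc _ T00.
move=> /nbhs_ballP[e /= egt0 He]; exists e => // t /andP[t0 te] tT.
by apply: He; rewrite /ball/= ?sub0r ?normrN ?ger0_norm// in_itv/= t0.
Qed.

(** If U r1 0 > 0, continuity suffices. Otherwise r1 is an interior minimum of the initial velocity,
    the viscous force there is nonnegative, and the pressure gradient accelerates the fluid outwards
    at once. *)
Lemma inflow_gt0 : exists2 tau', 0 < tau' <= tau & forall t, 0 < t <= tau' -> 0 < U r1 t.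
Proof.
case/andP: tauT => tau0 tau1.
have T00 : 0 <= (0 : R) <= T by rewrite lexx ltW.
have U0 : 0 <= U r1 0 by exact: init_U.
suff [e egt0 He] : exists2 e, 0 < e & forall t, 0 < t < e -> t <= T -> 0 < U r1 t.
  exists (Num.min (e / 2) tau).
    by rewrite lt_min divr_gt0//= tau0 ge_min lexx orbT.
  move=> t /andP[t0]; rewrite le_min => /andP[te tT]; apply: He; last lra.
  by apply/andP; split=> //; lra.
move: U0; rewrite le_eqVlt => /predU1P[U0|U0]; last first.
  have [e egt0 He] := gt0_near0 (slC UC) U0.
  by exists e => // t /andP[t0 te] tT; apply: He => //; rewrite (ltW t0).
have [Ur0 Urr0] : Ur r1 0 = 0 /\ 0 <= Urr r1 0.
  case/andP: r101 => r1h r11.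
  pose d := Num.min (1 - r1) (Num.min (r1 - 2^-1) (r1 - (1 - e0))).
  have yin y : `|y - r1| < d -> 2^-1 < y < 1 /\ 1 - e0 < y.
    rewrite !lt_min !ltr_norml => /andP[/andP[? ?] /andP[/andP[? ?] /andP[? ?]]].
    by split; [apply/andP; split|]; lra.
  apply: (@derive2_ge0_min _ (U^~ 0) (Ur^~ 0) r1 _ d).
  - by rewrite !lt_min !subr_gt0 r11 r1h.
  - by move=> y /yin[y01 _]; exact: dU.
  - exact: dUr.
  - by move=> y /yin[y01 ye]; rewrite -U0 init_U.
(* With U = Ur = 0 at r1 only nu Th Urr >= 0 and - p_r > 0 survive. *)
have E0 : 0 < E 0.
  rewrite /E -U0 Ur0 !mul0r !mulr0 !addr0 !subr0.
  rewrite subr_gt0 mulr0 addr0; apply: lt_le_trans (src _) _.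
    by rewrite lexx ltW.
  by rewrite mulr_ge0// mulr_ge0// ltW// Th_gt0.
have [e egt0 He] := gt0_near0 E_cont E0.
exists (Num.min e T) => [|t]; first by rewrite lt_min egt0.
rewrite lt_min => /andP[t0 /andP[te tT]] _.
have [||s sin] := @MVT R (U r1) (Ut r1) 0 t t0.
- move=> s; rewrite in_itv/= => /andP[s0 st]; apply: dUt => //.
  by rewrite s0 (lt_trans st).
- apply: (continuous_subspaceW _ (slC UC)) => s /=; rewrite !in_itv/= => /andP[-> /le_trans->]//.
  exact: ltW.
move: sin; rewrite in_itv/= => /andP[s0 st].
have sT : 0 < s < T by rewrite s0 (lt_trans st).
rewrite -U0 !subr0 => ->; rewrite mulr_gt0//.
have Es : 0 < E s.
  by apply: He; [rewrite (ltW s0) (lt_trans st)|case/andP: sT => _ /ltW].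
have rp : 0 < rho r1 s by apply: rho_gt0 => //; case/andP: sT => /ltW -> /ltW.
rewrite -(pmulr_rgt0 _ rp).
have := momentum r101 sT; move: Es; rewrite /E; lra.
Qed.

End InflowSign.

(** * Minimum principle and barrier in the boundary layer *)

Section Comparison.
Variables (r1 tau : R).
Hypotheses (r101 : 2^-1 < r1 < 1) (r1e : 1 - e0 < r1) (tauT : 0 < tau < T).
Hypothesis src : forall r t, r1 <= r < 1 -> 0 <= t <= tau -> p_r r t < 0 /\ Thr r t <= 0.
Hypothesis inflow : forall t, 0 < t <= tau -> 0 < U r1 t.

Let r01_itv r : r1 <= r < 1 -> 2^-1 < r < 1.
Proof. by case/andP: r101 => + _ /andP[+ ->] => /lt_le_trans/[apply] ->. Qed.

Let box_C a b t1 t2 : r1 <= a -> b <= 1 -> 0 <= t1 -> t2 <= tau ->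
  [set` `[a, b]] `*` [set` `[t1, t2]] `<=` C.
Proof.
move=> ra b1 t10 t2tau z [] /=; rewrite !in_itv/= => /andP[? ?] /andP[? ?].
case/andP: tauT => ? ?; case/andP: r101 => ? ?.
by split; apply/andP; split; lra.
Qed.

Let time_itv t : 0 < t <= tau -> 0 < t < T.
Proof. by case/andP: tauT => ? ? /andP[-> /le_lt_trans->]. Qed.

(* U / r is minimized rather than U: on U = c r the zeroth-order viscous terms
   reduce to Thr (nu + 2 lb) c, whose sign is known. *)
Lemma U_ge0 r t : r1 <= r <= 1 -> 0 <= t <= tau -> 0 <= U r t.
Proof.
case/andP: (tauT) => tau0 tau1; case/andP: (r101) => r1h r11.
pose A : set (R * R) := `[r1, 1] `*` `[0, tau].
have AC : A `<=` C by exact: box_C.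
have cA : compact A by apply: compact_setX; exact: segment_compact.
have A0 : A !=set0 by exists (r1, 0); split; rewrite /= in_itv/= lexx ltW.
(* As |U / r| <= 2 B, this damping rate makes k + U / r nonnegative, so the inertial term U (k + U /
   r) has the sign of U at a negative minimum. *)
pose k := 2 * B.
pose V (z : R * R) := expR (- k * z.2) * (U z.1 z.2 / z.1).
have cV : {within A, continuous V}.
  apply: withinM.
    apply: continuous_subspaceT => z.
    apply: (@continuous_comp _ _ _ (fun z : R * R => - k * z.2) expR);
      last exact: continuous_expR.
    by apply: cvgM; [exact: cvg_cst|exact: cvg_snd].
  apply: withinM; first exact: continuous_subspaceW AC UC.
  apply: withinV; last by apply: continuous_subspaceT => z; exact: cvg_fst.
  by move=> z /AC[/andP[? _] _]; apply: lt0r_neq0; lra.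
have [[x s]] := compact_EVT_min A0 cA cV.
rewrite inE => -[/=]; rewrite !in_itv/= => xin sin Vmin.
have [V0|V0] := leP 0 (V (x, s)).
  move=> rin tin; have r0 : 0 < r by case/andP: rin => ? ?; lra.
  have : V (x, s) <= V (r, t) by apply: Vmin; rewrite inE; split; rewrite /= in_itv.
  move=> /(le_trans V0); rewrite /V/= pmulr_rge0 ?expR_gt0//.
  by rewrite pmulr_lge0// invr_gt0.
exfalso.
have x0 : 0 < x by case/andP: xin => ? ?; lra.
have Uneg : U x s < 0.
  by move: V0; rewrite /V/= pmulr_rlt0 ?expR_gt0// pmulr_llt0// invr_gt0.
have sT : 0 <= s <= T by exact: tT_itv tau1 sin.
have x1 : x < 1.
  rewrite lt_neqAle; case/andP: xin => _ ->; rewrite andbT.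
  by apply/eqP => E; move: Uneg; rewrite E U1// ltxx.
have s0 : 0 < s.
  rewrite lt_neqAle; case/andP: sin => -> _; rewrite andbT.
  apply/eqP => E; move: Uneg; rewrite -E ltNge init_U//.
    by apply: r01_itv; rewrite x1; case/andP: xin => ->.
  by case/andP: xin => + _; exact: lt_le_trans.
have s0T : 0 < s < T by apply: time_itv; rewrite s0; case/andP: sin.
have r1x : r1 < x.
  rewrite lt_neqAle; case/andP: xin => -> _; rewrite andbT.
  apply/eqP => E; move: Uneg; rewrite -E ltNge ltW// inflow// s0.
  by case/andP: sin.
have x01 : 2^-1 < x < 1 by apply: r01_itv; rewrite x1 ltW.
set v := V (x, s) in V0 Vmin.
(* Minimality of V says that U lies above v exp(k q) y with contact at (x, s); the conditions on Ut,
   Ur and Urr come from this comparison. *)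
have Uv y q : r1 <= y <= 1 -> 0 <= q <= tau -> v * expR (k * q) * y <= U y q.
  move=> yin qin; have y0 : 0 < y by case/andP: yin => ? ?; lra.
  have : v <= V (y, q) by apply: Vmin; rewrite inE; split; rewrite /= in_itv.
  rewrite /V/= mulNr expRN => h.
  have e0' : expR (k * q) != 0 by rewrite lt0r_neq0// expR_gt0.
  have -> : U y q = (expR (k * q))^-1 * (U y q / y) * (expR (k * q) * y).
    by field; rewrite e0' lt0r_neq0.
  by rewrite -mulrA ler_pM2r// mulr_gt0// expR_gt0.
have Uxs : U x s = v * expR (k * s) * x.
  rewrite /v /V/= mulNr expRN.
  have e0' : expR (k * s) != 0 by rewrite lt0r_neq0// expR_gt0.
  by field; rewrite e0' lt0r_neq0.
have Ut_le : Ut x s <= k * U x s.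
  have de : is_derive s (1 : R) (fun q => expR (k * q)) (expR (k * s) * k).
    apply: (@is_derive1_comp _ expR (fun q => k * q)).
    by apply: is_derive_eq; rewrite /GRing.scale /= mulr1.
  have dx := dUt x01 s0T.
  have dp : is_derive s (1 : R) (fun q => U x q - v * expR (k * q) * x) (Ut x s - k * U x s).
    by apply: is_derive_eq; rewrite Uxs /GRing.scale /=; ring.
  rewrite -subr_le0; apply: (derive_le0_left dp s0) => q /andP[q0 qs].
  rewrite -Uxs subrr subr_ge0; apply: Uv; first by rewrite !ltW.
  by case/andP: sin => _ ?; rewrite subr_ge0 (ltW qs)/=; lra.
have [Ur_eq Urr_ge] : Ur x s - v * expR (k * s) = 0 /\ 0 <= Urr x s.
  apply: (@derive2_ge0_min _ (fun y => U y s - v * expR (k * s) * y)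
    (fun y => Ur y s - v * expR (k * s)) x _ (Num.min (x - r1) (1 - x))).
  - by rewrite lt_min !subr_gt0 r1x.
  - move=> y; rewrite lt_min !ltr_norml => /andP[/andP[? ?] /andP[? ?]].
    have y01 : 2^-1 < y < 1 by apply/andP; split; lra.
    have dy := dU y01 sT.
    by apply: is_derive_eq; rewrite /GRing.scale /= mulr1.
  - have dy := dUr x01 sT.
    by apply: is_derive_eq; rewrite subr0.
  - move=> y; rewrite lt_min !ltr_norml => /andP[/andP[? ?] /andP[? ?]].
    rewrite -Uxs subrr subr_ge0; apply: Uv => //.
    by apply/andP; split; lra.
have {}Ur_eq : Ur x s = U x s / x.
  by rewrite Uxs mulfK ?lt0r_neq0//; lra.
have [pr0 Thr0] : p_r x s < 0 /\ Thr x s <= 0 by apply: src => //; rewrite x1 ltW.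
have rp := rho_gt0 x01 sT; have Tp := Th_gt0 x01 sT.
have [UB1 _ _] := UB x01 s0T.
have := momentum x01 s0T; apply/eqP; rewrite lt_eqF//.
have Ux : U x s / x < 0 by rewrite pmulr_llt0// invr_gt0.
have [_ xi _] := inv_half_itv x01.
have L : rho x s * (Ut x s + U x s * Ur x s) <= 0.
  rewrite pmulr_rle0// Ur_eq; apply: (@le_trans _ _ (U x s * (k + U x s / x))).
    by rewrite mulrDr lerD2r mulrC.
  rewrite nmulr_rle0// /k.
  have : - B <= U x s by move: UB1; rewrite ler_norml => /andP[].
  by case/andP: xi => ? ?; nra.
have R1 : 0 <= nu * Th x s * (Urr x s + 2 * (Ur x s / x) - 2 * (U x s / x ^+ 2)).
  apply: mulr_ge0; first by rewrite mulr_ge0// ltW.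
  rewrite Ur_eq.
  have -> : U x s / x / x = U x s / x ^+ 2 by rewrite expr2 invfM mulrA.
  by rewrite addrK.
have R2 : 0 <= Thr x s * (nu * Ur x s + 2 * lb * (U x s / x)).
  apply: mulr_le0 => //; rewrite Ur_eq -mulrDl.
  by apply: mulr_ge0_le0; rewrite ltW.
lra.
Qed.

(** At an interior zero U would be minimal in r and in earlier times, so Ut <= 0, Ur = 0 and Urr >=
    0; the strictly negative pressure gradient is then incompatible with the momentum equation. *)
Lemma U_gt0 r t : r1 <= r < 1 -> 0 < t <= tau -> 0 < U r t.
Proof.
move=> rin tin.
move: (rin) => /andP[]; rewrite le_eqVlt => /predU1P[<- _|r1r r_lt1]; first exact: inflow.
have t0T := time_itv tin.
have tin0 : 0 <= t <= tau by case/andP: tin => /ltW ->.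
have tT : 0 <= t <= T by case/andP: t0T => /ltW -> /ltW.
have r01 := r01_itv rin.
have : 0 <= U r t by apply: U_ge0 => //; case/andP: rin => -> /ltW.
rewrite le_eqVlt => /predU1P[U0|//]; exfalso.
have Ut_le : Ut r t <= 0.
  case/andP: (tin) => t0 ttau.
  apply: (derive_le0_left (dUt r01 t0T) t0) => q /andP[q0 qt].
  rewrite -U0; apply: U_ge0; first by rewrite !ltW.
  by rewrite subr_ge0 (ltW qt)/=; lra.
have [Ur0 Urr_ge] : Ur r t = 0 /\ 0 <= Urr r t.
  apply: (@derive2_ge0_min _ (U^~ t) (Ur^~ t) r _ (Num.min (r - r1) (1 - r))).
  - by rewrite lt_min !subr_gt0 r1r.
  - move=> y; rewrite lt_min !ltr_norml => /andP[/andP[? ?] /andP[? ?]].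
    by apply: dU => //; apply: r01_itv; apply/andP; split; lra.
  - exact: dUr.
  - move=> y; rewrite lt_min !ltr_norml => /andP[/andP[? ?] /andP[? ?]].
    by rewrite -U0; apply: U_ge0 => //; apply/andP; split; lra.
have [pr0 _] := src rin tin0.
have := momentum r01 t0T; apply/eqP; rewrite lt_eqF//.
rewrite Ur0 -U0 !mul0r !mulr0 !addr0 subr0 mulr0 addr0.
have R1 : 0 <= nu * Th r t * Urr r t.
  by rewrite mulr_ge0// mulr_ge0 ?ltW// Th_gt0.
have : rho r t * Ut r t <= 0 by rewrite pmulr_rle0// rho_gt0.
lra.
Qed.

(* Hopf barrier: eps (g(1 - r) - (t2 - t)) with g(x) = x + b x^2 is a strict
   subsolution, because rho <= K Th bounds the degeneracy of the time derivative. *)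
Definition barrier b eps t2 (z : R * R) : R :=
  eps * ((1 - z.1) + b * (1 - z.1) ^+ 2 - (t2 - z.2)).

(** At a minimum of U minus the barrier, Ut <= eps, Ur = - eps g' and Urr >= 2 b eps. If the value
    there were negative, U would lie between 0 and eps g, and [barrier_momentum] would contradict
    the momentum equation. *)
Lemma barrier_no_touching b eps t1 t2 x s : 0 < b -> b * (1 - r1) <= 8^-1 ->
  1 - r1 <= 8^-1 -> 8 * `|lb| * (1 - r1) <= nu -> K <= nu * (2 * b - 7) ->
  0 < eps -> 0 < t1 -> t2 <= tau -> r1 < x < 1 -> t1 < s <= t2 ->
  (forall y q, r1 <= y <= 1 -> t1 <= q <= t2 ->
    U x s - barrier b eps t2 (x, s) <= U y q - barrier b eps t2 (y, q)) ->
  barrier b eps t2 (x, s) <= U x s.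
Proof.
move=> b0 br1 r1s lbr1 Kb eps0 t10 t2tau /andP[r1x x1] /andP[t1s st2] Zmin.
rewrite leNgt; apply/negP => UZ.
have s0tau : 0 < s <= tau by rewrite (lt_trans t10)// (le_trans st2).
have xr1 : r1 <= x < 1 by rewrite x1 ltW.
have s0T := time_itv s0tau; have x01 := r01_itv xr1.
have sT : 0 <= s <= T by case/andP: s0T => /ltW -> /ltW.
have sin0 : 0 <= s <= tau by case/andP: s0tau => /ltW ->.
have U0 : 0 <= U x s by apply: U_ge0 => //; rewrite !ltW.
have [pr0 Thr0] := src xr1 sin0.
have rp := rho_gt0 x01 sT; have Tp := Th_gt0 x01 sT.
have rT := rhoTh x01 s0T.
have Ut_le : Ut x s <= eps.
  have dx := dUt x01 s0T.
  have dp : is_derive s (1 : R) (fun q => U x q - barrier b eps t2 (x, q)) (Ut x s - eps).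
    by rewrite /barrier/=; apply: is_derive_eq; rewrite /GRing.scale/=; ring.
  rewrite -subr_le0; apply: (derive_le0_left dp (e:=s - t1)); first by rewrite subr_gt0.
  move=> q /andP[q0 qs]; apply: Zmin; first by rewrite !ltW.
  rewrite (_ : t1 <= s - q); last by move: qs; lra.
  by rewrite (le_trans _ st2)// gerBl ltW.
pose g' y := 1 + 2 * b * (1 - y).
have [Ur_eq Urr_ge] : Ur x s + eps * g' x = 0 /\ 0 <= Urr x s - eps * (2 * b).
  apply: (@derive2_ge0_min _ (fun y => U y s - barrier b eps t2 (y, s))
    (fun y => Ur y s + eps * g' y) x _ (Num.min (x - r1) (1 - x))).
  - by rewrite lt_min !subr_gt0 r1x.
  - move=> y; rewrite lt_min !ltr_norml => /andP[/andP[h1 _] /andP[_ h2]].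
    have y01 : 2^-1 < y < 1.
      by apply: r01_itv; move: h1 h2 => h1 h2; apply/andP; split; lra.
    have dy := dU y01 sT.
    by rewrite /barrier/= /g'; apply: is_derive_eq; rewrite /GRing.scale /=; ring.
  - have dy := dUr x01 sT.
    by rewrite /g'; apply: is_derive_eq; rewrite /GRing.scale /=; ring.
  - move=> y; rewrite lt_min !ltr_norml => /andP[/andP[h1 _] /andP[_ h2]].
    apply: Zmin; last by rewrite ltW.
    by move: h1 h2 => h1 h2; apply/andP; split; lra.
have x1r : 0 < 1 - x by rewrite subr_gt0.
have xr : 1 - x <= 1 - r1 by rewrite lerD2l lerN2 ltW.
have bx0 : 0 < b * (1 - x) by rewrite mulr_gt0.
have bx : b * (1 - x) <= 8^-1 by apply: le_trans br1; rewrite ler_pM2l.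
have bxx : b * (1 - x) ^+ 2 <= 8^-1 * (1 - x) by rewrite expr2 mulrA ler_pM2r.
have bxx0 : 0 <= b * (1 - x) ^+ 2 by rewrite mulr_ge0 ?sqr_ge0// ltW.
have gle : (1 - x) + b * (1 - x) ^+ 2 <= 2 * (1 - r1) by move: xr bxx x1r; lra.
have := momentum x01 s0T; apply/eqP; rewrite lt_eqF//.
apply: (@barrier_momentum _ _ _ _ _ _ _ _ _ _ _ K b eps
  ((1 - x) + b * (1 - x) ^+ 2) (g' x)) => //.
- by rewrite /g'; move: bx0 bx => ? ?; apply/andP; split; lra.
- by move: gle r1s x1r bxx0 => ? ? ? ?; apply/andP; split; lra.
- apply: le_trans lbr1; rewrite [leRHS](_ : _ = 4 * `|lb| * (2 * (1 - r1))); last first.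
    by ring.
  by rewrite ler_wpM2l// mulr_ge0.
- rewrite U0 (le_trans (ltW UZ))// /barrier/= ler_pM2l// gerBl.
  by rewrite subr_ge0.
- by move: Ur_eq; lra.
- by rewrite -subr_ge0.
Qed.

Lemma barrier_cont b eps t2 : continuous (barrier b eps t2).
Proof.
move=> z; have c1 : (1 - z'.1) @[z' --> z] --> (1 - z.1).
  by apply: cvgB; [exact: cvg_cst|exact: cvg_fst].
apply: cvgM; first exact: cvg_cst.
apply: cvgB; last by apply: cvgB; [exact: cvg_cst|exact: cvg_snd].
apply: cvgD; first exact: c1.
by apply: cvgM; [exact: cvg_cst|exact: (cvgM c1 c1)].
Qed.

(** Comparison with the barrier on [r1, 1] x [t1, t2]. At time t2 the barrier is eps times (1 - r) +
    b (1 - r)^2, hence at least eps (1 - r). *)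
Lemma U_ge_linear b t2 : 0 < b -> b * (1 - r1) <= 8^-1 -> 1 - r1 <= 8^-1 ->
  8 * `|lb| * (1 - r1) <= nu -> K <= nu * (2 * b - 7) -> 0 < t2 <= tau ->
  exists2 eps, 0 < eps & forall r, r1 <= r <= 1 -> eps * (1 - r) <= U r t2.
Proof.
move=> b0 br1 r1s lbr1 Kb /andP[t20 t2tau].
case/andP: (r101) => r1h r11.
have gx y : r1 <= y <= 1 -> 0 <= 1 - y + b * (1 - y) ^+ 2 <= 2 * (1 - y).
  move=> /andP[ry y1]; have y1' : 0 <= 1 - y by rewrite subr_ge0.
  rewrite addr_ge0 ?mulr_ge0 ?sqr_ge0 ?(ltW b0)//= mulrDl mul1r lerD2l.
  rewrite expr2 mulrA ler_piMl//; apply: (@le_trans _ _ 8^-1); last by lra.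
  by apply: le_trans br1; rewrite ler_pM2l// lerD2l lerN2.
pose t1 := t2 / 2.
have t10 : 0 < t1 by rewrite divr_gt0.
have t1t2 : t1 < t2 by rewrite ltr_pdivrMr// ltr_pMr// ltr1n.
have t2t1 : t2 - t1 = t1 by rewrite /t1; field.
(* In the strip 1 - xs < x one has g <= 2 (1 - x) <= t1 = t2 - t1, so the barrier is nonpositive
   there at the starting time t1. *)
pose xs := Num.min (t1 / 2) (1 - r1).
have xs0 : 0 < xs by rewrite lt_min divr_gt0//= subr_gt0.
have xst : xs <= t1 / 2 by rewrite ge_min lexx.
have xsr : r1 <= 1 - xs by rewrite lerBrDl -lerBrDr ge_min lexx orbT.
have xs1 : 1 - xs < 1 by rewrite gtrBl.
have cbox a d : compact (([set` `[a, d]] : set R) `*` ([set` `[t1, t2]] : set R)).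
  by apply: compact_setX; exact: segment_compact.
pose A1 : set (R * R) := `[r1, 1 - xs] `*` `[t1, t2].
have A10 : A1 !=set0.
  by exists (r1, t1); split; rewrite /= in_itv/= ?lexx ?xsr ?(ltW t1t2).
have cU1 : {within A1, continuous (fun z : R * R => U z.1 z.2)}.
  by apply: continuous_subspaceW UC; apply: box_C => //; exact: ltW.
have [[rm tm]] := compact_EVT_min A10 (cbox _ _) cU1.
rewrite inE => -[/=]; rewrite !in_itv/= => /andP[rm1 rm2] /andP[tm1 tm2] Umin.
(* The minimum of U outside the strip of width [xs], positive by [U_gt0]. Outside the strip the
   barrier is at most eps, because 2 (1 - r1) <= 1. *)
set eps := U rm tm in Umin.
have eps0 : 0 < eps.
  apply: U_gt0; first by rewrite rm1 (le_lt_trans rm2).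
  by rewrite (lt_le_trans t10)// (le_trans tm2).
exists eps => //.
pose A : set (R * R) := `[r1, 1] `*` `[t1, t2].
have AC : A `<=` C by apply: box_C => //; exact: ltW.
have A0 : A !=set0 by exists (r1, t1); split; rewrite /= in_itv/= lexx ltW.
pose Z := barrier b eps t2.
have cZ : {within A, continuous (fun z : R * R => U z.1 z.2 - Z z)}.
  apply: withinD; first exact: continuous_subspaceW AC UC.
  by apply: withinN; apply: continuous_subspaceT; exact: barrier_cont.
have [[x s]] := compact_EVT_min A0 (cbox _ _) cZ.
rewrite inE => -[/=]; rewrite !in_itv/= => xin sin Zmin.
have sin0 : 0 <= s <= tau.
  by case/andP: sin => t1s st2; rewrite (le_trans (ltW t10))// (le_trans st2).
have Zle : Z (x, s) <= eps * (2 * (1 - x)).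
  rewrite /Z /barrier/= ler_pM2l//; have /andP[_ h] := gx _ xin.
  by apply: le_trans h; rewrite gerBl subr_ge0; case/andP: sin.
suff UZ : Z (x, s) <= U x s.
  move=> r rin; have : U x s - Z (x, s) <= U r t2 - Z (r, t2).
    by apply: (Zmin (r, t2)); rewrite inE; split; rewrite /= in_itv//= lexx ltW.
  have : 0 <= U x s - Z (x, s) by rewrite subr_ge0.
  move=> /le_trans/[apply]; rewrite subr_ge0 {1}/Z /barrier/= subrr subr0; apply: le_trans.
  by rewrite ler_pM2l// lerDl mulr_ge0 ?sqr_ge0// ltW.
have [xle|x_gt] := leP x (1 - xs).
  have : eps <= U x s.
    apply: (Umin (x, s)); rewrite inE; split; rewrite /= in_itv//=.
    by case/andP: xin => ->.
  apply: le_trans; rewrite (le_trans Zle)// ger_pMr//.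
  by case/andP: xin => + _; move: r1s; lra.
have U0 : 0 <= U x s by exact: U_ge0.
case/andP: (sin); rewrite le_eqVlt => /predU1P[sE _|t1s st2].
  apply: le_trans U0; rewrite /Z /barrier/= pmulr_rle0// -sE t2t1 subr_le0.
  by have /andP[_ /le_trans] := gx _ xin; apply; move: x_gt xst; lra.
case/andP: (xin) => _; rewrite le_eqVlt => /predU1P[xE|x1].
  apply: le_trans U0; rewrite /Z /barrier/= pmulr_rle0// xE subrr expr0n/= mulr0 !add0r.
  by rewrite oppr_le0 subr_ge0.
apply: (@barrier_no_touching b eps t1) => //.
- by rewrite x1 (le_lt_trans xsr).
- by rewrite t1s.
- by move=> y q yin qin; apply: (Zmin (y, q)); rewrite inE; split; rewrite /= in_itv.
Qed.

End Comparison.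

End Positivity.

(** Between r and the zero at 1 the mean value theorem yields a slope of at most - eps, while near 1
    flatness allows nothing below - eps / 2. *)
Lemma flat_linear_absurd (R : realType) (f df : R -> R) (r1 eps : R) :
  r1 < 1 -> 0 < eps -> f 1 = 0 -> {within `[r1, 1], continuous f} ->
  (forall r, r1 < r < 1 -> is_derive r (1 : R) f (df r)) ->
  (forall e, 0 < e -> exists2 d, 0 < d & forall r, r1 < r < 1 -> 1 - d < r ->
    `|df r| <= e) ->
  (forall r, r1 <= r <= 1 -> eps * (1 - r) <= f r) -> False.
Proof.
move=> r11 eps0 f1 fc fd flat lin.
have [|d d0 Hd] := flat (eps / 2); first by rewrite divr_gt0.
pose r := Num.max (1 - d / 2) ((r1 + 1) / 2).
have r1r : r1 < r by rewrite lt_max; apply/orP; right; lra.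
have rlt1 : r < 1 by rewrite gt_max; apply/andP; split; lra.
have dr : 1 - d < r by rewrite lt_max; apply/orP; left; lra.
have [||c] := @MVT R f df r 1 rlt1.
- by move=> x; rewrite in_itv/= => /andP[rx x1]; apply: fd; rewrite x1 (lt_trans r1r).
- apply: continuous_subspaceW fc => x /=; rewrite !in_itv/= => /andP[rx ->].
  by rewrite (le_trans (ltW r1r)).
rewrite in_itv/= => /andP[rc c1]; rewrite f1 sub0r => E.
have cin : r1 < c < 1 by rewrite c1 (lt_trans r1r).
have := Hd _ cin (lt_trans dr rc); rewrite ler_norml => /andP[h _].
have rin : r1 <= r <= 1 by rewrite !ltW.
have := lin _ rin; have -> : f r = - df c * (1 - r) by rewrite mulNr -E opprK.
rewrite ler_pM2r ?subr_gt0//; lra.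
Qed.

(** * Contradiction for the radial flow *)

Theorem radial_flow_absurd (R : realType) (T : R)
    (rho U Th p_r Thr rhor Ur Urr rhot Ut : R -> R -> R)
    (nu lb B K M c0 e0 : R) :
  0 < T -> 0 < nu -> 0 < nu + 2 * lb ->
  radial_flow T rho U Th p_r Thr rhor Ur Urr rhot Ut nu lb B K ->
  0 < M -> (forall r t, 2^-1 < r < 1 -> 0 <= t <= T ->
    rhor r t <= - M * rho r t -> p_r r t < 0 /\ Thr r t <= 0) ->
  0 < c0 -> 0 < e0 ->
  (forall r, 2^-1 < r < 1 -> 1 - e0 < r ->
    rhor r 0 <= - (c0 / (1 - r)) * rho r 0) ->
  (forall r, 2^-1 < r < 1 -> 1 - e0 < r -> 0 <= U r 0) ->
  (forall tau : R, 0 < tau < T -> exists2 t2 : R, 0 < t2 < tau &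
    forall e : R, 0 < e -> exists2 d : R, 0 < d & forall r, 2^-1 < r < 1 -> 1 - d < r ->
    `|Ur r t2| <= e) -> False.
Proof.
move=> T0 nu0 bulk0 flow M0 source c0p e0p init_rho init_U good.
(* With this b, nu (2 b - 7) = nu + 2 |K|, which exceeds K. *)
pose b := 4 + `|K| / nu.
have b0 : 0 < b by rewrite ltr_wpDr// divr_ge0// ltW.
have Kb : K <= nu * (2 * b - 7).
  have -> : nu * (2 * b - 7) = nu + 2 * `|K| by rewrite /b; field; rewrite lt0r_neq0.
  by have := ler_norm K; have := normr_ge0 K; lra.
(* Each summand encodes one smallness condition on 1 - r1, so the single choice 1 - r1 = 1 / S meets
   all of them. *)
pose S := 8 + 2 / e0 + (M + 2) / c0 + 8 * b + 8 * `|lb| / nu.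
have p1 : 0 < 2 / e0 by rewrite divr_gt0.
have p2 : 0 < (M + 2) / c0 by rewrite divr_gt0// addr_gt0.
have p3 : 0 < 8 * b by rewrite mulr_gt0.
have p4 : 0 <= 8 * `|lb| / nu by rewrite divr_ge0 ?mulr_ge0// ltW.
have S0 : 0 < S by rewrite /S; lra.
pose r1 := 1 - S^-1.
have r1S : 1 - r1 = S^-1 by rewrite /r1 opprB addrC subrK.
have Sle a : a <= S -> a * (1 - r1) <= 1 by move=> aS; rewrite r1S ler_pdivrMr// mul1r.
have s0 : 0 < 1 - r1 by rewrite r1S invr_gt0.
have s1 : 8 * (1 - r1) <= 1 by apply: Sle; rewrite /S; lra.
have s2 : 2 / e0 * (1 - r1) <= 1 by apply: Sle; rewrite /S; lra.
have s3 : (M + 2) / c0 * (1 - r1) <= 1 by apply: Sle; rewrite /S; lra.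
have s4 : 8 * b * (1 - r1) <= 1 by apply: Sle; rewrite /S; lra.
have s5 : 8 * `|lb| / nu * (1 - r1) <= 1 by apply: Sle; rewrite /S; lra.
have r101 : 2^-1 < r1 < 1 by apply/andP; split; lra.
have r1e : 1 - e0 < r1.
  by move: s2; rewrite mulrAC ler_pdivrMr// mul1r; lra.
have r1c : (M + 2) * (1 - r1) <= c0.
  by move: s3; rewrite mulrAC ler_pdivrMr// mul1r.
have r1lb : 8 * `|lb| * (1 - r1) <= nu.
  by move: s5; rewrite mulrAC ler_pdivrMr// mul1r.
have [tau tauT grad] := density_gradient T0 flow M0 init_rho r101 r1e r1c.
have r01_itv r : r1 <= r < 1 -> 2^-1 < r < 1.
  by case/andP: r101 => h _ /andP[/(lt_le_trans h) -> ->].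
have [tau0 tau1] := andP tauT.
have src r t : r1 <= r < 1 -> 0 <= t <= tau -> p_r r t < 0 /\ Thr r t <= 0.
  move=> rin tin; apply: source; [exact: r01_itv| |exact: grad].
  by case/andP: tin => -> /le_trans->//; exact: ltW.
have r1r1 : r1 <= r1 < 1 by rewrite lexx; case/andP: r101.
have src1 t : 0 <= t <= tau -> p_r r1 t < 0 by move=> /(src _ _ r1r1)[].
have [tau' /andP[tau'0 tau'tau] inflow] := inflow_gt0 T0 flow nu0 init_U r101 r1e tauT src1.
have tau'T : 0 < tau' < T by rewrite tau'0 (le_lt_trans tau'tau).
have src' r t : r1 <= r < 1 -> 0 <= t <= tau' -> p_r r t < 0 /\ Thr r t <= 0.
  by move=> rin /andP[t0 tt]; apply: src => //; rewrite t0 (le_trans tt).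
(* The flat time is chosen last, inside the interval on which density steepness and inflow are
   already available. *)
have [t2 /andP[t20 t2tau] flat] := good _ tau'T.
have [|||eps eps0 lin] := @U_ge_linear R T rho U Th p_r Thr rhor Ur Urr rhot Ut
  nu lb B K flow nu0 bulk0 e0 init_U r1 tau' r101 r1e tau'T src' inflow b t2 b0 _ _ r1lb Kb.
- lra.
- lra.
- by rewrite t20 ltW.
have t2T : 0 <= t2 <= T by rewrite ltW// ltW// (lt_trans t2tau)//; case/andP: tau'T.
apply: (@flat_linear_absurd R (U^~ t2) (Ur^~ t2) r1 eps) => //.
- by case/andP: r101.
- exact: (rf_U1 flow).
- apply: (within_slice (rf_U_cont flow)) => r /=; rewrite in_itv/= => /andP[r1r rl1].
  split=> //=; rewrite rl1 andbT (le_trans _ r1r)// ltW//.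
  by case/andP: r101.
- move=> r /andP[/ltW r1r rl1]; apply: (rf_Ur flow) => //.
  by apply: r01_itv; rewrite r1r.
- move=> e egt0; have [d d0 Hd] := flat _ egt0; exists d => // r /andP[/ltW r1r rl1].
  by apply: Hd; apply: r01_itv; rewrite r1r.
Qed.

(** * Essential suprema and one-sided time derivatives *)

Lemma sum3E (V : nmodType) (F : 'I_3 -> V) :
  \sum_(i < 3) F i = F 0 + F 1 + F 2%R.
Proof.
rewrite !big_ord_recr big_ord0 /= add0r.
by congr (F _ + F _ + F _); apply: val_inj.
Qed.

Section PointwiseBounds.
Variable R : realType.
Implicit Types (a b : R).

Lemma ae_itv (P : R -> Prop) a b : (\forall t \ae @lebesgue_measure R, P t) ->
  a < b -> exists2 t, a < t < b & P t.
Proof.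
move=> [N [mN N0 PN]] ab; apply: contrapT => noP.
have sN : [set` `]a, b[] `<=` N.
  move=> t /=; rewrite in_itv/= => tab; apply: PN => /= Pt.
  by apply: noP; exists t.
have : (lebesgue_measure [set` `]a, b[] <= lebesgue_measure N)%E.
  by apply: le_measure; rewrite ?inE//; exact: measurable_itv.
rewrite N0 lebesgue_measure_itv/= lte_fin ab.
by rewrite -EFinB lee_fin subr_le0 leNgt ab.
Qed.

(* No measurability of f: the lower bound is read off a simple function. *)
Lemma const_le_integral (d : measure_display) (X : measurableType d)
    (m : {measure set X -> \bar R}) (D I : set X) (f : X -> \bar R) (c : R) :
  measurable I -> I `<=` D -> 0 <= c ->
  (forall t, D t -> (0 <= f t)%E) -> (forall t, I t -> (c%:E <= f t)%E) ->
  (c%:E * m I <= \int[m]_(t in D) f t)%E.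
Proof.
move=> mI ID c0 f0 cf; rewrite ge0_integralE//; apply: ereal_sup_ubound.
exists (scale_nnsfun (indic_nnsfun R mI) c0) => /=.
  move=> t; rewrite patchE; case: ifPn => [|].
    rewrite inE => Dt; rewrite /= /measurable_realfun.mindic indicE; case: (boolP (t \in I)) => [|_].
      by rewrite inE => It; rewrite mulr1 cf.
    by rewrite mulr0 f0.
  move=> /negP tD; rewrite /= /measurable_realfun.mindic indicE.
  case: (boolP (t \in I)) => [|_]; last by rewrite mulr0.
  by rewrite inE => /ID Dt; exfalso; apply: tD; rewrite inE.
by rewrite (sintegralrM m c (indic_nnsfun R mI)) sintegral_indic.
Qed.

(** If N were infinite on all of ]a, b[, the integral would be at least c (b - a) for each c; the
    choice c = (M + 1) / (b - a) exceeds its finite value M. *)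
Lemma in_L2_time_finite (T : R) (N : R -> \bar R) a b :
  (forall t, (0 <= N t)%E) -> in_L2_time T N -> 0 <= a -> a < b -> b <= T ->
  exists2 t, a < t < b & (N t < +oo)%E.
Proof.
move=> N0 L2 a0 ab bT; apply: contrapT => noN.
have Ny t : a < t < b -> N t = +oo%E.
  move=> tab; apply/eqP; rewrite -leye_eq leNgt; apply/negP => Nt.
  by apply: noN; exists t.
have ba : 0 < b - a by rewrite subr_gt0.
have I0 : (0 <= \int[@lebesgue_measure R]_(t in `]0%R, T[) (N t * N t))%E.
  by apply: integral_ge0 => t _; rewrite mule_ge0.
have [M ME] : exists M : R, (\int[@lebesgue_measure R]_(t in `]0%R, T[) (N t * N t))%E = M%:E.
  by exists (fine (\int[@lebesgue_measure R]_(t in `]0%R, T[) (N t * N t))%E);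
    rewrite fineK// ge0_fin_numE.
have M0 : 0 <= M by rewrite -lee_fin -ME.
have c0 : 0 <= (M + 1) / (b - a) by apply: divr_ge0; [exact: addr_ge0|exact: ltW].
have IT : [set` `]a, b[] `<=` [set` `]0, T[].
  move=> t /=; rewrite !in_itv/= => /andP[at_ tb].
  by rewrite (le_lt_trans a0)// (lt_le_trans tb).
have : (((M + 1) / (b - a))%:E * lebesgue_measure [set` `]a, b[] <=
    \int[@lebesgue_measure R]_(t in `]0%R, T[) (N t * N t))%E.
  apply: const_le_integral => //.
    by move=> t _; rewrite mule_ge0.
  by move=> t; rewrite /= in_itv/= => /Ny ->; rewrite mulyy leey.
rewrite ME lebesgue_measure_itv/= lte_fin ab -EFinB -EFinM divfK ?gt_eqF//.
by rewrite lee_fin leNgt ltrDl ltr01.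
Qed.

Local Notation leb3 := ((@lebesgue_measure R \x @lebesgue_measure R) \x @lebesgue_measure R)%E.

Lemma ae_cube (Q : R * R * R -> Prop) (x : R * R * R) (e : R) :
  (\forall z \ae leb3, Q z) -> 0 < e -> exists2 z, ball x e z & Q z.
Proof.
move=> [N [mN N0 QN]] e0; apply: contrapT => noQ.
pose I c := [set` `](c - e), (c + e)[].
pose box := (I x.1.1 `*` I x.1.2) `*` I x.2.
have bN : box `<=` N.
  move=> [[a b] c] /= [[Ia Ib] Ic]; apply: QN => /= Qz.
  apply: noQ; exists (a, b, c) => //; move: Ia Ib Ic.
  rewrite /I /= !in_itv/= -!ltr_distl => Ia Ib Ic.
  by split; [split|]; rewrite /ball/= distrC.
have mI c : measurable (I c : set R) by exact: measurable_itv.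
have lI c : @lebesgue_measure R (I c) = (e *+ 2)%:E.
  rewrite lebesgue_measure_itv/= lte_fin ltrD2l gtrN//.
  by rewrite -EFinB; congr (_%:E); ring.
have mb : measurable box by apply: measurableX => //; exact: measurableX.
have m01 : (@lebesgue_measure R \x @lebesgue_measure R)%E (I x.1.1 `*` I x.1.2) =
    ((e *+ 2) * (e *+ 2))%:E.
  rewrite product_measure1E; [|exact: mI|exact: mI].
  exact: (congr2 mule (lI _) (lI _)).
have mbox : leb3 box = ((e *+ 2) * (e *+ 2) * (e *+ 2))%:E.
  rewrite product_measure1E; [|apply: measurableX; exact: mI|exact: mI].
  exact: (congr2 mule m01 (lI _)).
have : (leb3 box <= leb3 N)%E by apply: le_measure; rewrite ?inE.
by rewrite mbox N0 lee_fin leNgt !mulr_gt0// mulrn_wgt0.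
Qed.

Lemma Linf_norm_ge0 (A : set 'rV[R]_3) (f : 'rV[R]_3 -> R) : (0 <= Linf_norm A f)%E.
Proof.
have [z _] := ae_cube (0, 0, 0) (ess_sup_ge leb3
  (fun x => if vec3 x \in A then `|f (vec3 x)|%:E else 0%E)) ltr01.
by apply: le_trans; case: ifP.
Qed.

(** If |f y| exceeded M, it would do so on a cube around y inside A, and a cube is not a null
    set. *)
Lemma Linf_norm_le (A : set 'rV[R]_3) (f : 'rV[R]_3 -> R) (M : R) y :
  (Linf_norm A f <= M%:E)%E -> nbhs y A -> f @ y --> f y -> `|f y| <= M.
Proof.
move=> /ess_supP fM Ay fy; rewrite leNgt; apply/negP => Mf.
have /nbhs_ballP[e /= e0 He] : \forall z \near y, A z /\ M < `|f z|.
  apply: filterI => //.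
  have fy' : (fun z => `|f z|) @ y --> `|f y| by exact: cvg_norm fy.
  exact: cvgr_gt fy' _ Mf.
have [[[a b] c] [[/= Ia Ib] Ic]] := ae_cube (y 0 0, y 0 1, y 0 2%R) fM e0.
have [Av Mv] : A (vec3 (a, b, c)) /\ M < `|f (vec3 (a, b, c))|.
  apply: He; split=> // i j; rewrite !mxE/= ord1.
  case: j => -[|[|[|//]]] j3 /=.
  - by move: Ia; congr (ball (y 0 _) e a); apply: val_inj.
  - by move: Ib; congr (ball (y 0 _) e b); apply: val_inj.
  - by move: Ic; congr (ball (y 0 _) e c); apply: val_inj.
by rewrite mem_set//= lee_fin leNgt Mv.
Qed.

Lemma Sobolev_norm_ge0 k (A : set 'rV[R]_3) (f : 'rV[R]_3 -> R) :
  (0 <= Sobolev_norm k A f)%E.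
Proof.
elim: k f => [|k IH] f /=; first exact: Linf_norm_ge0.
by rewrite adde_ge0 ?Linf_norm_ge0// sume_ge0.
Qed.

Lemma Linf_le_Sobolev k (A : set 'rV[R]_3) (f : 'rV[R]_3 -> R) :
  (Linf_norm A f <= Sobolev_norm k A f)%E.
Proof.
case: k => [|k] //=; rewrite leeDl// sume_ge0// => i _; exact: Sobolev_norm_ge0.
Qed.

Lemma Sobolev_deriv_le k (A : set 'rV[R]_3) (f : 'rV[R]_3 -> R) (i : 'I_3) :
  (Sobolev_norm k A (fun y => 'D_(evec R i) f y) <= Sobolev_norm k.+1 A f)%E.
Proof.
rewrite /= (bigD1 i)//= addeCA leeDl// adde_ge0 ?Linf_norm_ge0// sume_ge0// => j _.
exact: Sobolev_norm_ge0.
Qed.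

Lemma in_Linf_timeP (T : R) (N : R -> \bar R) : in_Linf_time T N ->
  exists M : R, \forall t \ae @lebesgue_measure R, 0 < t < T -> (N t <= M%:E)%E.
Proof.
rewrite /in_Linf_time => H.
have [M HM] : exists M : R, (ess_sup (@lebesgue_measure R)
    (fun t => if t \in `]0%R, T[ then N t else 0%E) <= M%:E)%E.
  move: H; case: (ess_sup _ _) => [r _|//|_]; first by exists r.
  by exists 0; rewrite leNye.
exists M; move/ess_supP: HM; apply: filterS => t + t01.
by rewrite in_itv/= t01.
Qed.

End PointwiseBounds.

(** * One-sided time derivatives *)

Section TimeDerivative.
Variables (R : realType) (T : R).
Implicit Types (g : R -> R) (t : R).

Lemma is_derive_of_quot g t (d : R) :
  (fun h : R => h^-1 * (g (t + h) - g t)) @ 0^' --> d -> is_derive t (1 : R) g d.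
Proof.
move=> gd; have gd' : (fun h : R => h^-1 *: ((g \o shift t) (h *: 1) - g t)) @ 0^' --> d.
  apply: cvg_trans gd; rewrite [X in X @ _](_ : _ =
    (fun h : R => h^-1 * (g (t + h) - g t)))//.
  by apply/funext => h /=; rewrite /GRing.scale /= mulr1 [h + t]addrC.
have dg : derivable g t 1 by apply/cvg_ex; exists d.
by apply: (DeriveDef dg); exact: (cvg_lim _ gd').
Qed.

Lemma tquot_interior g t : 0 < t < T ->
  tquot T g t = (fun h : R => h^-1 * (g (t + h) - g t)) @ 0^'.
Proof.
move=> /andP[t0 tT]; apply/funext => V; apply/propext.
have hT : \forall h \near (0 : R)^', 0 <= t + h <= T.
  exists (Num.min t (T - t)) => /=; first by rewrite lt_min t0 subr_gt0.
  move=> h /=; rewrite /ball/= sub0r normrN lt_min !ltr_norml => /andP[/andP[? ?] /andP[? ?]] _.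
  by apply/andP; split; lra.
split=> HV.
  have {}HV : \forall h \near (0 : R)^', 0 <= t + h <= T -> V (h^-1 * (g (t + h) - g t)) := HV.
  by apply: filterS2 hT HV => h ? /(_ _); exact.
have {}HV : \forall h \near (0 : R)^', V (h^-1 * (g (t + h) - g t)) := HV.
by apply: filterS HV => h Vh _.
Qed.

Lemma tderiv_is_derive g t : 0 < t < T -> tderivable T g t ->
  is_derive t (1 : R) g (tderiv T g t).
Proof.
move=> t01 gt; apply: is_derive_of_quot.
have : tquot T g t --> tderiv T g t := gt.
by rewrite tquot_interior.
Qed.

Lemma is_derive_tderiv g t (d : R) : 0 < t < T -> is_derive t (1 : R) g d ->
  tderiv T g t = d.
Proof.
move=> t01 /is_derive_quot gd; rewrite /tderiv tquot_interior//.
exact: (cvg_lim _ gd).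
Qed.

(** Close to t the difference quotient differs from its limit l by less than 1, whence |g s - g t|
    <= (|l| + 1) |s - t|. This covers the end points 0 and T. *)
Lemma tderivable_within_cvg g t : tderivable T g t ->
  g @ within [set` `[0, T]] (nbhs t) --> g t.
Proof.
move=> gt; set l := tderiv T g t.
have gl : tquot T g t --> l := gt.
have : \forall h \near (0 : R)^', 0 <= t + h <= T ->
    `|l - h^-1 * (g (t + h) - g t)| < 1.
  by move/cvgrPdist_lt : gl => /(_ _ ltr01).
move=> [d /= d0 Hd].
apply/cvgrPdist_lt => e e0.
have l1 : 0 < `|l| + 1 by rewrite ltr_wpDl.
exists (Num.min d (e / (`|l| + 1))) => /=; first by rewrite lt_min d0 divr_gt0.
move=> s; rewrite /ball/= lt_min => /andP[sd se]; rewrite /= in_itv/= => sT.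
have [->|st] := eqVneq s t; first by rewrite subrr normr0.
have h0 : s - t != 0 by rewrite subr_eq0.
have := Hd (s - t); rewrite /ball/= sub0r normrN distrC => /(_ sd h0).
rewrite addrC subrK => /(_ sT) q1.
have E : g s - g t = (s - t) * ((s - t)^-1 * (g s - g t)) by rewrite mulrA divff// mul1r.
rewrite distrC E normrM distrC.
apply: (@le_lt_trans _ _ (`|t - s| * (`|l| + 1))); last by rewrite -ltr_pdivlMr.
rewrite ler_wpM2l//; rewrite -lerBlDl; apply: le_trans (ltW q1).
by rewrite [leRHS]distrC; exact: lerB_dist.
Qed.

Lemma tderivable_within_continuous g : (forall t, 0 <= t <= T -> tderivable T g t) ->
  {within `[0, T], continuous g}.
Proof.
move=> gT; apply/subspace_continuousP => t; rewrite /= in_itv/= => tT.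
exact/tderivable_within_cvg/gT.
Qed.

End TimeDerivative.

(** * From essential bounds to pointwise bounds in the moving ball *)

Section Tubes.
Variables (R : realType) (T : R) (rb : R -> R).
Hypothesis T0 : 0 < T.
Hypothesis rbC : {within `[0, T], continuous rb}.

Lemma continuous_enorm : continuous (@enorm R).
Proof.
have cd : continuous (fun y : 'rV[R]_3 => dotv y y).
  rewrite (_ : (fun y => dotv y y) = fun y : 'rV[R]_3 =>
    y 0 0 * y 0 0 + y 0 1 * y 0 1 + y 0 2%R * y 0 2%R); last first.
    by apply/funext => z; rewrite /dotv sum3E.
  move=> y; have cM (i : 'I_3) :
      (fun z : 'rV[R]_3 => z 0 i * z 0 i) @ y --> y 0 i * y 0 i.
    have ci : (fun z : 'rV[R]_3 => z 0 i) @ y --> y 0 i by exact: coord_continuous.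
    exact: (cvgM ci ci).
  exact: (cvgD (cvgD (cM _) (cM _)) (cM _)).
by move=> y; apply: (@continuous_comp _ _ _ (fun y => dotv y y) Num.sqrt);
  [exact: cd|exact: sqrt_continuous].
Qed.

Lemma eball_nbhs (r : R) (y : 'rV[R]_3) : eball r y -> nbhs y (eball r).
Proof.
move=> yr; have := @continuous_enorm y.
by move=> /(@cvgr_lt _ _ _ _ _ _)/(_ _ yr).
Qed.

Lemma cont_on_slice (D : set ('rV[R]_3 * R)) f y t : cont_on D f -> D (y, t) ->
  (\forall z \near y, D (z, t)) -> (f^~ t) @ y --> f y t.
Proof.
move=> /subspace_continuousP fc Dy nD V Vf.
have := fc _ Dy _ Vf; rewrite /= => -[[W1 W2] /= [W1y W2t] HW].
apply: filterS2 W1y nD => z Wz Dz; apply: (HW (z, t)) => //=.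
by split=> //; exact: nbhs_singleton W2t.
Qed.

Lemma cont_on_slice_t (D : set ('rV[R]_3 * R)) f y t : cont_on D f -> D (y, t) ->
  f y @ within [set s | D (y, s)] (nbhs t) --> f y t.
Proof.
move=> /subspace_continuousP fc Dy V Vf.
have := fc _ Dy _ Vf; rewrite /= => -[[W1 W2] /= [W1y W2t] HW].
apply: filterS W2t => s Ws Ds; apply: (HW (y, s)) => //=.
by split=> //; exact: nbhs_singleton W1y.
Qed.

(** An excess over M at (y0, t0) persists at y0 for neighbouring times, during which y0 stays in the
    ball because [rb] is continuous. Those times contain one at which the essential bound is valid,
    and continuity in space makes it pointwise. *)
Lemma in_Linf_time_bound (f : 'rV[R]_3 -> R -> R) (N : R -> \bar R) :
  cont_on (tube T (fun t => eball (rb t))) f ->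
  (forall t, (Linf_norm (eball (rb t)) (f^~ t) <= N t)%E) -> in_Linf_time T N ->
  exists M, forall y t, 0 <= t <= T -> eball (rb t) y -> `|f y t| <= M.
Proof.
move=> fc fN /in_Linf_timeP[M HM]; exists M => y0 t0 t0T y0b.
rewrite leNgt; apply/negP => Mf.
have D0 : tube T (fun t => eball (rb t)) (y0, t0) by [].
have fcv : (fun t => `|f y0 t|) @ within [set s | tube T (fun t => eball (rb t)) (y0, s)] (nbhs t0) --> `|f y0 t0|.
  exact: (cvg_norm (cont_on_slice_t fc D0)).
have {fcv} n1 : \forall t \near t0, tube T (fun t => eball (rb t)) (y0, t) -> M < `|f y0 t|.
  exact: (cvgr_gt _ fcv _ Mf).
have t0in : [set` `[0, T]] t0 by rewrite /= in_itv.
have n2 : \forall t \near t0, [set` `[0, T]] t -> enorm y0 < rb t.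
  by move/subspace_continuousP : rbC => /(_ _ t0in)/(@cvgr_gt _ _ _ _ _ _)/(_ _ y0b).
have : \forall t \near t0,
    (tube T (fun t => eball (rb t)) (y0, t) -> M < `|f y0 t|) /\
    ([set` `[0, T]] t -> enorm y0 < rb t).
  exact: filterI.
move=> /nbhs_ballP[e /= e0 He].
pose a := Num.max 0 (t0 - e); pose b := Num.min T (t0 + e).
have ab : a < b.
  rewrite lt_min !gt_max T0 -andbA; case/andP: t0T => ? ?.
  by apply/and4P; split; lra.
have [t /andP[at_ tb] Ht] := ae_itv HM ab.
move: at_ tb; rewrite gt_max lt_min => /andP[t_gt0 te1] /andP[t_ltT te2].
have tT : 0 <= t <= T by rewrite !ltW.
have [] := He t; first by rewrite /ball/= ltr_norml; apply/andP; split; lra.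
move=> f1 /=; rewrite in_itv/= => /(_ tT) yb.
have Mft := f1 (conj tT yb).
have tt : 0 < t < T by rewrite t_gt0.
have := Linf_norm_le (le_trans (fN t) (Ht tt)) (eball_nbhs yb).
move=> H; move: Mft; rewrite ltNge H//.
apply: (cont_on_slice fc) => //=.
by near=> z; split=> //=; near: z; exact: eball_nbhs.
Unshelve. all: by end_near. Qed.

End Tubes.

(** * Radial vector fields *)

Section Lines.
Variable R : realType.
Implicit Types (f : 'rV[R]_3 -> R) (y v : 'rV[R]_3) (h r d : R).

Lemma is_derive_line f y v r d :
  is_derive (y + r *: v) v f d <-> is_derive r (1 : R) (fun h => f (y + h *: v)) d.
Proof.
have E : (fun h => h^-1 *: ((f \o shift (y + r *: v)) (h *: v) - f (y + r *: v))) =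
  (fun h => h^-1 *: (((fun h => f (y + h *: v)) \o shift r) (h *: (1 : R)) - f (y + r *: v))).
  apply/funext => h /=; congr (_ *: (f _ - _)).
  have -> : h *: (1 : R) = h by exact: mulr1.
  by rewrite scalerDl addrCA.
split=> -[fd <-]; (apply: DeriveDef; [rewrite /derivable|rewrite /derive]);
  by [rewrite -E|rewrite E|rewrite /derive -E].
Qed.

Lemma is_derive_line0 f y v d :
  is_derive y v f d <-> is_derive (0 : R) (1 : R) (fun h => f (y + h *: v)) d.
Proof. by rewrite -is_derive_line scale0r addr0. Qed.

(** Continuity of c at 0 suffices, since the factor h vanishes there. This allows shear stresses to
    be differentiated across the ray without differentiating their coefficients. *)
Lemma is_derive_mul_id (c : R -> R) : c @ (0 : R) --> c 0 ->
  is_derive (0 : R) (1 : R) (fun h => h * c h) (c 0).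
Proof.
move=> cc; apply: is_derive_of_quot; rewrite mul0r.
have : c @ (0 : R)^' --> c 0 by exact: cvg_within_filter cc.
apply: cvg_trans; apply: near_eq_cvg; rewrite near_withinE; near=> h => h0.
by rewrite subr0 add0r mulKf.
Unshelve. all: by end_near. Qed.

Definition ray r : 'rV[R]_3 := r *: evec R 0.

Lemma rayE r (i : 'I_3) : ray r 0 i = r *+ (i == 0).
Proof. by rewrite !mxE/= mulr_natr. Qed.

Lemma enorm_ray r : 0 <= r -> enorm (ray r) = r.
Proof.
move=> r0; rewrite /enorm /dotv sum3E !rayE/= mulr1n !mulr0n !mulr0 !addr0 -expr2.
by rewrite sqrtr_sqr ger0_norm.
Qed.

Lemma radial_ray r : 0 < r -> radial (ray r) = evec R 0.
Proof. by move=> r0; rewrite /radial enorm_ray ?ltW// /ray scalerA mulVf ?gt_eqF// scale1r. Qed.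

Lemma dotvC y v : dotv y v = dotv v y.
Proof. by rewrite /dotv; apply: eq_bigr => i _; rewrite mulrC. Qed.

Lemma dotv_evec y (j : 'I_3) : dotv y (evec R j) = y 0 j.
Proof.
rewrite /dotv (bigD1 j)//= mxE !eqxx mulr1 big1 ?addr0// => i /negPf ij.
by rewrite mxE ij andbF mulr0.
Qed.

Lemma dotv_line y v h :
  dotv (y + h *: v) (y + h *: v) = dotv y y + 2 * h * dotv y v + h ^+ 2 * dotv v v.
Proof.
rewrite /dotv !mulr_sumr -!big_split/=; apply: eq_bigr => i _; rewrite !mxE; ring.
Qed.

Lemma is_derive_ray f r d : is_derive (ray r) (evec R 0) f d <->
  is_derive r (1 : R) (fun h => f (ray h)) d.
Proof.
rewrite -[ray r]add0r is_derive_line; split; apply: near_eq_is_derive; near=> h; by rewrite add0r.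
Unshelve. all: by end_near. Qed.

Lemma continuous_ray : continuous ray.
Proof. by move=> r; apply: cvgZr_tmp; exact: cvg_id. Qed.

Lemma enorm_gt0_neq0 y : 0 < enorm y -> y != 0.
Proof.
apply: contraTneq => ->; rewrite /enorm /dotv sum3E !mxE !mulr0 !addr0 sqrtr0.
by rewrite ltxx.
Qed.

Lemma is_derive_enorm y (j : 'I_3) : 0 < enorm y ->
  is_derive y (evec R j) (@enorm R) (y 0 j / enorm y).
Proof.
move=> y0; apply/is_derive_line0.
have dp : 0 < dotv y y by move: y0; rewrite sqrtr_gt0.
have E h : dotv (y + h *: evec R j) (y + h *: evec R j) = dotv y y + 2 * y 0 j * h + h ^+ 2.
  rewrite dotv_line dotv_evec [dotv (evec R j) _]dotv_evec mxE !eqxx/=; ring.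
have d1 : is_derive (0 : R) (1 : R) (fun h => dotv y y + 2 * y 0 j * h + h ^+ 2) (2 * y 0 j).
  by apply: is_derive_eq; rewrite /GRing.scale/=; ring.
have d2 : is_derive (dotv y y + 2 * y 0 j * 0 + 0 ^+ 2) (1 : R) Num.sqrt (2 * Num.sqrt (dotv y y))^-1.
  rewrite mulr0 expr0n/= !addr0; exact: is_derive1_sqrt.
have d3 := @is_derive1_comp _ Num.sqrt (fun h => dotv y y + 2 * y 0 j * h + h ^+ 2) 0 _ _ d2 d1.
rewrite (_ : (fun h => enorm (y + h *: evec R j)) = Num.sqrt \o (fun h => dotv y y + 2 * y 0 j * h + h ^+ 2)); last first.
  by apply/funext => h; rewrite /enorm E.
apply: (is_derive_eq d3); rewrite -/(enorm y); field; exact: lt0r_neq0.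
Qed.

Lemma evec_line_cvg y v : (fun h : R => y + h *: v) @ (0 : R) --> y.
Proof.
have H : (fun h : R => y + h *: v) @ (0 : R) --> y + (0 : R) *: v.
  by apply: cvgD; [exact: cvg_cst|apply: cvgZr_tmp; exact: cvg_id].
by rewrite scale0r addr0 in H.
Qed.

End Lines.

Section RadialField.
Variables (R : realType) (b : R) (v : 'rV[R]_3 -> 'rV[R]_3) (U1 : R -> R).
Let U (r : R) := v (ray r) 0 0.
Hypothesis sym : forall y (i : 'I_3), 0 < enorm y < b ->
  v y 0 i = U (enorm y) / enorm y * y 0 i.
Hypothesis dU : forall r : R, 0 < r < b -> is_derive r (1 : R) U (U1 r).
Implicit Types (y z : 'rV[R]_3) (r h : R).

(** The derivative of U r / r, the scalar factor in v y = (U |y| / |y|) y. *)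
Let W1 r := (U1 r - U r / r) / r.

Lemma shell_nbhs y : 0 < enorm y < b -> \forall z \near y, 0 < enorm z < b.
Proof.
case/andP=> y0 yb; near=> z; apply/andP; split; near: z.
  by move/(@cvgr_gt _ _ _ _ _ _): (@continuous_enorm R y) => /(_ _ y0).
by move/(@cvgr_lt _ _ _ _ _ _): (@continuous_enorm R y) => /(_ _ yb).
Unshelve. all: by end_near. Qed.

Lemma radial_field_derive y (i j : 'I_3) : 0 < enorm y < b ->
  is_derive y (evec R j) (fun z => v z 0 i)
    ((U (enorm y) / enorm y) *+ (i == j) + W1 (enorm y) * (y 0 i * y 0 j / enorm y)).
Proof.
move=> yb; have [y0 _] := andP yb; set q := enorm y in y0 yb *.
have q0 : q != 0 by rewrite lt0r_neq0.
have dn : is_derive (0 : R) (1 : R) (fun h => enorm (y + h *: evec R j)) (y 0 j / q).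
  exact/is_derive_line0/is_derive_enorm.
have dW : is_derive q (1 : R) (fun r => U r / r) (W1 q).
  have du := dU yb.
  have dV := @is_deriveV R id q 1 1 q0 (is_derive_id _ _).
  apply: is_derive_eq; rewrite /W1 /GRing.scale/=; field; exact: q0.
have dWn : is_derive (0 : R) (1 : R) (fun h => U (enorm (y + h *: evec R j)) / enorm (y + h *: evec R j))
    (W1 q * (y 0 j / q)).
  apply: (@is_derive1_comp _ (fun r => U r / r) (fun h => enorm (y + h *: evec R j)) 0 _ _ _ dn).
  by rewrite scale0r addr0.
have dy : is_derive (0 : R) (1 : R) (fun h : R => (y + h *: evec R j) 0 i) (1 *+ (i == j)).
  rewrite (_ : (fun h : R => _) = (fun h : R => y 0 i + h * (1 *+ (i == j)))); last first.
    by apply/funext => h; rewrite !mxE/=.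
  by apply: is_derive_eq; rewrite /GRing.scale/=; ring.
have dp : is_derive y (evec R j) (fun z => U (enorm z) / enorm z * z 0 i)
    ((U q / q) *+ (i == j) + W1 q * (y 0 i * y 0 j / q)).
  apply/is_derive_line0; apply: is_derive_eq; rewrite scale0r addr0 -/q.
  by rewrite /GRing.scale/= mulrnAr mulr1; congr (_ + _); ring.
apply: near_eq_is_derive dp; near=> z; rewrite sym//; near: z; exact: shell_nbhs.
Unshelve. all: by end_near. Qed.

Lemma enorm_ray_itv r : 0 < r < b -> 0 < enorm (ray r) < b.
Proof. by move=> rb; rewrite enorm_ray// ltW//; case/andP: rb. Qed.

(** On the first axis the velocity gradient is diagonal, with entries U', U / r, U / r. *)
Lemma radial_field_derive_ray r (i j : 'I_3) : 0 < r < b ->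
  is_derive (ray r) (evec R j) (fun z => v z 0 i)
    (if i == j then if i == 0 then U1 r else U r / r else 0).
Proof.
move=> rb; have r0 : r != 0 by rewrite lt0r_neq0//; case/andP: rb.
apply: (is_derive_eq (radial_field_derive i j (enorm_ray_itv rb))).
rewrite enorm_ray ?ltW//; last by case/andP: rb.
rewrite !rayE /W1; case: (eqVneq i j) => [<-|ij] /=.
  rewrite mulr1n; case: (eqVneq i 0) => _; rewrite ?mulr1n ?mulr0n; last by rewrite !mul0r mulr0 addr0.
  by field.
rewrite mulr0n add0r; case: (eqVneq i 0) ij => [->|_ _]; last by rewrite mulr0n !mul0r mulr0.
by rewrite eq_sym => /negPf ->; rewrite mulr0n mulr0 mul0r mulr0.
Qed.

Lemma radial_field_ray0 r (j : 'I_3) : 0 < r < b -> j != 0 -> v (ray r) 0 j = 0.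
Proof.
by move=> rb j0; rewrite sym ?enorm_ray_itv// rayE (negPf j0) mulr0n mulr0.
Qed.

(** The shear entry is 2 W1 y_0 y_j / |y|. On the line through [ray r] in direction j the coordinate
    y_j is the parameter h itself, so [is_derive_mul_id] applies; [m] stands for the viscosity. *)
Lemma strain_derive_ray (m : 'rV[R]_3 -> R) r (j : 'I_3) : 0 < r < b -> j != 0 ->
  U1 @ r --> U1 r -> (fun h => m (ray r + h *: evec R j)) @ (0 : R) --> m (ray r) ->
  is_derive (ray r) (evec R j)
    (fun z => m z * ('D_(evec R 0) (fun y => v y 0 j) z + 'D_(evec R j) (fun y => v y 0 0) z))
    (m (ray r) * (2 * W1 r)).
Proof.
move=> rb j0 U1c mc; have r0 : 0 < r by case/andP: rb.
pose p h := ray r + h *: evec R j.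
pose c h := m (p h) * (2 * (W1 (enorm (p h)) * (r / enorm (p h)))).
have p0 : p 0 = ray r by rewrite /p scale0r addr0.
have np : (fun h => enorm (p h)) @ (0 : R) --> r.
  have := @continuous_enorm R (ray r); rewrite /continuous_at enorm_ray ?ltW// => H.
  by apply: cvg_comp H; exact: evec_line_cvg.
have Uc : U @ r --> U r.
  have := dU rb => -[dd _]; apply: differentiable_continuous.
  exact/derivable1_diffP.
have qc : (fun x => x^-1) @ r --> r^-1 by apply: cvgV; [rewrite lt0r_neq0|exact: cvg_id].
have W1c : W1 @ r --> W1 r.
  exact: (cvgM (cvgB U1c (cvgM Uc qc)) qc).
have cc : c @ (0 : R) --> c 0.
  rewrite /c p0 enorm_ray ?ltW//; apply: cvgM; first exact: mc.
  apply: cvgM; first exact: cvg_cst.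
  apply: cvgM; first exact: (cvg_comp _ _ np W1c).
  by apply: cvgM; [exact: cvg_cst|exact: (cvg_comp _ _ np qc)].
have nph : \forall h \near (0 : R), 0 < enorm (p h) < b.
  exact: (@evec_line_cvg R (ray r) (evec R j) _ (shell_nbhs (enorm_ray_itv rb))).
apply/is_derive_line0.
have -> : m (ray r) * (2 * W1 r) = c 0.
  by rewrite /c p0 enorm_ray ?ltW// divff ?mulr1// lt0r_neq0.
apply: near_eq_is_derive (is_derive_mul_id cc); near=> h.
have ph : 0 < enorm (p h) < b by near: h; exact: nph.
have -> : 'D_(evec R 0) (fun y => v y 0 j) (p h) = W1 (enorm (p h)) * (p h 0 j * p h 0 0 / enorm (p h)).
  have d := radial_field_derive j 0 ph.
  by rewrite (@derive_val _ _ _ _ _ _ _ d) (negPf j0) mulr0n add0r.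
have -> : 'D_(evec R j) (fun y => v y 0 0) (p h) = W1 (enorm (p h)) * (p h 0 j * p h 0 0 / enorm (p h)).
  have d := radial_field_derive 0 j ph.
  by rewrite (@derive_val _ _ _ _ _ _ _ d) eq_sym (negPf j0) mulr0n add0r [p h 0 0 * _]mulrC.
have -> : p h 0 j = h by rewrite !mxE/= (negPf j0) !eqxx/= mulr0 mulr1 add0r.
have -> : p h 0 0 = r.
  by rewrite !mxE/= [0 == j]eq_sym (negPf j0)/= mulr1 mulr0 addr0.
rewrite /c; ring.
Unshelve. all: by end_near. Qed.

End RadialField.

(** * The equations on a ray *)

Lemma is_derive_cvg (R : realType) (f : R -> R) (x d : R) :
  is_derive x (1 : R) f d -> f @ x --> f x.
Proof.
by move=> [fd _]; apply: differentiable_continuous; exact/derivable1_diffP.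
Qed.

Section Smoothness.
Variables (R : realType) (T : R) (D : set ('rV[R]_3 * R)).
Implicit Types (f : 'rV[R]_3 -> R -> R).

Lemma C_space_cont m f : C_space m D f -> cont_on D f.
Proof. by case: m => [|m] []. Qed.

Lemma C_space_is_derive m f y t (i : 'I_3) : C_space m.+1 D f -> D (y, t) ->
  is_derive y (evec R i) (f^~ t) (dx i f y t).
Proof. by move=> [_ /(_ i)[fd _]] /fd fdy; exact: (DeriveDef fdy erefl). Qed.

Lemma C_space_dx m f (i : 'I_3) : C_space m.+1 D f -> C_space m D (dx i f).
Proof. by move=> [_ /(_ i)[]]. Qed.

Lemma C_time_is_derive m f y t : C_time T m.+1 D f -> 0 < t < T -> D (y, t) ->
  is_derive t (1 : R) (f y) (dt T f y t).
Proof. by move=> [_ [fd _]] t01 /fd; exact: tderiv_is_derive. Qed.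

Lemma C_time_dt_cont f : C_time T 1 D f -> cont_on D (dt T f).
Proof. by move=> [_ [_ []]]. Qed.

End Smoothness.

Section FlowOnRay.
Variables (R : realType) (P : fluid R) (T : R).
Variables (rho0 : 'rV[R]_3 -> R) (u0 : 'rV[R]_3 -> 'rV[R]_3) (theta0 : 'rV[R]_3 -> R).
Variables (rb : R -> R) (rho : 'rV[R]_3 -> R -> R) (u : 'rV[R]_3 -> R -> 'rV[R]_3)
  (theta : 'rV[R]_3 -> R -> R).
Hypothesis sol : FBP_solution P T rho0 u0 theta0 rb rho u theta.
Hypothesis reg : regular_flow T rb rho u theta.
Implicit Types (r t : R) (y : 'rV[R]_3).

Definition on_ray (f : 'rV[R]_3 -> R -> R) (r t : R) : R := f (ray r) t.

Local Notation Om := (tube T (fun t => eball (rb t))).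
Local Notation U := (on_ray (vcoord u 0)).
Local Notation Ur := (on_ray (dx 0 (vcoord u 0))).
Local Notation Urr := (on_ray (dx 0 (dx 0 (vcoord u 0)))).
Local Notation Ut := (on_ray (dt T (vcoord u 0))).
Local Notation rhoR := (on_ray rho).
Local Notation rhor := (on_ray (dx 0 rho)).
Local Notation rhot := (on_ray (dt T rho)).
Local Notation theR := (on_ray theta).
Local Notation ther := (on_ray (dx 0 theta)).
Local Notation thet := (on_ray (dt T theta)).

Lemma ray_in_ball t r : 0 <= r < rb t -> eball (rb t) (ray r).
Proof. by move=> /andP[r0 rb1]; rewrite /eball /= enorm_ray. Qed.

Lemma ray_in_tube r t : 0 <= t <= T -> 0 <= r < rb t -> Om (ray r, t).
Proof. by move=> tT rr; split=> //; exact: ray_in_ball. Qed.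

Lemma velocity_sym t y (i : 'I_3) : 0 <= t <= T -> 0 < enorm y < rb t ->
  u y t 0 i = u (ray (enorm y)) t 0 0 / enorm y * y 0 i.
Proof.
move=> tT /andP[y0 yb]; have [f Hf] := fbp_sym_u sol.
rewrite (Hf y t tT (ltW yb) (enorm_gt0_neq0 y0)).
have er : enorm (ray (enorm y)) = enorm y by rewrite enorm_ray// ltW.
rewrite (Hf (ray (enorm y)) t tT) ?er ?(ltW yb)//; last first.
  by apply: enorm_gt0_neq0; rewrite er.
rewrite radial_ray// /radial !mxE/= mulr1; ring.
Qed.

Lemma space_derive_ray f m r t : C_space m.+1 Om f -> 0 <= t <= T -> 0 < r < rb t ->
  is_derive r (1 : R) (on_ray f ^~ t) (on_ray (dx 0 f) r t).
Proof.
move=> Cf tT /andP[/ltW r0 rrb].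
apply: (proj1 (is_derive_ray (f^~ t) r _)).
by apply: (C_space_is_derive _ Cf); apply: ray_in_tube => //; rewrite r0.
Qed.

Lemma time_derive_ray f m r t : C_time T m.+1 Om f -> 0 < t < T -> 0 < r < rb t ->
  is_derive t (1 : R) (on_ray f r) (on_ray (dt T f) r t).
Proof.
move=> Cf tT /andP[/ltW r0 rrb]; apply: (C_time_is_derive Cf) => //.
by apply: ray_in_tube; [case/andP: tT => /ltW -> /ltW ->|rewrite r0].
Qed.

Section AtPoint.
Variables (r t : R).
Hypotheses (tT : 0 <= t <= T) (rr : 0 < r < rb t).

Let r0 : 0 < r. Proof. by case/andP: rr. Qed.
Let rneq0 : r != 0. Proof. exact: lt0r_neq0. Qed.

Let sym y (i : 'I_3) : 0 < enorm y < rb t ->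
  u y t 0 i = u (ray (enorm y)) t 0 0 / enorm y * y 0 i.
Proof. exact: velocity_sym. Qed.

Let CU := (reg_u reg 0).1.

Let dU (q : R) : 0 < q < rb t -> is_derive q (1 : R) (fun q => u (ray q) t 0 0) (Ur q t).
Proof. by move=> qb; exact: (space_derive_ray CU). Qed.

Lemma vcoord_derive_ray (i j : 'I_3) :
  is_derive (ray r) (evec R j) (fun z => vcoord u i z t)
    (if i == j then if i == 0 then Ur r t else U r t / r else 0).
Proof. exact: (radial_field_derive_ray sym dU). Qed.

Lemma dx_vcoord_ray (i j : 'I_3) : dx j (vcoord u i) (ray r) t =
  if i == j then if i == 0 then Ur r t else U r t / r else 0.
Proof. exact: (@derive_val _ _ _ _ _ _ _ (vcoord_derive_ray i j)). Qed.

Lemma vcoord_ray (j : 'I_3) : vcoord u j (ray r) t = if j == 0 then U r t else 0.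
Proof.
by case: eqP => [->//|/eqP j0]; rewrite /vcoord (radial_field_ray0 sym).
Qed.

Lemma divu_ray : divu u (ray r) t = Ur r t + 2 * (U r t / r).
Proof. by rewrite /divu sum3E !dx_vcoord_ray/=; ring. Qed.

Let in_tube : Om (ray r, t).
Proof. by apply: ray_in_tube => //; rewrite ltW//; case/andP: rr. Qed.

Let drho (j : 'I_3) : is_derive (ray r) (evec R j) (rho^~ t) (dx j rho (ray r) t).
Proof. exact: (C_space_is_derive _ (reg_rho reg).1). Qed.

Let dthe (j : 'I_3) : is_derive (ray r) (evec R j) (theta^~ t) (dx j theta (ray r) t).
Proof. exact: (C_space_is_derive _ (reg_theta reg).1). Qed.

Lemma mass_flux_ray (j : 'I_3) : dx j (fun z q => rho z q * vcoord u j z q) (ray r) t =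
  if j == 0 then rhor r t * U r t + rhoR r t * Ur r t else rhoR r t * (U r t / r).
Proof.
have d1 := drho j; have d2 := vcoord_derive_ray j j.
have d : is_derive (ray r) (evec R j) (fun z => rho z t * vcoord u j z t) _ := is_deriveM d1 d2.
apply: etrans (@derive_val _ _ _ _ _ _ _ d) _; rewrite eqxx vcoord_ray /on_ray /GRing.scale/=.
by case: eqP => [->|_]; [ring|rewrite mul0r addr0].
Qed.

Lemma momentum_flux_ray (j : 'I_3) :
  dx j (fun z q => rho z q * vcoord u 0 z q * vcoord u j z q) (ray r) t =
  if j == 0 then rhor r t * U r t ^+ 2 + 2 * (rhoR r t * U r t * Ur r t)
  else rhoR r t * U r t * (U r t / r).
Proof.
have d1 := drho j; have d2 := vcoord_derive_ray j j; have d3 := vcoord_derive_ray 0 j.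
have d : is_derive (ray r) (evec R j) (fun z => rho z t * vcoord u 0 z t * vcoord u j z t) _ :=
  is_deriveM (is_deriveM d1 d3) d2.
apply: etrans (@derive_val _ _ _ _ _ _ _ d) _; rewrite !eqxx !vcoord_ray /on_ray /GRing.scale/=.
by rewrite mulrfctE [0 == j]eq_sym; case: (eqVneq j 0) => [->|_];
  rewrite ?vcoord_ray/= /on_ray; ring.
Qed.

Lemma energy_flux_ray (j : 'I_3) :
  dx j (fun z q => rho z q * vcoord u j z q * theta z q) (ray r) t =
  if j == 0 then (rhor r t * U r t + rhoR r t * Ur r t) * theR r t + rhoR r t * U r t * ther r t
  else rhoR r t * (U r t / r) * theR r t.
Proof.
have d1 := drho j; have d2 := vcoord_derive_ray j j; have d3 := dthe j.
have d : is_derive (ray r) (evec R j) (fun z => rho z t * vcoord u j z t * theta z t) _ :=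
  is_deriveM (is_deriveM d1 d2) d3.
apply: etrans (@derive_val _ _ _ _ _ _ _ d) _; rewrite !eqxx !vcoord_ray /on_ray /GRing.scale/=.
by rewrite mulrfctE vcoord_ray /on_ray; case: (eqVneq j 0) => [->|_]; ring.
Qed.

Lemma powR_theta_derive : is_derive r (1 : R) (fun q => theR q t `^ alpha P)
  (alpha P * theR r t `^ (alpha P - 1) * ther r t).
Proof.
have th0 : 0 < theR r t by exact: (fbp_pos sol tT in_tube.2).2.
have d1 : is_derive r (1 : R) (theR^~ t) (ther r t) := space_derive_ray (reg_theta reg).1 tT rr.
exact: (@is_derive1_comp _ (fun x => x `^ alpha P) (theR^~ t) r _ _ (is_derive1_powR _ th0) d1).
Qed.

Lemma shell_near_r : \forall q \near r, 0 < q < rb t.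
Proof.
case/andP: rr => ? ?; near=> q; apply/andP; split; near: q; [exact: lt_nbhsr|exact: lt_nbhsl].
Unshelve. all: by end_near. Qed.

Lemma pressure_derive_ray : dx 0 (pressure P rho theta) (ray r) t =
  Rg P * (rhor r t * theR r t + rhoR r t * ther r t).
Proof.
have d1 := drho 0; have d2 := dthe 0.
have d : is_derive (ray r) (evec R 0) (fun z => Rg P * rho z t * theta z t)
    (Rg P * (rhor r t * theR r t + rhoR r t * ther r t)).
  by apply: is_derive_eq; rewrite /on_ray /GRing.scale/=; ring.
exact: (@derive_val _ _ _ _ _ _ _ d).
Qed.

End AtPoint.

Section AtInteriorTime.
Variables (r t : R).
Hypotheses (tT : 0 < t < T) (rr : 0 < r < rb t).

Let tT' : 0 <= t <= T. Proof. by case/andP: tT => /ltW -> /ltW ->. Qed.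
Let r0 : 0 < r. Proof. by case/andP: rr. Qed.
Let yb : eball (rb t) (ray r). Proof. by apply: ray_in_ball; rewrite ltW//; case/andP: rr. Qed.

Let drhot : is_derive t (1 : R) (rho (ray r)) (rhot r t) :=
  time_derive_ray (reg_rho reg).2 tT rr.
Let dUt : is_derive t (1 : R) (vcoord u 0 (ray r)) (Ut r t) :=
  time_derive_ray (reg_u reg 0).2 tT rr.
Let dthet : is_derive t (1 : R) (theta (ray r)) (thet r t) :=
  time_derive_ray (reg_theta reg).2 tT rr.

Lemma mass_ray :
  rhot r t + rhor r t * U r t + rhoR r t * (Ur r t + 2 * (U r t / r)) = 0.
Proof.
have := fbp_mass sol tT' yb; rewrite /mass_eq sum3E !(mass_flux_ray tT' rr)/= => <-.
by rewrite /on_ray; ring.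
Qed.

Lemma visc00_derive_ray : dx 0 (visc_stress P u theta 0 0) (ray r) t =
  (2 * mubar P + lambar P) * (theR r t `^ alpha P) * Urr r t
  + lambar P * (theR r t `^ alpha P) * (2 * (Ur r t / r) - 2 * (U r t / r ^+ 2))
  + alpha P * theR r t `^ (alpha P - 1) * ther r t *
    ((2 * mubar P + lambar P) * Ur r t + 2 * lambar P * (U r t / r)).
Proof.
have dT := powR_theta_derive tT' rr.
have dU : is_derive r (1 : R) (U^~ t) (Ur r t) := space_derive_ray (reg_u reg 0).1 tT' rr.
have dUr : is_derive r (1 : R) (Ur^~ t) (Urr r t) :=
  space_derive_ray (C_space_dx 0 (reg_u reg 0).1) tT' rr.
have rneq0 : r != 0 by exact: lt0r_neq0.
have dV := @is_deriveV R id r 1 1 rneq0 (is_derive_id _ _).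
apply: (@derive_val _ _ _ _ _ _ _ _); apply/is_derive_ray.
apply: (@near_eq_is_derive _ _ _ (fun q => mubar P * (theR q t `^ alpha P) * (Ur q t + Ur q t)
   + lambar P * (theR q t `^ alpha P) * (Ur q t + 2 * (U q t / q)))).
  near=> q; have qb : 0 < q < rb t by near: q; exact: shell_near_r.
  by rewrite /visc_stress mulr1n /strain2 (divu_ray tT' qb) !(dx_vcoord_ray tT' qb).
apply: is_derive_eq; rewrite /GRing.scale/= -/(GRing.exp _ _); field.
exact: rneq0.
Unshelve. all: by end_near. Qed.

Lemma visc0j_derive_ray (j : 'I_3) : j != 0 -> dx j (visc_stress P u theta 0 j) (ray r) t =
  2 * mubar P * (theR r t `^ alpha P) * (Ur r t / r - U r t / r ^+ 2).
Proof.
move=> j0; have CU := (reg_u reg 0).1.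
have rneq0 : r != 0 by exact: lt0r_neq0.
have dU (q : R) : 0 < q < rb t -> is_derive q (1 : R) (fun q => u (ray q) t 0 0) (Ur q t).
  by move=> qb; exact: (space_derive_ray CU).
have Uc : (Ur^~ t) @ r --> Ur r t.
  exact: (is_derive_cvg (space_derive_ray (C_space_dx 0 CU) tT' rr)).
have th0 : 0 < theta (ray r) t by exact: (fbp_pos sol tT' yb).2.
have mc : (fun h => mubar P * theta (ray r + h *: evec R j) t `^ alpha P) @ (0 : R) -->
    mubar P * theta (ray r) t `^ alpha P.
  have dl := (is_derive_line0 _ _ _ _).1 (C_space_is_derive j (reg_theta reg).1 (conj tT' yb)).
  have tc : (fun h => theta (ray r + h *: evec R j) t) @ (0 : R) --> theta (ray r) t.
    by have := is_derive_cvg dl; rewrite scale0r addr0.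
  apply: cvgM; first exact: cvg_cst.
  exact: (cvg_comp _ _ tc (is_derive_cvg (is_derive1_powR (alpha P) th0))).
have d := strain_derive_ray (m:=fun z => mubar P * theta z t `^ alpha P)
  (fun y i => @velocity_sym t y i tT') dU rr j0 Uc mc.
apply: etrans (@derive_val _ _ _ _ _ _ _ (near_eq_is_derive _ d)) _.
  by near=> z; rewrite /visc_stress eq_sym (negPf j0) mulr0n addr0.
rewrite /on_ray -[u (ray r) t 0 0]/(vcoord u 0 (ray r) t); field.
exact: rneq0.
Unshelve. all: by end_near. Qed.

(** The mass equation turns the inertial terms into rho (Ut + U Ur). The two transverse shear
    stresses contribute 4 mubar (Ur / r - U / r^2), which completes the lambda part to the
    coefficient 2 mubar + lambar. *)
Lemma momentum_ray :
  rhoR r t * (Ut r t + U r t * Ur r t) + Rg P * (rhor r t * theR r t + rhoR r t * ther r t) =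
  (2 * mubar P + lambar P) * (theR r t `^ alpha P) *
    (Urr r t + 2 * (Ur r t / r) - 2 * (U r t / r ^+ 2))
  + alpha P * theR r t `^ (alpha P - 1) * ther r t *
    ((2 * mubar P + lambar P) * Ur r t + 2 * lambar P * (U r t / r)).
Proof.
have := fbp_momentum sol tT' yb 0.
rewrite !sum3E !(momentum_flux_ray tT' rr)/= (pressure_derive_ray tT' rr).
rewrite visc00_derive_ray !visc0j_derive_ray//.
have d : is_derive t (1 : R) (fun q => rho (ray r) q * vcoord u 0 (ray r) q)
    (rhot r t * U r t + rhoR r t * Ut r t).
  by apply: (is_derive_eq (is_deriveM drhot dUt)); rewrite /on_ray /GRing.scale/=; ring.
rewrite [dt _ _ _ _](is_derive_tderiv tT d) => E.
have M : rhot r t = - rhor r t * U r t - rhoR r t * (Ur r t + 2 * (U r t / r)).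
  by have := mass_ray; lra.
move: E; rewrite M; lra.
Qed.

Lemma energy_ray : kapbar P = 0 ->
  c_v P * rhoR r t * (thet r t + U r t * ther r t)
  + Rg P * rhoR r t * theR r t * (Ur r t + 2 * (U r t / r))
  = theR r t `^ alpha P * (2 * mubar P * (Ur r t ^+ 2 + 2 * (U r t / r) ^+ 2)
     + lambar P * (Ur r t + 2 * (U r t / r)) ^+ 2).
Proof.
move=> k0; have := fbp_energy sol tT' yb; rewrite /energy_eq.
rewrite !sum3E !(energy_flux_ray tT' rr)/= (divu_ray tT' rr) /strain2 !(dx_vcoord_ray tT' rr)/=.
have d : is_derive t (1 : R) (fun q => rho (ray r) q * theta (ray r) q)
    (rhot r t * theR r t + rhoR r t * thet r t).
  by apply: (is_derive_eq (is_deriveM drhot dthet)); rewrite /on_ray /GRing.scale/=; ring.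
rewrite [dt _ _ _ _](is_derive_tderiv tT d) /kappa k0 !mul0r addr0 => E.
have M : rhot r t = - rhor r t * U r t - rhoR r t * (Ur r t + 2 * (U r t / r)).
  by have := mass_ray; lra.
move: E; rewrite M /pressure /mu /lam -/(theR r t) -/(rhoR r t) => E.
lra.
Qed.

End AtInteriorTime.
End FlowOnRay.

(** * Entropy and the boundary velocity *)

Lemma is_derive_comp_line (R : realType) (f : 'rV[R]_3 -> R) (g : R -> R)
    (y v : 'rV[R]_3) (a b : R) :
  is_derive y v f a -> is_derive (f y) (1 : R) g b -> is_derive y v (fun z => g (f z)) (b * a).
Proof.
move=> /is_derive_line0 fd gd; apply/is_derive_line0.
apply: (@is_derive1_comp _ g (fun h => f (y + h *: v)) 0 _ _ _ fd).
by rewrite scale0r addr0.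
Qed.

Lemma within_eq (X Y : topologicalType) (A : set X) (f g : X -> Y) :
  (forall x, A x -> f x = g x) -> {within A, continuous f} -> {within A, continuous g}.
Proof.
move=> fg; apply: subspace_eq_continuous => x; rewrite inE => Ax; exact: fg.
Qed.

Lemma within_ln (R : realType) (X : topologicalType) (A : set X) (f : X -> R) :
  (forall x, A x -> 0 < f x) -> {within A, continuous f} ->
  {within A, continuous (fun x => ln (f x))}.
Proof.
move=> f0 /subspace_continuousP fc; apply/subspace_continuousP => x Ax.
exact: (cvg_comp _ _ (fc _ Ax) (continuous_ln (f0 _ Ax))).
Qed.

Lemma within_powR (R : realType) (X : topologicalType) (A : set X) (f : X -> R) (a : R) :
  (forall x, A x -> 0 < f x) -> {within A, continuous f} ->
  {within A, continuous (fun x => f x `^ a)}.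
Proof.
move=> f0 /subspace_continuousP fc; apply/subspace_continuousP => x Ax.
exact: (cvg_comp _ _ (fc _ Ax) (is_derive_cvg (is_derive1_powR a (f0 _ Ax)))).
Qed.

(** The form splits into a shear part in a - b, with coefficient 4 m / 3, and a bulk part in a + 2
    b, with coefficient (2 m + 3 l) / 3. The two squares together control a^2 + b^2. *)
Lemma dissipation_coercive (R : realFieldType) (m l : R) : 0 < m -> 0 < 2 * m + 3 * l ->
  exists2 c, 0 < c & forall a b : R,
    c * (a ^+ 2 + b ^+ 2) <= 2 * m * (a ^+ 2 + 2 * b ^+ 2) + l * (a + 2 * b) ^+ 2.
Proof.
move=> m0 ml0; set c1 := 4 * m / 3; set c2 := (2 * m + 3 * l) / 3.
have c10 : 0 < c1 by rewrite divr_gt0 ?mulr_gt0.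
have c20 : 0 < c2 by rewrite divr_gt0.
exists (Num.min c1 c2) => [|a b]; first by rewrite lt_min c10.
have -> : 2 * m * (a ^+ 2 + 2 * b ^+ 2) + l * (a + 2 * b) ^+ 2 =
  c1 * (a - b) ^+ 2 + c2 * (a + 2 * b) ^+ 2 by rewrite /c1 /c2; field.
have H1 : Num.min c1 c2 * (a - b) ^+ 2 <= c1 * (a - b) ^+ 2.
  by rewrite ler_wpM2r ?sqr_ge0// ge_min lexx.
have H2 : Num.min c1 c2 * (a + 2 * b) ^+ 2 <= c2 * (a + 2 * b) ^+ 2.
  by rewrite ler_wpM2r ?sqr_ge0// ge_min lexx orbT.
have H3 : Num.min c1 c2 * (a ^+ 2 + b ^+ 2) <= Num.min c1 c2 * ((a - b) ^+ 2 + (a + 2 * b) ^+ 2).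
  rewrite ler_wpM2l//; first by rewrite le_min !ltW.
  by have := sqr_ge0 (a + b); have := sqr_ge0 b; nra.
by apply: (le_trans H3); rewrite mulrDr; exact: lerD.
Qed.

Lemma within_left_lt (R : realType) (g : R -> R) (b a : R) : 0 < b ->
  {within `[0, b], continuous g} -> g b < a ->
  exists2 d, 0 < d & forall r : R, 0 < r < b -> b - d < r -> g r < a.
Proof.
move=> b0 /subspace_continuousP gc gba.
have bin : [set` `[0, b]] b by rewrite /= in_itv/= lexx ltW.
have : \forall r \near b, [set` `[0, b]] r -> g r < a.
  exact: (cvgr_lt _ (gc _ bin) _ gba).
move=> /nbhs_ballP[d /= d0 Hd]; exists d => // r /andP[r0 rb] dr.
apply: Hd; last by rewrite /= in_itv/= !ltW.
by rewrite /ball/= ltr_norml; apply/andP; split; lra.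
Qed.

Section EntropyFlow.
Variables (R : realType) (P : fluid R) (T : R).
Variables (rho0 : 'rV[R]_3 -> R) (u0 : 'rV[R]_3 -> 'rV[R]_3) (theta0 : 'rV[R]_3 -> R).
Variables (rb : R -> R) (rho : 'rV[R]_3 -> R -> R) (u : 'rV[R]_3 -> R -> 'rV[R]_3)
  (theta s : 'rV[R]_3 -> R -> R).
Hypothesis sol : FBP_solution P T rho0 u0 theta0 rb rho u theta.
Hypothesis reg : regular_flow T rb rho u theta.
Hypothesis ent : is_entropy P T rb rho theta s.
Hypothesis rent : regular_entropy T rb s.
Hypothesis adm : admissible P.
Hypothesis T0 : 0 < T.
Implicit Types (r t : R) (y : 'rV[R]_3).

Local Notation Om := (tube T (fun t => eball (rb t))).
Local Notation Omc := (tube T (fun t => [set y | enorm y <= rb t])).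
Local Notation U := (on_ray (vcoord u 0)).
Local Notation Ur := (on_ray (dx 0 (vcoord u 0))).
Local Notation rhoR := (on_ray rho).
Local Notation rhor := (on_ray (dx 0 rho)).
Local Notation rhot := (on_ray (dt T rho)).
Local Notation theR := (on_ray theta).
Local Notation ther := (on_ray (dx 0 theta)).
Local Notation thet := (on_ray (dt T theta)).

Lemma cv_gt0 : 0 < c_v P.
Proof. by rewrite divr_gt0 ?subr_gt0 ?adm_gamma ?adm_Rg. Qed.

Lemma rb_cont : {within `[0, T], continuous rb}.
Proof. by apply: tderivable_within_continuous => t /(fbp_kinematic sol)[]. Qed.

Lemma tube_pos (z : 'rV[R]_3 * R) : Om z -> 0 < rho z.1 z.2 /\ 0 < theta z.1 z.2.
Proof. by case: z => y t [tT yb]; exact: (fbp_pos sol tT yb). Qed.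

Lemma entropyE y t : 0 <= t <= T -> eball (rb t) y ->
  s y t = c_v P * (ln (theta y t) - (gamma P - 1) * ln (rho y t) + (ln (Rg P) - ln (Abar P))).
Proof.
move=> tT yb; have [rp tp] := fbp_pos sol tT yb.
have Rp := adm_Rg adm; have Ap := adm_Abar adm.
have g1 : 0 < gamma P - 1 by rewrite subr_gt0 adm_gamma.
have /(congr1 (@ln R)) := ent tT yb; rewrite /pressure.
rewrite !lnM ?posrE ?mulr_gt0 ?expR_gt0 ?powR_gt0// expRK ln_powR => E.
have -> : ln (theta y t) = ln (Abar P) + s y t * (gamma P - 1) / Rg P
  + gamma P * ln (rho y t) - ln (Rg P) - ln (rho y t) by lra.
by rewrite /c_v; field; rewrite !lt0r_neq0.
Qed.

(** Written through rho and theta, whose derivatives are continuous on the tube, so that the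
    essential bounds on the derivatives of s become pointwise. *)
Definition entropy_dx (i : 'I_3) y t : R :=
  c_v P * (dx i theta y t / theta y t - (gamma P - 1) * (dx i rho y t / rho y t)).
Definition entropy_dt y t : R :=
  c_v P * (dt T theta y t / theta y t - (gamma P - 1) * (dt T rho y t / rho y t)).

Lemma dx_entropy (i : 'I_3) y t : 0 <= t <= T -> eball (rb t) y ->
  dx i s y t = entropy_dx i y t.
Proof.
move=> tT yb; have [rp tp] := fbp_pos sol tT yb.
have d1 := is_derive_comp_line (C_space_is_derive i (reg_theta reg).1 (conj tT yb)) (is_derive1_ln tp).
have d2 := is_derive_comp_line (C_space_is_derive i (reg_rho reg).1 (conj tT yb)) (is_derive1_ln rp).
have d : is_derive y (evec R i) (fun y => c_v P * (ln (theta y t) - (gamma P - 1) * ln (rho y t)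
    + (ln (Rg P) - ln (Abar P)))) (entropy_dx i y t).
  by apply: is_derive_eq; rewrite /entropy_dx /GRing.scale/=; ring.
apply: etrans (@derive_val _ _ _ _ _ _ _ (near_eq_is_derive _ d)) erefl.
near=> z; rewrite entropyE//; near: z; exact: eball_nbhs.
Unshelve. all: by end_near. Qed.

Lemma ball_time_nbhs y t : 0 < t < T -> eball (rb t) y ->
  \forall q \near t, 0 <= q <= T /\ eball (rb q) y.
Proof.
move=> tT yb; have tin : [set` `[0, T]] t by rewrite /= in_itv/=; case/andP: tT => /ltW -> /ltW ->.
have n1 : \forall q \near t, [set` `[0, T]] q -> enorm y < rb q.
  by move/subspace_continuousP : rb_cont => /(_ _ tin)/(@cvgr_gt _ _ _ _ _ _)/(_ _ yb).
have n2 : \forall q \near t, 0 <= q <= T.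
  case/andP: tT => t0 t1; near=> q; apply/andP; split; apply: ltW; near: q;
    [exact: lt_nbhsr|exact: lt_nbhsl].
apply: filterS2 n1 n2 => q H qT; split=> //; apply: H.
by rewrite /= in_itv.
Unshelve. all: by end_near. Qed.

Lemma dt_entropy y t : 0 < t < T -> eball (rb t) y -> dt T s y t = entropy_dt y t.
Proof.
move=> tT yb; have tT' : 0 <= t <= T by case/andP: tT => /ltW -> /ltW ->.
have [rp tp] := fbp_pos sol tT' yb.
have d1 := @is_derive1_comp _ _ (theta y) t _ _ (is_derive1_ln tp)
  (C_time_is_derive (reg_theta reg).2 tT (conj tT' yb)).
have d2 := @is_derive1_comp _ _ (rho y) t _ _ (is_derive1_ln rp)
  (C_time_is_derive (reg_rho reg).2 tT (conj tT' yb)).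
have d : is_derive t (1 : R) (fun t => c_v P * ((@ln R \o theta y) t - (gamma P - 1) * (@ln R \o rho y) t
    + (ln (Rg P) - ln (Abar P)))) (entropy_dt y t).
  by apply: is_derive_eq; rewrite /entropy_dt /GRing.scale/=; ring.
apply: (is_derive_tderiv tT (near_eq_is_derive _ d)).
near=> q; have [qT yq] : 0 <= q <= T /\ eball (rb q) y by near: q; exact: ball_time_nbhs.
by rewrite /= (entropyE qT yq).
Unshelve. all: by end_near. Qed.

Let rho_neq0 (z : 'rV[R]_3 * R) : Om z -> rho z.1 z.2 != 0.
Proof. by move=> /tube_pos[/lt0r_neq0]. Qed.

Let theta_neq0 (z : 'rV[R]_3 * R) : Om z -> theta z.1 z.2 != 0.
Proof. by move=> /tube_pos[_ /lt0r_neq0]. Qed.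

Let rhoC : cont_on Om rho := C_space_cont (reg_rho reg).1.
Let thetaC : cont_on Om theta := C_space_cont (reg_theta reg).1.

Lemma log_gradient_cont (ft fr : 'rV[R]_3 -> R -> R) : cont_on Om ft -> cont_on Om fr ->
  cont_on Om (fun y t => c_v P * (ft y t / theta y t - (gamma P - 1) * (fr y t / rho y t))).
Proof.
move=> ftC frC; apply: withinM; first exact: within_cst.
apply: withinD; first by apply: withinM => //; apply: withinV.
apply: withinN; apply: withinM; first exact: within_cst.
by apply: withinM => //; apply: withinV.
Qed.

Lemma entropy_dt_cont : cont_on Om entropy_dt.
Proof.
by apply: log_gradient_cont; [exact: C_time_dt_cont (reg_theta reg).2|exact: C_time_dt_cont (reg_rho reg).2].
Qed.

Lemma dx_entropy_cont (i : 'I_3) : cont_on Om (dx i s).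
Proof.
apply: within_eq (log_gradient_cont (C_space_cont (C_space_dx i (reg_theta reg).1))
   (C_space_cont (C_space_dx i (reg_rho reg).1))).
by move=> [y t] [/= tT yb]; rewrite dx_entropy.
Qed.

Lemma entropy_cont : cont_on Om s.
Proof.
apply: (@within_eq _ _ _ (fun z => c_v P * (ln (theta z.1 z.2) - (gamma P - 1) * ln (rho z.1 z.2)
   + (ln (Rg P) - ln (Abar P))))).
  by move=> [y t] [/= tT yb]; rewrite (entropyE tT yb).
apply: withinM; first exact: within_cst.
apply: withinD; last exact: within_cst.
apply: withinD; first by apply: within_ln => // z /tube_pos[].
apply: withinN; apply: withinM; first exact: within_cst.
by apply: within_ln => // z /tube_pos[].
Qed.

Lemma entropy_bounded : exists M, forall y t, 0 <= t <= T -> eball (rb t) y -> `|s y t| <= M.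
Proof.
apply: (in_Linf_time_bound T0 rb_cont entropy_cont _ (reg_s_W1 rent)) => t.
exact: Linf_le_Sobolev.
Qed.

Lemma entropy_dx_bounded : exists M, forall y t, 0 <= t <= T -> eball (rb t) y ->
  `|entropy_dx 0 y t| <= M.
Proof.
have [M HM] : exists M, forall y t, 0 <= t <= T -> eball (rb t) y -> `|dx 0 s y t| <= M.
  have H t : (Linf_norm (eball (rb t)) (fun y => dx 0%R s y t) <=
      Sobolev_norm 1 (eball (rb t)) (fun y => s y t))%E.
    exact: (Sobolev_deriv_le 0 (eball (rb t)) (s^~ t) 0).
  exact: (in_Linf_time_bound T0 rb_cont (@dx_entropy_cont 0) H (reg_s_W1 rent)).
by exists M => y t tT yb; rewrite -dx_entropy//; exact: HM.
Qed.

Lemma velocity_bounded : exists M, forall y t, 0 <= t <= T -> eball (rb t) y ->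
  [/\ `|vcoord u 0 y t| <= M, `|dx 0 (vcoord u 0) y t| <= M &
    `|dx 0 (dx 0 (vcoord u 0)) y t| <= M].
Proof.
have CU := (reg_u reg 0).1; have W := reg_u_W2 reg 0.
have [M1 H1] : exists M, forall y t, 0 <= t <= T -> eball (rb t) y -> `|vcoord u 0 y t| <= M.
  by apply: (in_Linf_time_bound T0 rb_cont (C_space_cont CU) _ W) => t; exact: Linf_le_Sobolev.
have CU1 := C_space_dx 0 CU; have CU2 := C_space_dx 0 CU1.
have S1 t := Sobolev_deriv_le 1 (eball (rb t)) (fun y => vcoord u 0 y t) 0.
have [M2 H2] : exists M, forall y t, 0 <= t <= T -> eball (rb t) y -> `|dx 0 (vcoord u 0) y t| <= M.
  apply: (in_Linf_time_bound T0 rb_cont (C_space_cont CU1) _ W) => t.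
  exact: le_trans (Linf_le_Sobolev 1 _ _) (S1 t).
have [M3 H3] : exists M, forall y t, 0 <= t <= T -> eball (rb t) y -> `|dx 0 (dx 0 (vcoord u 0)) y t| <= M.
  apply: (in_Linf_time_bound T0 rb_cont (C_space_cont CU2) _ W) => t.
  exact: le_trans (Sobolev_deriv_le 0 _ _ 0) (S1 t).
exists (Num.max M1 (Num.max M2 M3)) => y t tT yb.
have [h1 h2 h3] := And3 (H1 y t tT yb) (H2 y t tT yb) (H3 y t tT yb).
by split; rewrite !le_max; [rewrite h1 | rewrite h2 orbT | rewrite h3 !orbT].
Qed.

(** Split ln rho with weights 1 - alpha (gamma - 1) and alpha (gamma - 1). The first weight is
    nonnegative, so that share is bounded through ln P0; the entropy bound turns the second into
    alpha ln theta plus a constant. *)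
Lemma rho_le_theta (P0 : R) : alpha P <= 1 / (gamma P - 1) -> 1 <= P0 ->
  exists2 K, 0 < K & forall y t, 0 <= t <= T -> eball (rb t) y -> rho y t <= P0 ->
    rho y t <= K * theta y t `^ alpha P.
Proof.
move=> al P1; have [M HM] := entropy_bounded.
have g1 : 0 < gamma P - 1 by rewrite subr_gt0 adm_gamma.
have a0 := adm_alpha adm.
have a1 : alpha P * (gamma P - 1) <= 1 by rewrite -ler_pdivlMr.
set k := ln (Rg P) - ln (Abar P).
pose kap := (1 - alpha P * (gamma P - 1)) * ln P0 + alpha P * (M / c_v P + k).
exists (expR kap); first exact: expR_gt0.
move=> y t tT yb rP; have [rp tp] := fbp_pos sol tT yb.
rewrite -ler_ln ?posrE ?mulr_gt0 ?expR_gt0 ?powR_gt0// lnM ?posrE ?expR_gt0 ?powR_gt0//.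
rewrite expRK ln_powR.
have lr : ln (rho y t) <= ln P0 by rewrite ler_ln ?posrE// (lt_le_trans ltr01).
have H : - (M / c_v P) <= ln (theta y t) - (gamma P - 1) * ln (rho y t) + k.
  have := HM y t tT yb; rewrite entropyE// -/k ler_norml => /andP[h _].
  by rewrite -mulNr ler_pdivrMr ?cv_gt0// mulrC.
have H1 : alpha P * - (M / c_v P) <= alpha P * (ln (theta y t) - (gamma P - 1) * ln (rho y t) + k).
  by rewrite ler_wpM2l.
have H2 : (1 - alpha P * (gamma P - 1)) * ln (rho y t) <= (1 - alpha P * (gamma P - 1)) * ln P0.
  by rewrite ler_wpM2l// subr_ge0.
rewrite /kap; lra.
Qed.

(** The mass equation expresses the divergence as minus the material derivative of ln rho. The
    heating terms then combine into rho theta times the material derivative of s. *)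
Lemma entropy_production_ray r t : kapbar P = 0 -> 0 < t < T -> 0 < r < rb t ->
  theR r t `^ alpha P * (2 * mubar P * (Ur r t ^+ 2 + 2 * (U r t / r) ^+ 2)
     + lambar P * (Ur r t + 2 * (U r t / r)) ^+ 2)
  = rhoR r t * theR r t * (on_ray entropy_dt r t + U r t * on_ray (entropy_dx 0) r t).
Proof.
move=> k0 tT rr; have tT' : 0 <= t <= T by case/andP: tT => /ltW -> /ltW ->.
have yb : eball (rb t) (ray r) by apply: ray_in_ball; case/andP: rr => /ltW -> ->.
have [rp tp] := fbp_pos sol tT' yb.
rewrite -(energy_ray sol reg tT rr k0).
have M : Ur r t + 2 * (U r t / r) = - (rhot r t + rhor r t * U r t) / rhoR r t.
  have := mass_ray sol reg tT rr => E.
  have -> : - (rhot r t + rhor r t * U r t) = rhoR r t * (Ur r t + 2 * (U r t / r)) by lra.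
  by rewrite mulrAC divff ?mul1r// lt0r_neq0.
rewrite M /on_ray /entropy_dt /entropy_dx /c_v; field.
by rewrite !lt0r_neq0// subr_gt0 adm_gamma.
Qed.

Definition finite_entropy_rate t : Prop :=
  (Linf_norm (eball (rb t)) (fun y => dt T s y t) < +oo)%E.

Lemma entropy_rate_bounded t : 0 < t < T -> finite_entropy_rate t ->
  exists N, forall y, eball (rb t) y -> `|entropy_dt y t| <= N.
Proof.
move=> tT fin; have tT' : 0 <= t <= T by case/andP: tT => /ltW -> /ltW ->.
exists (fine (Linf_norm (eball (rb t)) (fun y => dt T s y t))) => y yb.
rewrite -(dt_entropy tT yb).
apply: (@Linf_norm_le _ (eball (rb t)) (fun y => dt T s y t)).
- by rewrite fineK// ge0_fin_numE// Linf_norm_ge0.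
- exact: eball_nbhs.
- rewrite (dt_entropy tT yb).
  have c : (entropy_dt^~ t) @ y --> entropy_dt y t.
    apply: (cont_on_slice entropy_dt_cont) => //.
    by near=> z; split=> //=; near: z; exact: eball_nbhs.
  have nE : \forall z \near y, entropy_dt z t = dt T s z t.
    by near=> z; rewrite (dt_entropy tT)//; near: z; exact: eball_nbhs.
  exact: cvg_trans (near_eq_cvg nE) c.
Unshelve. all: by end_near. Qed.

Lemma closed_ray_cont (f : 'rV[R]_3 -> R -> R) t : 0 <= t <= T -> cont_on Omc f ->
  {within `[0, rb t], continuous (on_ray f ^~ t)}.
Proof.
move=> tT fc.
have gA r : [set` `[0, rb t]] r -> Omc (ray r, t).
  by rewrite /= in_itv/= => /andP[r0 rrb]; split=> //=; rewrite enorm_ray.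
have gc : {within `[0, rb t], continuous (fun r : R => (ray r, t))}.
  apply: continuous_subspaceT => r.
  by apply: (@cvg_pair _ _ _ (nbhs r) (nbhs (ray r)) (nbhs t)); [exact: continuous_ray|exact: cvg_cst].
exact: (within_comp gA gc fc).
Qed.

Lemma ray_sphere t : 0 <= t <= T -> esphere (rb t) (ray (rb t)).
Proof. by move=> tT; rewrite /esphere/= enorm_ray// ltW// (fbp_rb_pos sol). Qed.

Hypotheses (kap0 : kapbar P = 0) (bulk : 0 < 2 * mubar P + 3 * lambar P).
Hypothesis alphaP : alpha P <= 1 / (gamma P - 1).

(** In theta^alpha c q <= rho theta X the bound rho <= K theta^alpha cancels theta^alpha. What is
    left, c q <= K X theta, tends to 0 at the boundary by the vacuum condition. *)
Lemma velocity_flat t e : 0 < t < T -> finite_entropy_rate t -> 0 < e ->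
  exists2 d, 0 < d & forall r, 0 < r < rb t -> rb t - d < r ->
    `|Ur r t| <= e /\ `|U r t / r| <= e.
Proof.
move=> tT fin egt0; have tT' : 0 <= t <= T by case/andP: tT => /ltW -> /ltW ->.
have [N HN] := entropy_rate_bounded tT fin.
have [M1 HM1] := entropy_dx_bounded.
have [M2 HM2] := velocity_bounded.
have [K K0 HK] := rho_le_theta alphaP (lexx 1).
have [c cgt0 Hc] := dissipation_coercive (adm_mu adm) bulk.
have rbp : 0 < rb t by exact: fbp_rb_pos sol _ tT'.
(* Bounds the material derivative s_t + u s_r at time t. *)
pose X := `|N| + `|M2| * `|M1|.
have X0 : 0 <= X by rewrite addr_ge0// mulr_ge0.
have KX : 0 < K * X + 1 by rewrite ltr_wpDl// mulr_ge0// ltW.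
have [d1 d10 H1] : exists2 d, 0 < d & forall r : R, 0 < r < rb t -> rb t - d < r -> rhoR r t < 1.
  apply: (within_left_lt rbp (closed_ray_cont tT' (reg_rho_cl reg))).
  by rewrite /on_ray (fbp_vacuum sol tT' (ray_sphere tT')).1.
have [d2 d20 H2] : exists2 d, 0 < d & forall r : R, 0 < r < rb t -> rb t - d < r ->
    theR r t < c * e ^+ 2 / (K * X + 1).
  apply: (within_left_lt rbp (closed_ray_cont tT' (reg_theta_cl reg))).
  by rewrite /on_ray (fbp_vacuum sol tT' (ray_sphere tT')).2 divr_gt0// mulr_gt0// exprn_gt0.
exists (Num.min d1 d2) => [|r rr]; first by rewrite lt_min d10.
rewrite ltrBlDr => dr.
have {}H1 : rhoR r t < 1.
  by apply: H1 => //; rewrite ltrBlDr (lt_le_trans dr)// lerD2l ge_min lexx.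
have {}H2 : theR r t < c * e ^+ 2 / (K * X + 1).
  by apply: H2 => //; rewrite ltrBlDr (lt_le_trans dr)// lerD2l ge_min lexx orbT.
have yb : eball (rb t) (ray r) by apply: ray_in_ball; case/andP: rr => /ltW -> ->.
have [rp tp] := fbp_pos sol tT' yb.
have Thp : 0 < theR r t `^ alpha P by rewrite powR_gt0.
have rK : rhoR r t <= K * theR r t `^ alpha P by apply: HK => //; exact: ltW.
have HX : on_ray entropy_dt r t + U r t * on_ray (entropy_dx 0) r t <= X.
  apply: lerD; first by apply: le_trans (ler_norm _) (le_trans (HN _ yb) (ler_norm _)).
  apply: le_trans (ler_norm _) _; rewrite normrM.
  have [h2 _ _] := HM2 _ _ tT' yb; have h1 := HM1 _ _ tT' yb.
  by apply: ler_pM => //; [exact: le_trans h2 (ler_norm _)|exact: le_trans h1 (ler_norm _)].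
set q := Ur r t ^+ 2 + (U r t / r) ^+ 2.
have E := entropy_production_ray kap0 tT rr.
have Q1 : c * q <= K * X * theR r t.
  rewrite -(ler_pM2l Thp).
  have E2 : theR r t `^ alpha P * (c * q) <= rhoR r t * theR r t * X.
    have : theR r t `^ alpha P * (c * q) <= rhoR r t * theR r t *
        (on_ray entropy_dt r t + U r t * on_ray (entropy_dx 0) r t).
      by rewrite -E ler_pM2l//; exact: Hc.
    by move=> /le_trans; apply; rewrite ler_pM2l// mulr_gt0.
  apply: (le_trans E2).
  have : rhoR r t * (theR r t * X) <= K * theR r t `^ alpha P * (theR r t * X).
    by rewrite ler_wpM2r// mulr_ge0// ltW.
  lra.
have q_le : q <= e ^+ 2.
  rewrite -(ler_pM2l cgt0); apply: (le_trans Q1).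
  apply: (@le_trans _ _ ((K * X + 1) * theR r t)); first by rewrite ler_pM2r// lerDl.
  by rewrite mulrC -ler_pdivlMr// ltW.
have sq (a : R) : a ^+ 2 <= e ^+ 2 -> `|a| <= e.
  by move=> ae; rewrite -(@ler_pXn2r _ 2)// ?nnegrE//;
    [rewrite real_normK ?num_real|exact: ltW].
split; apply: sq; apply: le_trans q_le; rewrite /q.
  by rewrite lerDl sqr_ge0.
by rewrite lerDr sqr_ge0.
Qed.

Lemma good_time a b : 0 <= a -> a < b -> b <= T ->
  exists2 t, a < t < b & finite_entropy_rate t.
Proof.
move=> a0 ab bT.
exact: (in_L2_time_finite (fun t => Linf_norm_ge0 _ _) (reg_st rent) a0 ab bT).
Qed.

(** U / r tends to 0 at the boundary by [velocity_flat], and U is continuous up to it. *)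
Lemma velocity_boundary_good t : 0 < t < T -> finite_entropy_rate t -> U (rb t) t = 0.
Proof.
move=> tT fin; have tT' : 0 <= t <= T by case/andP: tT => /ltW -> /ltW ->.
have rbp : 0 < rb t by exact: fbp_rb_pos sol _ tT'.
apply/eqP; rewrite -normr_eq0 eq_le normr_ge0 andbT leNgt; apply/negP => Up.
pose e := `|U (rb t) t| / 2 / rb t.
have egt0 : 0 < e by rewrite !divr_gt0.
have [d1 d10 H1] := velocity_flat tT fin egt0.
have UC := closed_ray_cont tT' (@reg_u_cl _ _ _ _ _ _ reg 0).
have nUC : {within `[0, rb t], continuous (fun r => - `|U r t|)}.
  by apply: withinN; move=> r; exact: (cvg_norm (UC r)).
have [d2 d20 H2] : exists2 d, 0 < d & forall r : R, 0 < r < rb t -> rb t - d < r ->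
    - `|U r t| < - (`|U (rb t) t| / 2).
  apply: (within_left_lt rbp nUC).
  by rewrite ltrN2 ltr_pdivrMr// ltr_pMr// ltr1n.
pose r := Num.max (rb t / 2) (Num.max (rb t - d1 / 2) (rb t - d2 / 2)).
have rr : 0 < r < rb t.
  by rewrite lt_max divr_gt0//= !gt_max; apply/and3P; split; lra.
have r1 : rb t - d1 < r by rewrite !lt_max; apply/orP; right; apply/orP; left; lra.
have r2 : rb t - d2 < r by rewrite !lt_max; apply/orP; right; apply/orP; right; lra.
have [_ h1] := H1 r rr r1; have := H2 r rr r2; rewrite ltrN2.
have [r0 rrb] := andP rr.
move: h1; rewrite normrM normfV (gtr0_norm r0) ler_pdivrMr// => h1.
apply/negP; rewrite -leNgt (le_trans h1)//.
have -> : e * r = `|U (rb t) t| / 2 * (r / rb t) by rewrite /e; ring.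
by rewrite ler_piMr ?divr_ge0// ler_pdivrMr// mul1r ltW.
Qed.

(** The boundary velocity is continuous in time and vanishes on a dense set of times by
    [good_time]. *)
Lemma velocity_boundary t : 0 <= t <= T -> U (rb t) t = 0.
Proof.
move=> tT; apply/eqP; rewrite -normr_eq0 eq_le normr_ge0 andbT leNgt; apply/negP => Up.
have gA q : [set` `[0, T]] q -> Omc (ray (rb q), q).
  rewrite /= in_itv/= => qT; split=> //=; rewrite enorm_ray// ltW//.
  exact: fbp_rb_pos sol _ qT.
have gc : {within `[0, T], continuous (fun q : R => (ray (rb q), q))}.
  apply/subspace_continuousP => q qT.
  apply: (@cvg_pair _ _ _ (within [set` `[0, T]] (nbhs q)) (nbhs (ray (rb q))) (nbhs q)).
    move/subspace_continuousP : rb_cont => /(_ _ qT) c.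
    exact: (cvg_comp _ _ c (@continuous_ray R (rb q))).
  exact: cvg_within.
have /subspace_continuousP c : {within `[0, T], continuous (fun q => `|U (rb q) q|)}.
  have c1 : {within `[0, T], continuous (fun q => U (rb q) q)}.
    exact: (within_comp gA gc (@reg_u_cl _ _ _ _ _ _ reg 0)).
  by move=> q; exact: (cvg_norm (c1 q)).
have tin : [set` `[0, T]] t by rewrite /= in_itv.
have : \forall q \near t, [set` `[0, T]] q -> 0 < `|U (rb q) q|.
  exact: (cvgr_gt _ (c _ tin) _ Up).
move=> /nbhs_ballP[e /= egt0 He].
pose a := Num.max 0 (t - e); pose b := Num.min T (t + e).
have ab : a < b.
  rewrite lt_min !gt_max T0 -andbA; case/andP: tT => ? ?.
  by apply/and4P; split; lra.
have [||q /andP[aq qb] fin] := good_time _ ab.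
- by rewrite le_max lexx.
- by rewrite ge_min lexx.
move: aq qb; rewrite gt_max lt_min => /andP[q0 q1] /andP[qT q2].
have qT' : 0 < q < T by rewrite q0.
have := He q; rewrite (velocity_boundary_good qT' fin) normr0 ltxx => H.
suff : false by [].
apply: H.
  by rewrite /ball/= ltr_norml; apply/andP; split; lra.
by rewrite /= in_itv/= !ltW.
Qed.

Lemma rb_const t : 0 <= t <= T -> rb t = 1.
Proof.
move=> tT; rewrite -(fbp_rb0 sol).
have := tT; case/andP; rewrite le_eqVlt => /predU1P[<-//|t0] tleT.
have [||q] := @MVT R rb (fun=> 0) 0 t t0; last by move=> _; rewrite mul0r => /eqP; rewrite subr_eq0 => /eqP.
- move=> q; rewrite in_itv/= => /andP[q0 qt].
  have qT : 0 < q < T by rewrite q0 (lt_le_trans qt).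
  have qT' : 0 <= q <= T by case/andP: qT => /ltW -> /ltW ->.
  have [rbd kin] := fbp_kinematic sol qT'.
  apply: (is_derive_eq (tderiv_is_derive qT rbd)).
  rewrite (kin _ (ray_sphere qT')) radial_ray; last exact: fbp_rb_pos sol _ qT'.
  by rewrite dotv_evec; exact: velocity_boundary.
- apply: continuous_subspaceW rb_cont => q /=; rewrite !in_itv/= => /andP[-> /le_trans->]//.
Qed.

End EntropyFlow.

(** * Initial profile and non-existence *)

Section Profile.
Variables (R : realType) (C1 C2 delta : R) (rho0 : 'rV[R]_3 -> R).
Hypotheses (hC1 : 0 < C1) (hC2 : 0 < C2) (delta0 : 0 < delta).
Hypothesis prof : boundary_profile C1 C2 delta rho0.
Hypothesis rho0_gt0 : forall y, eball 1 y -> 0 < rho0 y.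

(** The point [ray 1] is a competitor in the infimum. The upper bound is the useful direction, as it
    makes 1 / d at least 1 / (1 - r). *)
Lemma dist_sphere_ray (r : R) : r <= 1 ->
  0 <= dist_to (esphere 1) (ray r) <= 1 - r.
Proof.
move=> r1; have E : enorm (ray r - ray 1) = 1 - r.
  have -> : ray r - ray 1 = - ray (1 - r) by rewrite /ray scalerBl opprB.
  rewrite -[RHS](@enorm_ray R) ?subr_ge0// /enorm; congr Num.sqrt.
  by rewrite /dotv; apply: eq_bigr => i _; rewrite !mxE mulrNN.
have s1 : esphere 1 (ray (1 : R)) by rewrite /esphere/= enorm_ray.
apply/andP; split.
  apply: lb_le_inf; first by exists (enorm (ray r - ray 1)), (ray 1).
  by move=> _ [z _ <-]; exact: sqrtr_ge0.
apply: ge_inf; last by rewrite -E; exists (ray 1).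
by exists 0 => _ [z _ <-]; exact: sqrtr_ge0.
Qed.

(** Dividing the lower bound on the gradient by the upper bound on rho0 cancels d^delta and leaves a
    logarithmic slope above 1 / (C1 C2 d). *)
Lemma profile_ray : exists2 e, 0 < e & forall r : R, 0 < r < 1 -> 1 - e < r ->
  (C1 * C2)^-1 / (1 - r) * rho0 (ray r) < `|'D_(evec R 0) rho0 (ray r)|.
Proof.
have [V [oV sV HV]] := prof.
have V1 : nbhs (ray (1 : R)) V.
  by apply: open_nbhs_nbhs; split=> //; apply: sV; rewrite /esphere/= enorm_ray.
have : \forall r \near (1 : R), V (ray r) by exact: (@continuous_ray R 1 _ V1).
move=> /nbhs_ballP[e /= e0 He]; exists e => // r /andP[r0 r1] er.
have yV : V (ray r) by apply: He; rewrite /ball/= ltr_norml; apply/andP; split; lra.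
have yb : eball 1 (ray r) by rewrite /eball/= enorm_ray// ltW.
have rp := rho0_gt0 yb.
have := HV _ yb yV; rewrite radial_ray//=; set d := dist_to _ _.
have /andP[d0 d1] : 0 <= d <= 1 - r by apply: dist_sphere_ray; exact: ltW.
move=> [/andP[_ h2] _ /andP[h3 _]].
(* At d = 0 the upper bound would read rho0 < 0, because 0 to the positive power delta is 0. *)
have dp : 0 < d.
  rewrite lt_neqAle d0 andbT; apply/eqP => dE; move: h2.
  by rewrite -dE powR0 ?gt_eqF// mulr0 ltNge (ltW rp).
apply: le_lt_trans h3.
have dE : d `^ (delta - 1) = d `^ delta / d.
  by rewrite powRB ?powRr1 ?(ltW dp)// (gt_eqF dp) implybT.
have r1' : 0 < 1 - r by rewrite subr_gt0.
have -> : (C1 * C2)^-1 / (1 - r) * rho0 (ray r) = C2^-1 * (rho0 (ray r) / C1 * (1 - r)^-1).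
  by rewrite invfM; ring.
rewrite dE ler_pM2l ?invr_gt0//; apply: ler_pM.
- by rewrite divr_ge0 ?ltW.
- by rewrite invr_ge0 ltW.
- by rewrite ler_pdivrMr// mulrC ltW.
- by rewrite lef_pV2 ?posrE.
Qed.

End Profile.

(** * From a solution of the free boundary problem to a radial flow *)

Section NonExistence.
Variables (R : realType) (P : fluid R) (T : R).
Variables (rho0 : 'rV[R]_3 -> R) (u0 : 'rV[R]_3 -> 'rV[R]_3) (theta0 : 'rV[R]_3 -> R).
Variables (rb : R -> R) (rho : 'rV[R]_3 -> R -> R) (u : 'rV[R]_3 -> R -> 'rV[R]_3)
  (theta s : 'rV[R]_3 -> R -> R).
Hypothesis sol : FBP_solution P T rho0 u0 theta0 rb rho u theta.
Hypothesis reg : regular_flow T rb rho u theta.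
Hypothesis ent : is_entropy P T rb rho theta s.
Hypothesis rent : regular_entropy T rb s.
Hypothesis adm : admissible P.
Hypothesis T0 : 0 < T.
Hypotheses (kap0 : kapbar P = 0) (bulk : 0 < 2 * mubar P + 3 * lambar P).
Hypothesis alphaP : alpha P <= 1 / (gamma P - 1).
Implicit Types (r t : R) (y : 'rV[R]_3).

Local Notation Om := (tube T (fun t => eball (rb t))).
Local Notation Omc := (tube T (fun t => [set y | enorm y <= rb t])).
Local Notation U := (on_ray (vcoord u 0)).
Local Notation Ur := (on_ray (dx 0 (vcoord u 0))).
Local Notation Urr := (on_ray (dx 0 (dx 0 (vcoord u 0)))).
Local Notation Ut := (on_ray (dt T (vcoord u 0))).
Local Notation rhoR := (on_ray rho).
Local Notation rhor := (on_ray (dx 0 rho)).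
Local Notation rhot := (on_ray (dt T rho)).
Local Notation theR := (on_ray theta).
Local Notation ther := (on_ray (dx 0 theta)).

Let Th r t := theR r t `^ alpha P.
Let Thr r t := alpha P * theR r t `^ (alpha P - 1) * ther r t.
Let p_r r t := Rg P * (rhor r t * theR r t + rhoR r t * ther r t).

Let rb1 t : 0 <= t <= T -> rb t = 1.
Proof. exact: (rb_const sol reg ent rent adm T0 kap0 bulk alphaP). Qed.

Let ray_itv r t : 2^-1 < r < 1 -> 0 <= t <= T -> 0 < r < rb t.
Proof.
move=> /andP[r1 r2] tT; rewrite rb1// r2 andbT (lt_trans _ r1)//.
Qed.

Let ray_ball r t : 2^-1 <= r < 1 -> 0 <= t <= T -> eball (rb t) (ray r).
Proof.
move=> /andP[r1 r2] tT; apply: ray_in_ball; rewrite rb1// r2 andbT (le_trans _ r1)//.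
Qed.

Let ray2_cont : continuous (fun z : R * R => (ray z.1, z.2)).
Proof.
move=> z; apply: (@cvg_pair _ _ _ (nbhs z) (nbhs (ray z.1)) (nbhs z.2)); last exact: cvg_snd.
exact: (cvg_comp _ _ (@cvg_fst _ _ (nbhs z.1) (nbhs z.2) _) (@continuous_ray R z.1)).
Qed.

Lemma shell_cont f : cont_on Om f -> cont2 (shell T) (on_ray f).
Proof.
move=> fc; have gA (z : R * R) : shell T z -> Om (ray z.1, z.2).
  by case: z => r t [/= rr tT]; split=> //; exact: ray_ball.
exact: (within_comp gA (continuous_subspaceT ray2_cont) fc).
Qed.

Lemma shell_closed_cont f : cont_on Omc f -> cont2 (shell_closed T) (on_ray f).
Proof.
move=> fc; have gA (z : R * R) : shell_closed T z -> Omc (ray z.1, z.2).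
  case: z => r t [/= /andP[r1 r2] tT]; split=> //=.
  by rewrite rb1// enorm_ray// (le_trans _ r1).
exact: (within_comp gA (continuous_subspaceT ray2_cont) fc).
Qed.

Lemma solution_radial_flow : exists B K,
  radial_flow T rhoR U Th p_r Thr rhor Ur Urr rhot Ut
    (2 * mubar P + lambar P) (lambar P) B K.
Proof.
have CU := (reg_u reg 0).1; have CU1 := C_space_dx 0 CU; have CU2 := C_space_dx 0 CU1.
have Crho := (reg_rho reg).1; have Cth := (reg_theta reg).1.
have rhoC := shell_closed_cont (reg_rho_cl reg).
have UC := shell_closed_cont (@reg_u_cl _ _ _ _ _ _ reg 0).
have thC : cont2 (shell T) theR := shell_cont (C_space_cont Cth).
have rhoC' : cont2 (shell T) rhoR := shell_cont (C_space_cont Crho).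
have therC : cont2 (shell T) ther := shell_cont (C_space_cont (C_space_dx 0 Cth)).
have rhorC : cont2 (shell T) rhor := shell_cont (C_space_cont (C_space_dx 0 Crho)).
have th_pos (z : R * R) : shell T z -> 0 < theR z.1 z.2.
  case: z => r t [/= rr tT]; exact: (fbp_pos sol tT (ray_ball rr tT)).2.
(* The comparison of rho with theta^alpha requires a cap on the density; it comes from continuity on
   the compact closed shell. *)
have [P0 [P01 HP0]] : exists P0, 1 <= P0 /\ forall r t, 2^-1 < r < 1 -> 0 <= t <= T ->
    rhoR r t <= P0.
  pose A : set (R * R) := `[2^-1, 1] `*` `[0, T].
  have AE : A = shell_closed T.
    by apply/seteqP; split => -[x y]; rewrite /A /shell_closed /= !in_itv.
  have A0 : A !=set0.
    exists (1, 0); split; rewrite /= in_itv/= lexx ?andbT ?(ltW T0)//.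
    by rewrite invf_le1 ?ler1n.
  have cA : compact A by apply: compact_setX; exact: segment_compact.
  have cf : {within A, continuous (fun z : R * R => rhoR z.1 z.2)} by rewrite AE.
  have [c _ Hc] := compact_EVT_max A0 cA cf.
  exists (Num.max 1 (rhoR c.1 c.2)); split; first by rewrite le_max lexx.
  move=> r t /andP[r1 r2] tT; rewrite le_max; apply/orP; right.
  by apply: (Hc (r, t)); rewrite inE AE; split=> //=; rewrite !ltW.
have [K _ HK] := rho_le_theta sol reg ent rent adm T0 alphaP P01.
have [B HB] := velocity_bounded sol reg T0.
exists B, K; split => //.
- exact: shell_cont (C_space_cont CU1).
- exact: shell_cont (C_space_cont CU2).
- exact: within_powR.
- apply: withinM => //; apply: withinM; first exact: within_cst.
  exact: within_powR.
- apply: withinM; first exact: within_cst.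
  by apply: withinD; exact: withinM.
- by move=> r t rr tT; exact: (space_derive_ray Crho tT (ray_itv rr tT)).
- by move=> r t rr tT; exact: (space_derive_ray CU tT (ray_itv rr tT)).
- by move=> r t rr tT; exact: (space_derive_ray CU1 tT (ray_itv rr tT)).
- move=> r t rr tT; have tT' : 0 <= t <= T by case/andP: tT => /ltW -> /ltW ->.
  exact: (time_derive_ray (reg_rho reg).2 tT (ray_itv rr tT')).
- move=> r t rr tT; have tT' : 0 <= t <= T by case/andP: tT => /ltW -> /ltW ->.
  exact: (time_derive_ray (reg_u reg 0).2 tT (ray_itv rr tT')).
- move=> r t rr tT; have tT' : 0 <= t <= T by case/andP: tT => /ltW -> /ltW ->.
  exact: (mass_ray sol reg tT (ray_itv rr tT')).
- move=> r t rr tT; have tT' : 0 <= t <= T by case/andP: tT => /ltW -> /ltW ->.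
  exact: (momentum_ray sol reg tT (ray_itv rr tT')).
- move=> r t /andP[/ltW r1 r2] tT.
  by apply: (fbp_pos sol tT (ray_ball _ tT)).1; rewrite r1.
- by move=> r t /andP[/ltW r1 r2] tT; apply: powR_gt0; apply: (th_pos (r, t)); split=> //=; rewrite r1.
- by move=> t tT; have := fbp_vacuum sol tT (ray_sphere sol tT); rewrite rb1// => -[].
- by move=> t tT; have := velocity_boundary sol reg ent rent adm T0 kap0 bulk alphaP tT; rewrite rb1.
- move=> r t /andP[/ltW r1 r2] tT; have tT' : 0 <= t <= T by case/andP: tT => /ltW -> /ltW ->.
  by apply: (HB _ _ tT' (ray_ball _ tT')); rewrite r1.
- move=> r t rr tT; have tT' : 0 <= t <= T by case/andP: tT => /ltW -> /ltW ->.
  apply: HK => //; last exact: HP0.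
  by case/andP: rr => /ltW r1 r2; apply: ray_ball => //; rewrite r1.
Qed.

(** The logarithmic slope of theta is gamma - 1 times that of rho, up to |M1| / c_v = (gamma - 1)
    |M1| / Rg from the entropy gradient. With M = |M1| / Rg + 1 it is at most -(gamma - 1), so
    density and temperature both decrease outwards. *)
Lemma steep_density_source : exists2 M, 0 < M & forall r t, 2^-1 < r < 1 -> 0 <= t <= T ->
  rhor r t <= - M * rhoR r t -> p_r r t < 0 /\ Thr r t <= 0.
Proof.
have [M1 HM1] := entropy_dx_bounded sol reg ent rent adm T0.
have Rp := adm_Rg adm; have g1 : 0 < gamma P - 1 by rewrite subr_gt0 adm_gamma.
have cv0 := cv_gt0 adm.
pose M := `|M1| / Rg P + 1.
have M0 : 0 < M by rewrite ltr_wpDl// divr_ge0// ltW.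
exists M => // r t rr tT steep.
have yb : eball (rb t) (ray r) by apply: ray_ball => //; case/andP: rr => /ltW -> ->.
have [rp tp] := fbp_pos sol tT yb.
have rho_neg : rhor r t < 0.
  by rewrite (le_lt_trans steep)// mulNr oppr_lt0 mulr_gt0.
have q1 : rhor r t / rhoR r t <= - M by rewrite ler_pdivrMr.
have H : c_v P * (ther r t / theR r t - (gamma P - 1) * (rhor r t / rhoR r t)) <= `|M1|.
  exact: le_trans (ler_norm _) (le_trans (HM1 _ _ tT yb) (ler_norm _)).
have th_neg : ther r t / theR r t < 0.
  have : ther r t / theR r t <= `|M1| / c_v P + (gamma P - 1) * (rhor r t / rhoR r t).
    by rewrite -lerBlDr ler_pdivlMr// mulrC.
  have : (gamma P - 1) * (rhor r t / rhoR r t) <= (gamma P - 1) * - M by rewrite ler_pM2l.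
  have -> : `|M1| / c_v P = (gamma P - 1) * (M - 1).
    by rewrite /M addrK /c_v; field; rewrite !lt0r_neq0.
  lra.
have {}th_neg : ther r t < 0 by move: th_neg; rewrite pmulr_llt0// invr_gt0.
split.
  rewrite /p_r pmulr_rlt0//.
  have : rhor r t * theR r t < 0 by rewrite nmulr_rlt0.
  have : rhoR r t * ther r t < 0 by rewrite pmulr_rlt0.
  lra.
apply: mulr_ge0_le0; last exact: ltW.
by apply: mulr_ge0; [exact: adm_alpha|exact: powR_ge0].
Qed.

(** The profile controls only the modulus of the slope. Near the boundary the slope is continuous
    and never zero, hence of constant sign; it is negative somewhere because the positive density
    falls to 0 at r = 1. *)
Lemma initial_density_gradient (C1 C2 delta : R) : 0 < C1 -> 0 < C2 -> 0 < delta ->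
  boundary_profile C1 C2 delta rho0 -> (forall y, eball 1 y -> 0 < rho0 y) ->
  exists2 e, 0 < e & forall r, 2^-1 < r < 1 -> 1 - e < r ->
    rhor r 0 <= - ((C1 * C2)^-1 / (1 - r)) * rhoR r 0.
Proof.
move=> hC1 hC2 d0 prof rho0p; have [e e0 He] := profile_ray hC1 hC2 d0 prof rho0p.
have z0 : 0 <= (0 : R) <= T by rewrite lexx ltW.
have half0 : 0 < (2^-1 : R) by rewrite invr_gt0.
have C0 : 0 < (C1 * C2)^-1 by rewrite invr_gt0 mulr_gt0.
exists e => // r rr er.
have big q : 2^-1 < q < 1 -> 1 - e < q ->
    (C1 * C2)^-1 / (1 - q) * rhoR q 0 < `|rhor q 0|.
  move=> /andP[q1 q2] eq; have q0 : 0 < q by exact: lt_trans q1.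
  have yb : eball 1 (ray q) by rewrite /eball/= enorm_ray// ltW.
  have := He q; rewrite q0 q2 => /(_ erefl eq).
  have [<- _ _] := fbp_init sol yb.
  rewrite (_ : 'D_(evec R 0) rho0 (ray q) = rhor q 0)//.
  apply: near_eq_derive; near=> z; have zb : eball 1 z by near: z; exact: eball_nbhs.
  by have [-> _ _] := fbp_init sol zb.
have rho_pos q : 2^-1 < q < 1 -> 0 < rhoR q 0.
  move=> /andP[/ltW q1 q2].
  by apply: (fbp_pos sol z0 (ray_ball _ z0)).1; rewrite q1.
have nz q : 2^-1 < q < 1 -> 1 - e < q -> rhor q 0 != 0.
  move=> qq eq; rewrite -normr_gt0 (lt_trans _ (big q qq eq))// !mulr_gt0 ?rho_pos//.
  by rewrite invr_gt0 subr_gt0; case/andP: qq.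
suff neg : rhor r 0 < 0.
  by have := big r rr er; rewrite ltr0_norm// ltrNr mulNr => /ltW.
rewrite ltNge; apply/negP => rpos; have [r1 r2] := andP rr.
have itv q : r <= q < 1 -> 2^-1 < q < 1 by move=> /andP[rq ->]; rewrite (lt_le_trans r1).
have Crho := (reg_rho reg).1.
have [||c cin E] := @MVT R (rhoR^~ 0) (rhor^~ 0) r 1 r2.
- move=> q; rewrite in_itv/= => /andP[rq q1]; apply: (space_derive_ray Crho z0).
  by apply: ray_itv => //; apply: itv; rewrite (ltW rq).
- apply: (within_slice (shell_closed_cont (reg_rho_cl reg))) => q /=.
  rewrite in_itv/= => /andP[rq q1]; split=> //=.
  by rewrite q1 andbT (le_trans (ltW r1)).
have v1 : rhoR 1 0 = 0.
  by have := fbp_vacuum sol z0 (ray_sphere sol z0); rewrite rb1// => -[].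
move: cin; rewrite in_itv/= => /andP[rc c1].
have cneg : rhor c 0 < 0.
  have : rhor c 0 * (1 - r) < 0 by rewrite -E v1 sub0r oppr_lt0 rho_pos.
  by rewrite pmulr_llt0// subr_gt0.
have [||q qin q0] := @IVT R (rhor^~ 0) r c 0 (ltW rc).
- apply: (within_slice (shell_cont (C_space_cont (C_space_dx 0 Crho)))) => q /=.
  rewrite in_itv/= => /andP[rq qc]; split=> //=.
  by rewrite (le_lt_trans qc) ?(le_trans (ltW r1)).
- by rewrite ge_min le_max (ltW cneg) rpos orbT.
move: qin; rewrite in_itv/= => /andP[rq qc].
have qq : 2^-1 < q < 1 by apply: itv; rewrite rq (le_lt_trans qc).
by have := nz q qq (lt_le_trans er rq); rewrite q0 eqxx.
Unshelve. all: by end_near. Qed.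

Lemma initial_velocity_ge0 r r0 : r0 < r -> 2^-1 < r < 1 ->
  (forall y, r0 < enorm y < 1 -> 0 <= dotv (radial y) (u0 y)) -> 0 <= U r 0.
Proof.
move=> r0r /andP[r1 r2] H; have rp : 0 < r by rewrite (lt_trans _ r1)// invr_gt0.
have er : enorm (ray r) = r by rewrite enorm_ray// ltW.
have yb : eball 1 (ray r) by rewrite /eball/= er.
have := H (ray r); rewrite er r0r r2 radial_ray// dotvC dotv_evec => /(_ erefl).
by have [_ <- _] := fbp_init sol yb.
Qed.

Lemma solution_absurd (C1 C2 delta r0 : R) : 0 < C1 -> 0 < C2 -> 0 < delta ->
  boundary_profile C1 C2 delta rho0 -> (forall y, eball 1 y -> 0 < rho0 y) ->
  r0 < 1 -> (forall y, r0 < enorm y < 1 -> 0 <= dotv (radial y) (u0 y)) -> False.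
Proof.
move=> hC1 hC2 d0 prof rho0p r01 u0p.
have [B [K flow]] := solution_radial_flow.
have [M M0 source] := steep_density_source.
have [e e0 grad] := initial_density_gradient hC1 hC2 d0 prof rho0p.
have nu0 : 0 < 2 * mubar P + lambar P by have := adm_mu adm; have := bulk; lra.
have bulk' : 0 < 2 * mubar P + lambar P + 2 * lambar P by have := bulk; lra.
have C0 : 0 < (C1 * C2)^-1 by rewrite invr_gt0 mulr_gt0.
(* The minimum with 1 - r0 confines the argument to r > r0, where the initial radial velocity is
   nonnegative. *)
apply: (@radial_flow_absurd R T rhoR U Th p_r Thr rhor Ur Urr rhot Ut _ _ B K M
  (C1 * C2)^-1 (Num.min e (1 - r0)) T0 nu0 bulk' flow M0 source C0).
- by rewrite lt_min e0 subr_gt0.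
- move=> r rr er; apply: grad => //; apply: le_lt_trans er.
  by rewrite lerD2l lerN2 ge_min lexx.
- move=> r rr er; apply: (@initial_velocity_ge0 r r0) => //.
  apply: le_lt_trans er; rewrite lerBrDl -lerBrDr ge_min lexx orbT//.
- move=> tau /andP[tau0 tauT].
  have [t2 /andP[t20 t2tau] fin] := good_time rent (lexx 0) tau0 (ltW tauT).
  exists t2; first by rewrite t20.
  have t2T : 0 < t2 < T by rewrite t20 (lt_trans t2tau).
  have t2T' : 0 <= t2 <= T by case/andP: t2T => /ltW -> /ltW ->.
  move=> eps eps0.
  have [d d1 Hd] := velocity_flat sol reg ent rent adm T0 kap0 bulk alphaP t2T fin eps0.
  exists d => // r rr dr.
  by have [] := Hd r; rewrite ?rb1// -(rb1 t2T'); exact: ray_itv.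
Qed.

End NonExistence.

Theorem theorem1p1 (R : realType) (C1 C2 : R) (hC1 : 0 < C1) (hC2 : 0 < C2) :
  exists d0 : R, 0 < d0 < 1 /\
  forall (P : fluid R) (delta : R)
         (rho0 : 'rV[R]_3 -> R) (u0 : 'rV[R]_3 -> 'rV[R]_3)
         (theta0 : 'rV[R]_3 -> R),
    admissible P ->
    0 < 2 * mubar P + 3 * lambar P ->
    kapbar P = 0 ->
    alpha P <= 1 / (gamma P - 1) ->
    0 < delta ->
    initial_data rho0 theta0 ->
    boundary_profile C1 C2 delta rho0 ->
    (exists r0 : R, [/\ 1 - d0 < r0 < 1,
       forall y, enorm y = r0 -> 0 < dotv (radial y) (u0 y) &
       forall y, r0 < enorm y < 1 -> 0 <= dotv (radial y) (u0 y)]) ->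
    forall T : R, 0 < T ->
    ~ exists (rb : R -> R) (rho : 'rV[R]_3 -> R -> R)
             (u : 'rV[R]_3 -> R -> 'rV[R]_3)
             (theta s : 'rV[R]_3 -> R -> R),
        [/\ FBP_solution P T rho0 u0 theta0 rb rho u theta,
            regular_flow T rb rho u theta,
            is_entropy P T rb rho theta s &
            regular_entropy T rb s].
Proof.
(* The argument takes place in a layer next to the sphere, chosen inside |y| > r0 once r0 < 1 is
   given; so 1/2 serves for all C1 and C2. *)
exists 2^-1; split; first by rewrite invr_gt0 ltr0n/= invf_lt1 ?ltr1n ?ltr0n.
move=> P delta rho0 u0 theta0 adm bulk kap0 alphaP delta0 init prof.
move=> [r0 [/andP[_ r01] _ u0_ge0]] T T0 [rb [rho [u [theta [s [sol reg ent rent]]]]]].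
apply: (solution_absurd sol reg ent rent adm T0 kap0 bulk alphaP hC1 hC2 delta0 prof _ r01 u0_ge0).
by move=> y /(init_pos init)[].
Qed.
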